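(* Let $G=G_0,\dots,G_r$ be the reduction series of a graph $G$. The mapping $\Phi_i:\mathrm{Aut}(G_i)\to\mathrm{Aut}(G_{i+1})$, $0\le i<r$, satisfies the following: (a) The mapping $\Phi_i$ is a group homomorphism. (b) The mapping $\Phi_i$ is an epimorphism, i.e., it is surjective. (c) For a semiregular subgroup $\Gamma$ of $\mathrm{Aut}(G_i)$, the restriction $\Phi_i|_\Gamma$ is an isomorphism (onto its image $\Phi_i(\Gamma)$). Moreover, the subgroup $\Phi_i(\Gamma)$ remains semiregular in $\mathrm{Aut}(G_{i+1})$.
   Context: GRAPHS. A graph is a tuple $(D,V,\iota,\lambda)$ with $D$ a finite set of darts, $V$ a finite set of vertices, $\iota:D\to V$ a partial function (incidence) and $\lambda:D\to D$ an involution. Edges are the orbits $\{d,\lambda d\}$ of $\lambda$ of size 2, half-edges are the orbits of size 1. An edge is standard if $\iota(d),\iota(\lambda d)$ are defined and distinct, a loop if they are defined and equal, pendant if exactly one is defined, free if none is defined. A pendant edge at $v$ is single if it is the only pendant edge attached to $v$. Edges are colored and have one of three types: halvable, undirected, directed (the latter with an orientation); pendant edges are undirected. The graph $G$ is connected, without loops and half-edges. When vertices are removed, their incident edges are kept as pendant or free edges; a free edge is a connected component. Automorphisms and isomorphisms are bijections on vertices and darts that commute with $\iota$ and $\lambda$ and preserve colors, types and orientations of edges; $\mathrm{Aut}(G)$ is the automorphism group. SEMIREGULARITY. A group of automorphisms is semiregular if stabilizers of all vertices, darts and non-halvable edges are trivial; a halvable edge may be fixed by an involution interchanging its two darts. An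 automorphism $\pi$ is semiregular if $\langle\pi\rangle$ is. BLOCK-TREE. An articulation is a vertex $u$ with $G\setminus u$ disconnected. Blocks are the maximal 2-connected subgraphs, where bridge-edges and pendant edges also count as blocks. The block-tree is the incidence graph between articulations and blocks; its center is a single vertex, called the central articulation or the central block ($K_1$, possibly with one pendant edge, is regarded as having a central articulation). The tree is rooted at its center; the rooted subtree determined by a node $x$ consists of $x$ and all nodes whose path to the center passes through $x$. ATOMS. For a subgraph $A$, $\partial A$ is the set of vertices of $A$ incident with an edge not in $A$, and $\mathring A=A\setminus\partial A$. Parts are the following subgraphs. Block part: the union $S$ of all blocks in the rooted subtree determined by a node other than the central block, where $S$ is not a single pendant edge. Proper part: given a block $B$ and a 2-cut $U=\{u,v\}$ of $B$ (i.e. $B\setminus U$ has at least two connected components containing vertices) with $u,v$ of degree at least 3 in $B$, the subgraph consisting of $u,v$ and a connected component $K$ of $G\setminus U$ that contains a component of $B\setminus U$ (with the edges joining $K$ to $U$), where $K$ is not a single free edge and $K$ does not contain all vertices of the central block or the central articulation. Dipole part (dipole): two vertices with all edges joining them, there being at least two such edges. Atoms are the inclusion-minimal parts: block atoms, proper atoms, dipoles. The boundary $\partial A$ is: the articulation at which $A$ is attached for a block atom (the center, for a star of pendant edges); $U$ for a proper atom; the two vertices for a dipole. A graph is primitive if it has no atoms. SYMMETRY TYPES. $\mathrm{Aut}_{\partial A}(A)$ is the set-wise stabilizer of $\partial A$ in $\mathrm{Aut}(A)$. A proper atom or dipole $A$ with $\partial A=\{u,v\}$ is halvable if some semiregular involution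 in $\mathrm{Aut}_{\partial A}(A)$ exchanges $u,v$; symmetric if it is not halvable but some element of $\mathrm{Aut}_{\partial A}(A)$ exchanges $u,v$; asymmetric otherwise. A $\partial$-isomorphism $A\to A'$ is an isomorphism mapping $\partial A$ onto $\partial A'$. REDUCTION. $G_{i+1}$ arises from $G_i$ by replacing simultaneously the interior of every atom $A$ of $G_i$ by an edge $e_A$, with a new color for each $\partial$-isomorphism class of atoms: a pendant edge at $u$ if $A$ is a block atom with $\partial A=\{u\}$; a halvable/undirected/directed edge $uv$ if $A$ is a halvable/symmetric/asymmetric proper atom or dipole with $\partial A=\{u,v\}$, directed edges being oriented consistently with $\partial$-isomorphisms inside each class. Atoms in all steps are taken with respect to the image of the central block/articulation of $G$. The reduction series $G=G_0,\dots,G_r$ stops when $G_r$ is primitive. THE MAPPING $\Phi_i$. For $\pi\in\mathrm{Aut}(G_i)$, $\Phi_i(\pi)$ acts as $\pi$ on common vertices, edges and darts of $G_i$ and $G_{i+1}$, and maps $e_A$ to $e_{\pi(A)}$ for each atom $A$ of $G_i$; the dart of $e_A$ at $u\in\partial A$ is mapped to the dart of $e_{\pi(A)}$ at $\pi(u)$, and the other dart to the other dart. *)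

(* Defs.v *)
From HB Require Import structures.
From mathcomp Require Import all_boot all_fingroup.

Set Implicit Arguments.
Unset Strict Implicit.
Unset Printing Implicit Defensive.

Inductive edge_type := Halvable | Undirected | Directed.

Definition edge_type_code (t : edge_type) : option bool :=
  match t with Halvable => None | Undirected => Some false | Directed => Some true end.
Definition edge_type_decode (o : option bool) : edge_type :=
  match o with None => Halvable | Some false => Undirected | Some true => Directed end.
Lemma edge_type_codeK : cancel edge_type_code edge_type_decode.
Proof. by case. Qed.
HB.instance Definition _ := Equality.copy edge_type (can_type edge_type_codeK).

(* [inc] is the partial incidence function iota and [flip] the involution
   lambda. Colors and types of edges are stored on darts, and are constant on
   the orbits of [flip]. An orientation of a directed edge is the choice of one
   of its two darts, its tail; [tail] is irrelevant on the other edges. *)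
Record graph := Graph {
  vert : finType;
  dart : finType;
  inc : dart -> option vert;
  flip : dart -> dart;
  color : dart -> nat;
  etype : dart -> edge_type;
  tail : dart -> bool;
  flipK : involutive flip;
  color_flip : forall d, color (flip d) = color d;
  etype_flip : forall d, etype (flip d) = etype d;
  tail_flip : forall d, etype d = Directed -> tail (flip d) = ~~ tail d
}.

Arguments inc {g} _.
Arguments flip {g} _.
Arguments color {g} _.
Arguments etype {g} _.
Arguments tail {g} _.

Definition preserves (G H : graph) (f : vert G -> vert H) (g : dart G -> dart H) : bool :=
  [forall d, [&& inc (g d) == omap f (inc d),
                 g (flip d) == flip (g d),
                 color (g d) == color d,
                 etype (g d) == etype d &
                 (etype d == Directed) ==> (tail (g d) == tail d)]].

Definition autT (G : graph) := ({perm vert G} * {perm dart G})%type.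

Definition AutG (G : graph) : {set autT G} := [set p : autT G | preserves p.1 p.2].

Lemma AutG_group_set (G : graph) : group_set (AutG G).
Proof.
apply/group_setP; split=> [|p q].
  rewrite inE; apply/forallP=> d; rewrite !perm1 !eqxx implybT !andbT /=.
  by case: (inc d) => [v|] //=; rewrite perm1.
rewrite !inE => /forallP hp /forallP hq; apply/forallP=> d /=.
rewrite !permM.
have /and5P[/eqP h1 /eqP h2 /eqP h3 /eqP h4 h5] := hp d.
have /and5P[/eqP k1 /eqP k2 /eqP k3 /eqP k4 k5] := hq (p.2 d).
rewrite k1 h1 h2 k2 k3 h3 k4 h4 !eqxx /=; apply/andP; split.
  by case: (inc d) => [v|] //=; rewrite permM.
apply/implyP=> hd; move/implyP: h5 => /(_ hd) /eqP <-.
by move/implyP: k5; apply; rewrite h4.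
Qed.
Canonical AutG_group (G : graph) := Group (AutG_group_set G).

(* An element of a group that fixes a halvable edge but none of its darts
   interchanges these two darts, and its square then fixes them. *)
Definition semiregular (G : graph) (Gamma : {set autT G}) : bool :=
  [forall p in Gamma, (p != 1%g) ==>
     [&& [forall v, p.1 v != v],
         [forall d, p.2 d != d] &
         [forall d, (etype d != Halvable) ==> (p.2 d \notin [set d; flip d])]]].

(* Vertices and darts of a piece of G. Darts that are incident in G to a vertex
   outside of the piece are kept as darts whose incidence is undefined. *)
Definition piece (G : graph) := ({set vert G} * {set dart G})%type.

Section Pieces.
Variable G : graph.
Implicit Types S T : piece G.

Definition whole : piece G := ([set: vert G], [set: dart G]).
Definition remove S (U : {set vert G}) : piece G := (S.1 :\: U, S.2).
Definition included S T : bool := (S.1 \subset T.1) && (S.2 \subset T.2).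

Definition is_subgraph S : bool :=
  [forall d in S.2, (flip d \in S.2) && (if inc d is Some v then v \in S.1 else true)].

(* Connectivity concerns vertices and darts together, so that an edge none of
   whose darts is incident to a vertex of S is a component of its own. *)
Definition items S : {set vert G + dart G} :=
  [set a | match a with inl v => v \in S.1 | inr d => d \in S.2 end].
Definition adjacent S : rel (vert G + dart G) := fun a b =>
  match a, b with
  | inl v, inr d | inr d, inl v => [&& v \in S.1, d \in S.2 & inc d == Some v]
  | inr d, inr e => [&& d \in S.2, e \in S.2 & e == flip d]
  | inl _, inl _ => false
  end.
Definition connected S : bool :=
  [forall a in items S, forall b in items S, connect (adjacent S) a b].
Definition is_component S (K : {set vert G + dart G}) : bool :=
  [exists a in items S, K == [set b | connect (adjacent S) a b]].
Definition component_piece (K : {set vert G + dart G}) : piece G :=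
  ([set v | inl v \in K], [set d | inr d \in K]).

Definition articulation (u : vert G) : bool := ~~ connected (remove whole [set u]).

(* A bridge-edge with its two ends and a pendant edge with its end have no
   articulation in this sense, and are the degenerate blocks. *)
Definition two_connected S : bool :=
  [&& is_subgraph S, S.2 != set0, connected S &
      [forall u in S.1, connected (remove S [set u])]].
Definition block S : bool :=
  two_connected S && [forall T, two_connected T && included S T ==> (T == S)].

Definition degree_in S (v : vert G) : nat := #|[set d in S.2 | inc d == Some v]|.

(* Nodes of the block-tree are pieces; the articulation u is the piece
   ([set u], set0), so articulations are the nodes without darts. *)
Definition vertex_node (u : vert G) : piece G := ([set u], set0).
Definition block_tree_nodes : {set piece G} :=
  [set S | block S] :|: [set vertex_node u | u : vert G & articulation u].
Definition incident_nodes (S T : piece G) : bool :=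
  [&& S.2 == set0, T.2 != set0 & S.1 \subset T.1].
Definition tree_edge (N : {set piece G}) : rel (piece G) := fun S T =>
  [&& S \in N, T \in N & incident_nodes S T || incident_nodes T S].

Definition tree_ball (N : {set piece G}) (S : piece G) (n : nat) : {set piece G} :=
  iter n (fun A => A :|: [set T | [exists R in A, tree_edge N R T]]) [set S].

(* minimal eccentricity in the block-tree *)
Definition central_node (C : piece G) : Prop :=
  C \in block_tree_nodes /\
  forall S n, S \in block_tree_nodes ->
    block_tree_nodes \subset tree_ball block_tree_nodes S n ->
    block_tree_nodes \subset tree_ball block_tree_nodes C n.

(* By convention, the vertex of K_1 with at most one pendant edge is a central
   articulation. *)
Definition is_center (C : piece G) : Prop :=
  if (#|vert G| == 1) && (#|dart G| <= 2) then C = ([set: vert G], set0)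
  else central_node C /\ forall C', central_node C' -> C' = C.

End Pieces.

Arguments whole {G}.

Definition admissible (G : graph) : Prop :=
  [/\ connected (@whole G),
      forall d : dart G, flip d != d,
      forall d : dart G, inc d != None -> inc d != inc (flip d) &
      forall d : dart G, inc d != None -> inc (flip d) = None -> etype d = Undirected].

Section SubGraph.
Variables (G : graph) (S : piece G).

Definition sub_vert := {v : vert G | v \in S.1}.
Definition sub_dart := {d : dart G | (d \in S.2) && (flip d \in S.2)}.

Lemma sub_flip_subproof (d : sub_dart) :
  (flip (val d) \in S.2) && (flip (flip (val d)) \in S.2).
Proof. by rewrite flipK andbC (valP d). Qed.
Definition sub_flip (d : sub_dart) : sub_dart := Sub (flip (val d)) (sub_flip_subproof d).
Lemma sub_flipK : involutive sub_flip.
Proof. by move=> d; apply: val_inj; rewrite /= flipK. Qed.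

Definition subgraph : graph :=
  @Graph sub_vert sub_dart
    (fun d => obind (insub : vert G -> option sub_vert) (inc (val d))) sub_flip
    (fun d => color (val d)) (fun d => etype (val d)) (fun d => tail (val d))
    sub_flipK (fun d => color_flip (val d)) (fun d => etype_flip (val d))
    (fun d => @tail_flip G (val d)).

End SubGraph.

(* A graph together with the image of the central block or of the central
   articulation of the initial graph of the reduction series. *)
Record centered_graph := CenteredGraph {
  base_graph :> graph;
  center : piece base_graph
}.

Section Atoms.
Variable G : centered_graph.

Definition rooted_nodes : {set piece G} := center G |: block_tree_nodes G.

(* Every path of the block-tree from T to the center goes through S. *)
Definition below (S T : piece G) : bool :=
  (T == S) ||
  ~~ connect [rel A B | [&& tree_edge rooted_nodes A B, A != S & B != S]] T (center G).

Definition subtree_blocks (S : piece G) : {set piece G} :=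
  [set B in rooted_nodes | block B && below S B].
Definition subtree_piece (S : piece G) : piece G :=
  (\bigcup_(B in subtree_blocks S) B.1, \bigcup_(B in subtree_blocks S) B.2).

(* u is S itself if S is an articulation, and the parent of S if S is a block. *)
Definition attached_at (S : piece G) (u : vert G) : bool :=
  if S.2 == set0 then S == vertex_node u
  else tree_edge rooted_nodes S (vertex_node u) && ~~ below S (vertex_node u).

Definition single_pendant_edge (S : piece G) : bool :=
  [exists d, [&& S.2 == [set d; flip d], inc d != None & inc (flip d) == None]].

(* a subgraph with its boundary *)
Definition part := (piece G * {set vert G})%type.

(* The tree of K_1 without edges has no blocks, whence the non-emptiness. *)
Definition block_part (P : part) : bool :=
  [exists S in rooted_nodes, exists u,
    [&& (S != center G) || (S.2 == set0),
        attached_at S u,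
        P == (subtree_piece S, [set u]),
        P.1.2 != set0 &
        ~~ single_pendant_edge P.1]].

Definition two_cut (B : piece G) (U : {set vert G}) : bool :=
  1 < #|[set K | is_component (remove B U) K & (component_piece K).1 != set0]|.

(* A component without vertices is a single free edge. The darts of K comprise
   both darts of every edge that joins K to U. *)
Definition proper_part (P : part) : bool :=
  [exists B, exists u, exists v, exists K : {set vert G + dart G},
    let U := [set u; v] in
    [&& block B, u != v, U \subset B.1, two_cut B U,
        3 <= degree_in B u, 3 <= degree_in B v,
        is_component (remove whole U) K,
        [exists L, is_component (remove B U) L && (L \subset K)],
        (component_piece K).1 != set0,
        ~~ ((center G).1 \subset (component_piece K).1) &
        P == ((U :|: (component_piece K).1, (component_piece K).2), U)]].

Definition joining (u v : vert G) : {set dart G} :=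
  [set d | ((inc d == Some u) && (inc (flip d) == Some v))
        || ((inc d == Some v) && (inc (flip d) == Some u))].

(* When v has no other edges, a block consisting of u, v and parallel edges
   and attached at u is a block part, whose boundary is u. It is not counted
   once more as a dipole. *)
Definition dipole_part (P : part) : bool :=
  [exists u, exists v,
    [&& u != v, P == (([set u; v], joining u v), [set u; v]),
        1 < #|[set [set d; flip d] | d in joining u v]| &
        ~~ [exists w, block_part (P.1, [set w])]]].

Definition is_part (P : part) : bool :=
  [|| block_part P, proper_part P | dipole_part P].

Definition is_atom (P : part) : bool :=
  is_part P && [forall Q : part, is_part Q && included Q.1 P.1 ==> (Q.1 == P.1)].

Definition primitive : bool := [forall P : part, ~~ is_atom P].

Definition atom := {P : part | is_atom P}.

End Atoms.

Section Symmetry.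
Variable G : centered_graph.

Definition part_graph (P : part G) : graph := subgraph P.1.
Definition sub_boundary (P : part G) : {set vert (part_graph P)} :=
  [set v : sub_vert P.1 | val v \in P.2].

Definition AutG_boundary (P : part G) : {set autT (part_graph P)} :=
  [set p in AutG (part_graph P) | p.1 @: sub_boundary P == sub_boundary P].

(* For a boundary of size two: moving both vertices is exchanging them. *)
Definition exchanges (P : part G) (p : autT (part_graph P)) : bool :=
  [forall v in sub_boundary P, p.1 v != v].

Definition halvable (P : part G) : bool :=
  [exists p in AutG_boundary P, [&& #[p]%g == 2, semiregular <[p]>%g & exchanges p]].
Definition exchangeable (P : part G) : bool :=
  [exists p in AutG_boundary P, exchanges p].

(* #|P.2| = 1 characterizes the block atoms. *)
Definition new_type (P : part G) : edge_type :=
  if #|P.2| == 1 then Undirected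
  else if halvable P then Halvable
  else if exchangeable P then Undirected
  else Directed.

Definition boundary_iso (P Q : part G) (f : vert (part_graph P) -> vert (part_graph Q))
    (g : dart (part_graph P) -> dart (part_graph Q)) : Prop :=
  [/\ bijective f, bijective g, preserves f g & f @: sub_boundary P = sub_boundary Q].

Definition boundary_isomorphic (P Q : part G) : Prop :=
  exists f g, @boundary_iso P Q f g.

End Symmetry.

(* The colors of the edges replacing the atoms, and the tails of those among
   them that are directed. *)
Record choices (G : centered_graph) := Choices {
  new_color : atom G -> nat;
  new_tail : forall A : atom G, {v : vert G | v \in (val A).2}
}.

Definition valid_choices (G : centered_graph) (c : choices G) : Prop :=
  [/\ forall (A : atom G) (d : dart G), new_color c A <> color d,
      forall A B : atom G,
        new_color c A = new_color c B <-> boundary_isomorphic (val A) (val B) &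
      forall (A B : atom G) f g, new_type (val A) = Directed ->
        @boundary_iso G (val A) (val B) f g ->
        forall v, val v = val (new_tail c A) -> val (f v) = val (new_tail c B)].

(* The darts of the edge replacing A, each named after its incidence: two
   vertices, or one vertex and [None] in the case of a pendant edge. *)
Definition ends (G : centered_graph) (P : part G) : {set option (vert G)} :=
  Some @: P.2 :|: (if #|P.2| == 1 then [set None] else set0).

Definition other_end (G : centered_graph) (P : part G) (x : option (vert G)) : option (vert G) :=
  odflt x [pick y in ends P | y != x].

Lemma is_part_flip (G : centered_graph) (P : part G) (d : dart G) :
  is_part P -> d \in P.1.2 -> flip d \in P.1.2.
Proof.
case/or3P.
- case/existsP=> S /andP[_ /existsP[u /and5P[_ _ /eqP-> _ _]]] /=.
  case/bigcupP=> B hB hd; apply/bigcupP; exists B => //.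
  move: hB; rewrite inE => /and3P[_ /andP[/and4P[/forallP /(_ d)] + _ _ _] _] _.
  by rewrite hd => /andP[].
- case/existsP=> B /existsP[u /existsP[v /existsP[K]]] /=.
  do 6 case/andP=> _; case/andP=> /existsP[a /andP[_ /eqP->]].
  case/and4P=> _ _ _ /eqP-> /=; rewrite !inE => h.
  by apply: connect_trans h (connect1 _); rewrite /= !inE eqxx.
- case/existsP=> u /existsP[v /and4P[_ /eqP-> _ _]] /=.
  by rewrite !inE flipK orbC andbC [X in _ || X]andbC.
Qed.

Lemma is_part_boundary (G : centered_graph) (P : part G) :
  is_part P -> (#|P.2| == 1) || (#|P.2| == 2).
Proof.
case/or3P.
- case/existsP=> S /andP[_ /existsP[u /and5P[_ _ /eqP-> _ _]]] /=.
  by rewrite cards1.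
- case/existsP=> B /existsP[u /existsP[v /existsP[K]]] /=.
  case/andP=> _ /andP[uv]; do 8 case/andP=> _; move/eqP=> -> /=.
  by rewrite cards2 uv.
- case/existsP=> u /existsP[v /and4P[uv /eqP-> _ _]] /=.
  by rewrite cards2 uv.
Qed.

Lemma card_ends (G : centered_graph) (P : part G) : is_part P -> #|ends P| = 2.
Proof.
move/is_part_boundary; rewrite /ends; case: ifP => [/eqP h _ | _ /= /eqP h].
  rewrite cardsU card_imset ?h; last exact: Some_inj.
  rewrite cards1 (_ : _ :&: _ = set0) ?cards0 //.
  by apply/setP=> x; rewrite !inE andbC; case: eqP => // ->; apply/imsetP=> -[].
by rewrite setU0 card_imset //; apply: Some_inj.
Qed.

Lemma other_endP (G : centered_graph) (P : part G) (x : option (vert G)) :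
  is_part P -> x \in ends P ->
  ends P = [set x; other_end P x] /\ other_end P x != x.
Proof.
move=> /card_ends/eqP/cards2P[a [b [ab e]]].
rewrite /other_end e !inE => hx; case: pickP => [y | h] /=.
  rewrite !inE => /andP[hy nyx]; split=> //.
  case/orP: hx nyx hy => /eqP-> /negPf->; rewrite ?orbF //= => /eqP-> //.
  by rewrite setUC.
have := h a; have := h b; rewrite !inE !eqxx orbT /=.
by case/orP: hx => /eqP->; rewrite ?(eq_sym b) ab.
Qed.

Section Reduction.
Variables (G : centered_graph) (c : choices G).

Definition kept_vert (v : vert G) : bool :=
  ~~ [exists A : atom G, v \in (val A).1.1 :\: (val A).2].
Definition kept_dart (d : dart G) : bool :=
  ~~ [exists A : atom G, d \in (val A).1.2].

Definition red_vert := {v : vert G | kept_vert v}.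
Definition old_dart := {d : dart G | kept_dart d}.
Definition new_dart := {q : atom G * option (vert G) | q.2 \in ends (val q.1)}.
Definition red_dart := (old_dart + new_dart)%type.

Lemma atom_part (A : atom G) : is_part (val A).
Proof. by case/andP: (valP A). Qed.

Lemma old_flip_subproof (d : old_dart) : kept_dart (flip (val d)).
Proof.
have := valP d; apply: contra => /existsP[A hA]; apply/existsP; exists A.
by rewrite -[val d]flipK; apply: is_part_flip (atom_part A) hA.
Qed.
Lemma new_flip_subproof (q : new_dart) :
  other_end (val (val q).1) (val q).2 \in ends (val (val q).1).
Proof. by have [-> _] := other_endP (atom_part _) (valP q); rewrite !inE eqxx orbT. Qed.

Definition old_flip (d : old_dart) : old_dart := Sub (flip (val d)) (old_flip_subproof d).
Definition new_flip (q : new_dart) : new_dart :=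
  Sub ((val q).1, other_end (val (val q).1) (val q).2) (new_flip_subproof q).

Definition red_inc (d : red_dart) : option red_vert :=
  obind insub (match d with inl d => inc (val d) | inr q => (val q).2 end).
Definition red_flip (d : red_dart) : red_dart :=
  match d with inl d => inl (old_flip d) | inr q => inr (new_flip q) end.
Definition red_color (d : red_dart) : nat :=
  match d with inl d => color (val d) | inr q => new_color c (val q).1 end.
Definition red_type (d : red_dart) : edge_type :=
  match d with inl d => etype (val d) | inr q => new_type (val (val q).1) end.
Definition red_tail (d : red_dart) : bool :=
  match d with
  | inl d => tail (val d)
  | inr q => (val q).2 == Some (val (new_tail c (val q).1))
  end.

Lemma red_flipK : involutive red_flip.
Proof.
case=> [d | q] /=; congr (_ _); apply: val_inj => /=; first exact: flipK.
case: q => -[A x] /= hx; congr (_, _).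
have [e1 n1] := other_endP (atom_part A) hx.
have hy : other_end (val A) x \in ends (val A) by rewrite e1 !inE eqxx orbT.
have [e2 n2] := other_endP (atom_part A) hy.
have : x \in ends (val A) by [].
by rewrite e2 !inE eq_sym (negPf n1) => /= /eqP.
Qed.
Lemma red_color_flip d : red_color (red_flip d) = red_color d.
Proof. by case: d => [d | q] //=; apply: color_flip. Qed.
Lemma red_type_flip d : red_type (red_flip d) = red_type d.
Proof. by case: d => [d | q] //=; apply: etype_flip. Qed.
Lemma red_tail_flip d : red_type d = Directed -> red_tail (red_flip d) = ~~ red_tail d.
Proof.
case: d => [d | [[A x] /= hx]] /=; first exact: tail_flip.
move=> _; case: (new_tail c A) => t /= ht.
have [e1 n1] := other_endP (atom_part A) hx.
have : Some t \in ends (val A) by rewrite inE imset_f.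
by rewrite e1 !inE ![Some t == _]eq_sym => /orP[] /eqP <-; rewrite eqxx ?[x == _]eq_sym (negPf n1).
Qed.

Definition red_graph : graph :=
  Graph red_inc red_flipK red_color_flip red_type_flip red_tail_flip.

Definition red_center : piece red_graph :=
  ([set v : red_vert | val v \in (center G).1],
   [set d : red_dart | match d with
      | inl d => val d \in (center G).2
      | inr q => (val (val q).1).1.2 :&: (center G).2 != set0
      end]).

Definition reduction : centered_graph := CenteredGraph red_center.

(* [induces p q] states that q is the value of the mapping Phi at p. *)
Definition part_image (p : autT G) (P : part G) : part G :=
  ((p.1 @: P.1.1, p.2 @: P.1.2), p.1 @: P.2).

Definition induces (p : autT G) (q : autT reduction) : Prop :=
  [/\ forall v : red_vert, val (q.1 v : red_vert) = p.1 (val v),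
      forall d : old_dart, exists2 d' : old_dart,
        q.2 (inl d) = inl d' & val d' = p.2 (val d) &
      forall e : new_dart, exists2 e' : new_dart,
        q.2 (inr e) = inr e' &
        val (val e').1 = part_image p (val (val e).1) /\
        (val e').2 = omap p.1 (val e).2].

End Reduction.

Fixpoint reduction_step (c : forall H : centered_graph, choices H) (G : centered_graph) (i : nat) : centered_graph :=
  if i is j.+1 then reduction (c (reduction_step c G j)) else G.

(* [c] makes the choices that are left open by the reduction. They are
   constrained on the graphs of the series only. *)
Definition reduction_series (c : forall H : centered_graph, choices H) (G : centered_graph) (r : nat) : Prop :=
  (forall i, i < r -> ~~ primitive (reduction_step c G i) /\
                      valid_choices (c (reduction_step c G i))) /\
  primitive (reduction_step c G r).

(* Main.v *)
Require Import Defs.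
From mathcomp Require Import all_boot all_fingroup cyclic.

(* Darts that no vertex separates form a class, and the blocks are exactly
   these classes with the vertices incident to them. Hence a block part with
   boundary [w] is a union of connected components of [G \ w] that avoid the
   center, a proper part is a connected component of [G \ {u, v}], and the
   usual uncrossing of such cuts shows that two distinct atoms share at most
   vertices of their boundaries. Therefore automorphisms that fix the center
   act on the reduced graph. Conversely, an automorphism of the reduced graph
   maps the edge of an atom to the edge of a boundary-isomorphic atom, and the
   isomorphisms between these atoms, corrected by an exchange of the boundary
   where necessary, glue together. The center of the reduced graph is again a
   block or a vertex, and by surjectivity it is fixed by all automorphisms, so
   the argument can be iterated. A semiregular element that fixes the new edge
   of an atom exchanges its boundary and is an involution, so that the atom is
   halvable and the edge is allowed to be fixed. *)

Set Implicit Arguments.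
Unset Strict Implicit.
Unset Printing Implicit Defensive.

(** Minimality of an atom is always used in one way: a part whose piece lies in the atom must have
    the same piece, so each case of the uncrossing exhibits a part inside that misses a vertex. Two
    positions resist this. If two parts together cover the graph, neither is smaller, and it is the
    center that decides: one of them would have to contain it. If two cuts {u, v} and {u', v'} of
    one block cross, each dart of u' in the block leads to u or to v in G \ {u', v'}. Two darts
    leading to the same vertex yield a smaller proper part or a dipole, so u' has at most two darts
    in the block, against the degree condition on cuts.

    In the reduced graph the difficulty is that a vertex separating a dart from the central block
    may have disappeared into an atom. It must be replaced by a surviving one before the image of
    the block can be recognized as a class again.

    When an automorphism of the reduced graph is pulled back, the new colors keep old and new edges
    apart, and the orientation of a directed edge forbids precisely the exchange that an asymmetric
    atom does not have. *)

Lemma connect_ind (T : finType) (e : rel T) (P : T -> Prop) x y :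
  P x -> (forall a b, connect e x a -> e a b -> P a -> P b) ->
  connect e x y -> P y.
Proof.
move=> Px step /connectP[p + ->]; elim/last_ind: p => [|p b IH] //=.
rewrite rcons_path last_rcons => /andP[ep eb].
by apply: step eb (IH ep); apply/connectP; exists p.
Qed.

(** * Connectivity after the deletion of vertices *)

Section Connectivity.
Variable G : graph.
Implicit Types (U W : {set vert G}) (x y z : vert G + dart G).

(** The vertices of [U] stay in the carrier as isolated items and no dart is ever deleted. Sets of
    items for different [U] are thus directly comparable, at the price of the trivial pair [x = y]
    in [conn_off]. *)
Definition adj U : rel (vert G + dart G) := fun x y =>
  match x, y with
  | inl v, inr d | inr d, inl v => (v \notin U) && (inc d == Some v)
  | inr d, inr e => e == flip d
  | inl _, inl _ => false
  end.
Definition conn U := connect (adj U).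
Definition off U x := if x is inl v then v \notin U else true.

Lemma adjE U : adjacent (remove whole U) =2 adj U.
Proof. by case=> [v|d] [w|e] //=; rewrite !inE ?andbT. Qed.

Lemma connE U : connect (adjacent (remove whole U)) =2 conn U.
Proof. exact/eq_connect/adjE. Qed.

Lemma adj_sym U : symmetric (adj U).
Proof.
by case=> [v|d] [w|e] //=; apply/eqP/eqP => ->; rewrite flipK.
Qed.

Lemma conn_sym U : symmetric (conn U).
Proof. exact/sym_connect_sym/adj_sym. Qed.

Lemma connC U x y : conn U x y -> conn U y x.
Proof. by rewrite conn_sym. Qed.

Lemma conn_refl U x : conn U x x.
Proof. exact: connect0. Qed.

Lemma conn_trans U y x z : conn U x y -> conn U y z -> conn U x z.
Proof. exact: connect_trans. Qed.

Lemma conn_flip U d : conn U (inr d) (inr (flip d)).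
Proof. by apply: connect1; rewrite /= eqxx. Qed.

Lemma conn_inc U d v : inc d = Some v -> v \notin U -> conn U (inr d) (inl v).
Proof. by move=> dv vU; apply: connect1; rewrite /= vU dv eqxx. Qed.

Lemma adj_off U x y : adj U x y -> off U x && off U y.
Proof. by case: x y => [v|d] [w|e] //= => [/andP[->] | /andP[->]]. Qed.

Lemma adj_switch U W x y : adj U x y -> off W x -> off W y -> adj W x y.
Proof. by case: x y => [v|d] [w|e] //= /andP[_ ->] => [->|_ ->]. Qed.

Lemma conn_off U x y : conn U x y -> x = y \/ off U x /\ off U y.
Proof.
move=> c; apply: (connect_ind (P := fun y => x = y \/ off U x /\ off U y)) c.
  by left.
by move=> a b _ /adj_off/andP[oa ob] [-> | [ox _]]; right.
Qed.

Lemma conn_offr U x y : conn U x y -> off U x -> off U y.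
Proof. by case/conn_off=> [-> | []]. Qed.

Lemma conn_in U v x : v \in U -> conn U (inl v) x -> x = inl v.
Proof. by move=> vU /conn_off[-> // | []] /=; rewrite vU. Qed.

(** The tool for comparing two cuts: neither has to contain the other, it suffices that nothing
    reached for [U] is a vertex of [W]. *)
Lemma conn_switch U W x y :
  (forall z, conn U x z -> off W z) -> conn U x y -> conn W x y.
Proof.
move=> oW; apply: (connect_ind (P := fun y => conn W x y)).
  exact: connect0.
move=> a b xa ab xa'; apply: connect_trans xa' (connect1 _).
by apply: adj_switch ab (oW _ xa) (oW _ (connect_trans xa (connect1 ab))).
Qed.

Lemma conn_sub U W x y : U \subset W -> conn W x y -> conn U x y.
Proof.
move=> /subsetP sUW; apply: (connect_ind (P := fun y => conn U x y)).
  exact: connect0.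
move=> a b _ ab c; apply: connect_trans c (connect1 _).
have offS z : off W z -> off U z by case: z => //= v; apply/contra/sUW.
by case/andP: (adj_off ab) => /offS oa /offS ob; apply: adj_switch ab oa ob.
Qed.

(** Cut a path just before its first visit to [u]: it then ends in a dart at [u] and survives the
    deletion of [u]. *)
Lemma first_hit W y u : conn W y (inl u) -> y != inl u ->
  exists2 f, inc f = Some u & conn (u |: W) y (inr f).
Proof.
move=> c yu.
have nc : conn (u |: W) y (inl u) = false.
  by apply/negP=> /conn_off[/eqP | [_]] /=; rewrite ?(negPf yu) // !inE eqxx.
(* Along the path, either [u] has not been met or the dart has been recorded. At [u] itself only the
   second is possible, since [u] is isolated once deleted. *)
pose P z := conn (u |: W) y z \/
      exists2 f, inc f = Some u & conn (u |: W) y (inr f).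
suff: P (inl u) by rewrite /P nc => -[].
apply: connect_ind c; first by left; apply: connect0.
move=> a b _ ab [ya | ?]; last by right.
have au : a != inl u by apply: contraFneq nc => <-.
have [bu | bu] := eqVneq b (inl u).
  right; move: ab ya; rewrite bu; case: a {au} => //= d /andP[_ /eqP du] yd.
  by exists d.
left; apply: connect_trans ya (connect1 (adj_switch ab _ _)).
  by case/andP: (adj_off ab) => + _; case: a au {ab} => //= v vu vW; rewrite !inE negb_or vW
    andbT.
by case/andP: (adj_off ab) => _; case: b bu {ab} => //= v vu vW; rewrite !inE negb_or vW andbT.
Qed.

(** A path from a dart to a vertex must leave the edge of the dart through one of its ends, and that
    end is not deleted. *)
Lemma conn_dart_vert U d v : conn U (inr d) (inl v) ->
  exists2 y, y \notin U & inc d = Some y \/ inc (flip d) = Some y.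
Proof.
move=> c.
pose Q := exists2 y, y \notin U & inc d = Some y \/ inc (flip d) = Some y.
pose P z := match z with
  | inl v => Q
  | inr e => Q \/ (e = d \/ e = flip d)
  end.
change (P (inl v)).
apply: connect_ind c; first by right; left.
move=> [a|a] [b|b] _ //=.
- by move=> _ ?; left.
- move=> /andP[bU /eqP ab] [//|]; case=> h; exists b => //; rewrite -ab h; [left|right] => //.
- by move=> /eqP -> [?|[]->]; [left | right; right | right; left; rewrite flipK].
Qed.

End Connectivity.

(** * Blocks *)

Section Blocks.
Variable G : graph.
Implicit Types (U W : {set vert G}) (x y z : vert G + dart G) (S T B : piece G).

Lemma in_items1 S v : (inl v \in items S) = (v \in S.1).
Proof. by rewrite inE. Qed.

Lemma in_items2 S d : (inr d \in items S) = (d \in S.2).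
Proof. by rewrite inE. Qed.

Definition in_items := (in_items1, in_items2).

(** As darts are never deleted, each [w] gives an equivalence relation on all darts, and [eqd] is
    their intersection. Transitivity is therefore immediate, unlike for a definition by common
    cycles. *)
Definition eqd (d e : dart G) := [forall w, conn [set w] (inr d) (inr e)].

Definition cls (d : dart G) : piece G :=
  ([set v | [exists e, eqd d e && (inc e == Some v)]], [set e | eqd d e]).

Lemma eqdP d e : reflect (forall w, conn [set w] (inr d) (inr e)) (eqd d e).
Proof. exact: forallP. Qed.

Lemma eqd_refl d : eqd d d.
Proof. by apply/eqdP=> w; apply: connect0. Qed.

Lemma eqd_sym d e : eqd d e = eqd e d.
Proof. by apply/eqdP/eqdP=> h w; apply/connC/h. Qed.

Lemma eqd_trans d e f : eqd d e -> eqd e f -> eqd d f.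
Proof. by move=> /eqdP de /eqdP ef; apply/eqdP=> w; apply: conn_trans (de w) (ef w). Qed.

Lemma eqd_flip d : eqd d (flip d).
Proof. by apply/eqdP=> w; apply: conn_flip. Qed.

Lemma mem_cls2 d e : (e \in (cls d).2) = eqd d e.
Proof. by rewrite inE. Qed.

Lemma mem_cls1 d v : reflect (exists2 e, eqd d e & inc e = Some v) (v \in (cls d).1).
Proof.
rewrite inE; apply: (iffP existsP) => [[e /andP[de /eqP ev]] | [e de ev]]; exists e => //.
by rewrite de ev eqxx.
Qed.

Lemma cls_eqP d e : reflect (cls d = cls e) (eqd d e).
Proof.
apply: (iffP idP) => [de | eq_de]; last by rewrite -mem_cls2 eq_de mem_cls2 eqd_refl.
have E f : eqd d f = eqd e f.
  apply/idP/idP; last exact: eqd_trans.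
  by apply: eqd_trans; rewrite eqd_sym.
by congr (_, _); apply/setP=> v; rewrite !inE ?E //; apply: eq_existsb => f; rewrite E.
Qed.

Lemma incident_cls d v : inc d = Some v -> v \in (cls d).1.
Proof. by move=> dv; apply/mem_cls1; exists d => //; apply: eqd_refl. Qed.

Lemma items_cls_conn d x w : x \in items (cls d) -> x != inl w ->
  conn [set w] (inr d) x.
Proof.
case: x => [v|e]; rewrite inE; last by rewrite mem_cls2 => /eqdP.
case/mem_cls1=> e /eqdP de ev vw; apply: conn_trans (de w) (conn_inc ev _).
by rewrite inE; apply: contraNneq vw => ->.
Qed.

Lemma items_clsP2 d x y w : x \in items (cls d) -> y \in items (cls d) ->
  x != inl w -> y != inl w -> conn [set w] x y.
Proof.
by move=> hx hy xw yw; apply: conn_trans (connC (items_cls_conn hx xw)) (items_cls_conn hy yw).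
Qed.

Lemma path_conn U w x p : path (adj U) x p -> inl w \notin x :: p ->
  conn [set w] x (last x p).
Proof.
elim: p x => [|y p IH] x /=; first by move=> *; apply: connect0.
case/andP=> xy yp; rewrite in_cons negb_or => /andP[xw np].
apply: conn_trans (IH y yp np); apply: connect1; apply: adj_switch xy _ _.
  by case: x xw => //= v; rewrite inE; apply: contraNneq => ->.
move: np; rewrite in_cons negb_or => /andP[yw _].
by case: y yw {yp} => //= v; rewrite inE; apply: contraNneq => ->.
Qed.

(* A simple path between two items of a class stays in the class: a vertex that
   separates one of its darts from the class would be visited both before and
   after that dart. *)
Lemma cls_convex d U x y : x \in items (cls d) -> y \in items (cls d) ->
  conn U x y -> connect (adjacent (remove (cls d) U)) x y.
Proof.
move=> hx hy /connectP[p0 ep0 yp0].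
case: (shortenP ep0) yp0 => p ep up _ yp {p0 ep0}.
have dartp f : inr f \in x :: p -> eqd d f.
  move=> fp; apply: contraT => /eqdP ndf.
  have [w /negP ndw]: exists w, ~~ conn [set w] (inr d) (inr f).
    by apply/existsP; rewrite -negb_forall; apply/forallP.
  case/splitPl: fp ep up yp => p1 p2 lp1.
  rewrite cat_path lp1 => /andP[ep1 ep2].
  rewrite -cat_cons cat_uniq last_cat lp1 => /and3P[_ /hasPn dis up2] yp.
  (* The path is simple, so [w] is missing from the half before [f] or from the half after it. That
     half joins [f] to an end of the path, which [w] does not separate from [d]. *)
  have [wp1 | wp1] := boolP (inl w \in x :: p1).
    have wp2 : inl w \notin inr f :: p2.
      by rewrite inE /=; apply/negP=> /dis; rewrite /= wp1.
    have fy := path_conn ep2 wp2; rewrite -yp in fy.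
    case: ndw; apply: conn_trans (connC fy); apply: items_cls_conn hy _.
    by rewrite yp; apply: contraNneq wp2 => <-; apply: mem_last.
  have := path_conn ep1 wp1; rewrite lp1 => xf.
  case: ndw; apply: conn_trans xf; apply: items_cls_conn hx _.
  by apply: contraNneq wp1 => ->; rewrite mem_head.
apply/connectP; exists p => //.
elim: p x ep dartp {hx up yp} => //= b p IH a /andP[ab bp] dp.
have dp' f : inr f \in b :: p -> eqd d f by move=> h; apply: dp; rewrite inE h orbT.
rewrite IH // andbT.
have da f : a = inr f -> f \in (cls d).2 by move=> af; rewrite mem_cls2 dp // af mem_head.
have db f : b = inr f -> f \in (cls d).2 by move=> bf; rewrite mem_cls2 dp' // bf mem_head.
case: a b ab da db {IH bp dp dp'} => [v|e] [w|f] //= => [/andP[vU fv] _ /(_ _ erefl) hf |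
  /andP[wU ew] /(_ _ erefl) he _ | h /(_ _ erefl) he /(_ _ erefl) hf].
- rewrite hf fv in_setD vU !andbT; apply/mem_cls1; exists f; last exact/eqP.
  by rewrite -mem_cls2.
- rewrite he ew in_setD wU !andbT; apply/mem_cls1; exists e; last exact/eqP.
  by rewrite -mem_cls2.
- by rewrite he hf h.
Qed.

Lemma adjacent_adj S U : subrel (adjacent (remove S U)) (adj U).
Proof.
case=> [v|d] [w|e] //=; rewrite ?inE => /and3P[].
- by move=> /andP[-> _] _ ->.
- by move=> /andP[-> _] _ ->.
- by move=> _ _ ->.
Qed.

Lemma connect_conn S U x y : connect (adjacent (remove S U)) x y -> conn U x y.
Proof. by apply: connect_sub => a b /adjacent_adj/connect1. Qed.

Lemma remove0 S : remove S set0 = S.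
Proof. by case: S => A B; rewrite /remove setD0. Qed.

Hypothesis G_conn : forall x y, conn set0 x y.

Lemma cls_two_connected d : two_connected (cls d).
Proof.
apply/and4P; split.
- apply/forallP=> e; apply/implyP; rewrite mem_cls2 => de; apply/andP; split.
    by rewrite mem_cls2 (eqd_trans de) ?eqd_flip.
  by case E: (inc e) => [v|] //; apply/mem_cls1; exists e.
- by apply/set0Pn; exists d; rewrite mem_cls2 eqd_refl.
- apply/forallP=> x; apply/implyP=> hx; apply/forallP=> y; apply/implyP=> hy.
  by rewrite -(remove0 (cls d)); apply: cls_convex.
- apply/forallP=> u; apply/implyP=> _.
  apply/forallP=> x; apply/implyP=> hx; apply/forallP=> y; apply/implyP=> hy.
  have R z : z \in items (remove (cls d) [set u]) -> z \in items (cls d) /\ z != inl u.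
    by case: z => [v|e]; rewrite !inE //= => /andP[vu ->]; split=> //; apply: contraNneq vu =>
      -[->].
  have [hx' xu] := R x hx; have [hy' yu] := R y hy.
  by apply: cls_convex => //; apply: items_clsP2 hx' hy' xu yu.
Qed.

(** A two-connected piece remains connected whichever vertex of [G] is deleted, be it in the piece
    or not, so all its darts are equivalent. Each of its vertices lies on one of its darts because
    the piece is connected. *)
Lemma two_connected_cls S d : two_connected S -> d \in S.2 -> included S (cls d).
Proof.
case/and4P=> sub _ conS connSu dS.
have ds e : e \in S.2 -> eqd d e.
  move=> eS; apply/eqdP=> w; have [wS | wS] := boolP (w \in S.1).
    move/forallP/(_ w): connSu; rewrite wS => /forallP/(_ (inr d)); rewrite !inE dS.
    by move=> /forallP/(_ (inr e)); rewrite !inE eS; apply: connect_conn.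
  move/forallP/(_ (inr d)): conS; rewrite !inE dS => /forallP/(_ (inr e)); rewrite !inE eS.
  rewrite -{1}[S]remove0 /=; have -> : remove S set0 = remove S [set w].
    rewrite remove0; case: S wS {sub connSu dS eS} => A C /= wA; congr (_, _).
    by apply/setP=> v; rewrite !inE; case: eqP => // ->; apply/negbTE.
  exact: connect_conn.
apply/andP; split; apply/subsetP=> v vS; last by rewrite mem_cls2 ds.
apply/mem_cls1.
move/forallP/(_ (inl v)): conS; rewrite !inE vS => /forallP/(_ (inr d)); rewrite !inE dS.
case/connectP=> -[|a p] //= /andP[+ _] _; case: a => //= e /and3P[_ eS /eqP ev].
by exists e => //; apply: ds.
Qed.

Lemma included_anti S T : included S T -> included T S -> S = T.
Proof.
case: S T => [A C] [A' C'] /andP[/= h1 h2] /andP[/= h3 h4].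
by congr (_, _); apply/eqP; rewrite eqEsubset ?h1 ?h2.
Qed.

Lemma block_cls d : block (cls d).
Proof.
rewrite /block cls_two_connected; apply/forallP=> T; apply/implyP=> /andP[tT sT].
apply/eqP/included_anti => //; apply: two_connected_cls tT _.
by case/andP: sT => _ /subsetP; apply; rewrite mem_cls2 eqd_refl.
Qed.

Lemma block_eq_cls S d : block S -> d \in S.2 -> S = cls d.
Proof.
case/andP=> tS /forallP/(_ (cls d)) /implyP mS dS; apply/esym/eqP/mS.
by rewrite cls_two_connected two_connected_cls.
Qed.

Lemma blockP S : reflect (exists d, S = cls d) (block S).
Proof.
apply: (iffP idP) => [bS | [d ->]]; last exact: block_cls.
have /andP[/and4P[_ /set0Pn[d dS] _ _] _] := bS.
by exists d; apply: block_eq_cls.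
Qed.

Lemma cls_neq d e : cls d <> cls e -> exists w, ~~ conn [set w] (inr d) (inr e).
Proof.
move=> ne; apply/existsP; rewrite -negb_forall; apply/negP=> /forallP h.
by apply/ne/cls_eqP/eqdP.
Qed.

(** Some vertex separates the two classes, and it can only be the common one: if any other vertex is
    deleted, both darts still reach [w]. *)
Lemma cls_share d e w : cls d <> cls e -> w \in (cls d).1 -> w \in (cls e).1 ->
  ~~ conn [set w] (inr d) (inr e).
Proof.
move=> /cls_neq[w' ne] wd we; have [<- // | ww'] := eqVneq w' w.
have nw : inl w != inl w' :> vert G + dart G by apply: contraNneq ww' => -[->].
case/negP: ne; apply: conn_trans (connC (items_cls_conn (x := inl w) _ nw)); last by rewrite
  inE.
by apply: items_cls_conn nw; rewrite inE.
Qed.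

End Blocks.

(** * Block parts *)

(** A single item stands for the center, so that lying on the side of the center becomes a statement
    about [conn]. *)
Definition represents (G : centered_graph) (x : vert G + dart G) : Prop :=
  match x with inl v => center G = vertex_node v | inr d => center G = cls d end.

Section RootedTree.
Variable G : centered_graph.
Implicit Types (U W : {set vert G}) (x y z : vert G + dart G) (S T B : piece G)
  (d e f : dart G) (u v w : vert G).
Hypothesis G_conn : forall x y, conn set0 x y.
Variable rho : vert G + dart G.
Hypothesis rho_center : represents rho.

Definition avoid S : rel (piece G) :=
  [rel A B | [&& tree_edge (rooted_nodes G) A B, A != S & B != S]].

Lemma cls_rooted d : cls d \in rooted_nodes G.
Proof. by rewrite !inE block_cls // orbT. Qed.

Lemma rooted_nodeP T : T \in rooted_nodes G ->
  (exists d : dart G, T = cls d) \/ (exists v : vert G, T = vertex_node v).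
Proof.
rewrite !inE => /or3P[/eqP -> | /(blockP G_conn) | /imsetP[u _ ->]]; [ | by left | by right;
  exists u].
by case: rho rho_center => [v|d] ->; [right; exists v | left; exists d].
Qed.

Lemma cls_neq_vertex d v : cls d != vertex_node v.
Proof. by apply/eqP=> -[_ /setP/(_ d)]; rewrite mem_cls2 eqd_refl inE. Qed.

Lemma cls2_neq0 d : (cls d).2 != set0.
Proof. by apply/set0Pn; exists d; rewrite mem_cls2 eqd_refl. Qed.

Lemma avoid_sym S : symmetric (avoid S).
Proof.
move=> A B; rewrite /avoid /= /tree_edge; congr andb; last exact: andbC.
by rewrite andbCA [incident_nodes A B || _]orbC.
Qed.

Lemma avoid_connC S A B : connect (avoid S) A B -> connect (avoid S) B A.
Proof. by rewrite (sym_connect_sym (avoid_sym S)). Qed.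

Lemma avoid_cls_vertex S d v : v \in (cls d).1 -> vertex_node v \in rooted_nodes G ->
  cls d != S -> vertex_node v != S -> avoid S (cls d) (vertex_node v).
Proof.
move=> vd vN dS vS; rewrite /avoid /= dS vS /tree_edge vN cls_rooted !andbT /=.
by rewrite /incident_nodes /= eqxx cls2_neq0 sub1set vd orbT.
Qed.

Lemma avoidP S A B : avoid S A B -> [/\ A != S, B != S &
  (exists d v, [/\ A = cls d, B = vertex_node v & v \in (cls d).1]) \/
  (exists d v, [/\ A = vertex_node v, B = cls d & v \in (cls d).1])].
Proof.
case/and3P=> /and3P[/rooted_nodeP hA /rooted_nodeP hB hAB] AS BS; split=> //.
case: hA hAB => [[d ->]|[v ->]] {AS}; case: hB => [[e ->]|[u ->]] {BS};
  rewrite /incident_nodes /= ?eqxx ?cls2_neq0 ?(negPf (cls2_neq0 _)) //= ?sub1set ?orbF.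
- by move=> ud; left; exists d, u.
- by move=> ve; right; exists e, v.
Qed.

Lemma cls_articulation d e v : cls d <> cls e -> v \in (cls d).1 -> v \in (cls e).1 ->
  articulation v.
Proof.
move=> de vd ve; apply/negP=> /forallP/(_ (inr d)); rewrite !inE => /forallP/(_ (inr e)).
rewrite !inE /= connE; exact/negP/cls_share.
Qed.

Lemma articulation_rooted v : articulation v -> vertex_node v \in rooted_nodes G.
Proof. by move=> av; rewrite !inE imset_f ?inE ?av ?orbT. Qed.

Definition node_of x : piece G := match x with inl v => vertex_node v | inr d => cls d end.

(** A walk in the graph is followed in the block-tree. Where it passes from one class to another,
    the vertex in between is an articulation and hence a node. A vertex inside a single class need
    not be a node, so arrival at a vertex is recorded by a dart at it. *)
Lemma tree_walk S w d z : conn [set w] (inr d) z ->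
  (forall z', conn [set w] (inr d) z' -> node_of z' != S) ->
  match z with
  | inr f => connect (avoid S) (cls d) (cls f)
  | inl v => exists f, [/\ inc f = Some v, conn [set w] (inr d) (inr f)
                         & connect (avoid S) (cls d) (cls f)]
  end.
Proof.
move=> c nS.
pose P z := match z with
  | inr f => connect (avoid S) (cls d) (cls f)
  | inl v => exists f, [/\ inc f = Some v, conn [set w] (inr d) (inr f)
                         & connect (avoid S) (cls d) (cls f)]
  end.
change (P z); apply: connect_ind c; first exact: connect0.
move=> a b da ab; have db := connect_trans da (connect1 ab).
case: a b da ab db => [v|e] [u|f] //= da => [/andP[vw /eqP fv] df | /andP[uw /eqP eu] _ | /eqP
  -> _].
- case=> g [gv dg cg]; apply: connect_trans cg _.
  have [-> | gf] := eqVneq (cls g) (cls f); first exact: connect0.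
  have hg : v \in (cls g).1 by apply: incident_cls.
  have hf : v \in (cls f).1 by apply: incident_cls.
  have vN := articulation_rooted (cls_articulation (elimN eqP gf) hg hf).
  have vS := nS _ da.
  apply: (@connect_trans _ _ (vertex_node v)); apply: connect1.
    by apply: avoid_cls_vertex => //; apply: (nS (inr g)).
  by rewrite avoid_sym; apply: avoid_cls_vertex => //; apply: (nS (inr f)).
- by move=> h; exists e.
- by rewrite -(cls_eqP _ _ (eqd_flip e)).
Qed.

Lemma center_conn_rho w v : v \in (center G).1 -> v != w ->
  rho != inl w -> conn [set w] rho (inl v).
Proof.
case: rho rho_center => [c|d] /= -> => [| vd vw _].
  by rewrite inE => /eqP -> _ _; apply: connect0.
by apply: items_cls_conn; [rewrite inE | apply: contraNneq vw => -[->]].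
Qed.

Lemma center_sub w v : v \in (center G).1 -> v = w \/ conn [set w] rho (inl v).
Proof.
move=> vc; have [? | vw] := eqVneq v w; first by left.
right; have [rw | ?] := eqVneq rho (inl w); last exact: center_conn_rho.
move: rho_center vc; rewrite rw /= => ->; rewrite inE => /eqP vw'.
by rewrite vw' eqxx in vw.
Qed.

(** Deleting the node from the tree and the vertex from the graph has the same effect: consecutive
    nodes of a tree path share a vertex other than [w], and conversely walks are followed by
    [tree_walk]. *)
Lemma avoid_vertex_conn w d :
  center G != vertex_node w ->
  connect (avoid (vertex_node w)) (cls d) (center G) = conn [set w] (inr d) rho.
Proof.
move=> cw; apply/idP/idP => [/avoid_connC c | c].
  (* Invariant along the tree path that starts at the center. *)
  pose P T := forall z, z \in items T -> z != inl w -> conn [set w] z rho.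
  have: P (cls d).
    apply: connect_ind c.
      move=> z; case: rho rho_center => [v|e] /= -> hz zw.
        move: hz zw; case: z => [u|f]; rewrite in_items inE // => /eqP -> _.
        exact: connect0.
      exact/connC/items_cls_conn.
    move=> A B _ /avoidP[Aw Bw [] [e [v [EA EB ve]]]]; subst A B => IH z.
      case: z => [u|f]; rewrite in_items inE // => /eqP ->; apply: IH.
      by rewrite in_items.
    have vw : v != w by apply: contraNneq Aw => ->.
    have vwi : inl v != inl w :> vert G + dart G by apply: contraNneq vw => -[->].
    move=> hz zw; apply: conn_trans (items_clsP2 hz _ zw vwi) _; first by rewrite in_items.
    by apply: IH; rewrite ?inE.
  by move/(_ (inr d)); apply => //; rewrite in_items mem_cls2 eqd_refl.
have nS z : conn [set w] (inr d) z -> node_of z != vertex_node w.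
  case: z => [v|f] dz /=; last exact: cls_neq_vertex.
  by apply/eqP=> -[/set1_inj vw]; case: (conn_off dz) => // -[_]; rewrite vw /= !inE eqxx.
have := tree_walk c nS; case E : rho rho_center c => [v|e] /= ->; last by [].
move=> dv [f [fv _ cf]]; apply: connect_trans cf (connect1 _).
apply: avoid_cls_vertex; rewrite ?cls_neq_vertex //; first exact: incident_cls.
- by move: rho_center; rewrite E /= => <-; rewrite !inE eqxx.
- by move: rho_center cw; rewrite E /= => <-.
Qed.

Lemma vertex_below w d :
  below (vertex_node w) (cls d) = ~~ conn [set w] (inr d) rho || (center G == vertex_node w).
Proof.
rewrite /below (negPf (cls_neq_vertex d w)) /= orbC.
have [cw | cw] := eqVneq (center G) (vertex_node w); last by rewrite -avoid_vertex_conn.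
rewrite /=; apply/negP=> /avoid_connC/connectP[[|a p] /=].
  by move=> _ E; case/eqP: (cls_neq_vertex d w); rewrite E.
by case/andP=> /avoidP[]; rewrite cw eqxx.
Qed.

(** A tree path that leaves the block of [s] through [w] never returns to the side of [s]: a class
    entered at [w] is cut off by [cls_share], and a class entered at another vertex lies on the same
    side as that vertex. *)
Lemma reach_separated s w T z : w \in (cls s).1 ->
  connect (avoid (cls s)) (vertex_node w) T ->
  z \in items T -> z != inl w -> ~~ conn [set w] (inr s) z.
Proof.
move=> ws wT; pose P T := forall z, z \in items T -> z != inl w -> ~~ conn [set w] (inr s) z.
move: z; change (P T).
move: wT; apply: connect_ind.
  by move=> [v|e]; rewrite in_items inE // => /eqP ->; rewrite eqxx.
move=> A B _ /avoidP[As Bs [] [e [v [EA EB ve]]]]; subst A B => IH z hz zw.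
  case: z hz zw => [u|f]; rewrite in_items inE // => /eqP -> vw; apply: IH vw.
  by rewrite in_items.
have [vw | vw] := eqVneq v w; last first.
  have vwi : inl v != inl w :> vert G + dart G by apply: contraNneq vw => -[->].
  have := IH (inl v); rewrite in_items inE eqxx => /(_ isT vwi); apply: contra => sz.
  by apply: conn_trans sz _; apply: items_clsP2 hz _ zw vwi; rewrite in_items.
have : ~~ conn [set w] (inr s) (inr e).
  by apply: cls_share => //; [apply/eqP; rewrite eq_sym | rewrite -vw].
apply: contra => sz; apply: conn_trans sz _; apply: connC.
exact: items_cls_conn.
Qed.

(** Here [w] is the parent of the block. From a dart not on the side of [s] a walk leads to [w]
    without touching the block and then on to the center, while [reach_separated] excludes this for
    the darts on the side of [s]. *)
Lemma block_below s w d : w \in (cls s).1 -> vertex_node w \in rooted_nodes G ->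
  connect (avoid (cls s)) (vertex_node w) (center G) ->
  below (cls s) (cls d) = conn [set w] (inr s) (inr d).
Proof.
move=> ws wN wc.
have [sd | nsd] := boolP (conn [set w] (inr s) (inr d)).
  rewrite /below; apply/orP; right; apply/negP=> dc.
  have := reach_separated (z := inr d) ws (connect_trans wc (avoid_connC dc)).
  by rewrite in_items mem_cls2 eqd_refl sd => /(_ isT isT).
apply/negbTE; rewrite negb_or; apply/andP; split.
  by apply: contra nsd => /eqP/esym/cls_eqP/eqdP.
rewrite negbK; have [f fw df] := first_hit (G_conn (inr d) (inl w)) isT.
rewrite setU0 in df.
have nS z : conn [set w] (inr d) z -> node_of z != cls s.
  case: z => [v|e] dz /=; first by rewrite eq_sym cls_neq_vertex.
  apply: contra nsd => /eqP/esym/cls_eqP/eqdP/(_ w) se; exact: conn_trans se (connC dz).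
apply: connect_trans (tree_walk df nS) (connect_trans (connect1 _) wc).
apply: avoid_cls_vertex => //; first exact: incident_cls.
  exact: (nS (inr f)).
by rewrite eq_sym cls_neq_vertex.
Qed.

Lemma rho_in_center : rho \in items (center G).
Proof.
case: rho rho_center => [v|d] /= ->; rewrite in_items ?mem_cls2 ?eqd_refl //.
by rewrite inE.
Qed.

Lemma rho_separated s w : w \in (cls s).1 ->
  connect (avoid (cls s)) (vertex_node w) (center G) -> ~~ conn [set w] (inr s) rho.
Proof.
move=> ws wc; have [-> | rw] := eqVneq rho (inl w); last first.
  exact: reach_separated ws wc rho_in_center rw.
by apply/negP=> /connC /conn_in; rewrite inE eqxx => /(_ isT).
Qed.

Definition side w (K : {set vert G + dart G}) : Prop :=
  [/\ inl w \notin K, forall x y, x \in K -> conn [set w] x y -> y \in K & rho \notin K].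

(** A subtree is known by its darts and their ends. By connectedness of [G], every vertex of [K],
    and [w] too once [K] has a dart, is the end of a dart in [K]. *)
Lemma side_piece w K A : side w K -> A = [set d | inr d \in K] -> A != set0 ->
  ([set v | [exists d, (d \in A) && (inc d == Some v)]], A) =
  (w |: (component_piece K).1, (component_piece K).2).
Proof.
move=> [wK clK _] -> /set0Pn[a]; rewrite inE => aK; congr (_, _).
apply/setP=> v; rewrite !inE; apply/existsP/orP => [[d] | [/eqP -> | vK]].
- rewrite inE => /andP[dK /eqP dv]; have [-> | vw] := eqVneq v w; [by left | right].
  by apply: clK dK (conn_inc dv _); rewrite inE.
- have [f fw af] := first_hit (G_conn (inr a) (inl w)) isT; exists f.
  by rewrite inE fw eqxx andbT; apply: clK aK _; rewrite setU0 in af.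
- have vw : v != w by apply: contraNneq wK => <-.
  have := first_hit (G_conn (inr a) (inl v)) isT; rewrite setU0 => -[f fv _].
  exists f; rewrite inE fv eqxx andbT; apply: clK vK (connC (conn_inc fv _)).
  by rewrite inE.
Qed.

Definition below_darts S := [set d | below S (cls d)].

Lemma subtree_piece_cls S : subtree_piece S =
  ([set v | [exists d, (d \in below_darts S) && (inc d == Some v)]], below_darts S).
Proof.
rewrite /subtree_piece; congr pair; apply/setP=> a; rewrite [RHS]inE.
  apply/bigcupP/existsP => [[B] | [d]].
    rewrite inE => /and3P[_ /(blockP G_conn)[e ->] eS] /mem_cls1[d /cls_eqP ed da].
    by exists d; rewrite inE -ed eS da eqxx.
  rewrite inE => /andP[dS /eqP da]; exists (cls d); last exact: incident_cls.
  by rewrite inE cls_rooted block_cls.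
apply/bigcupP/idP => [[B] | aS].
  rewrite inE => /and3P[_ /(blockP G_conn)[e ->] eS]; rewrite mem_cls2.
  by move/cls_eqP <-.
by exists (cls a); rewrite ?mem_cls2 ?eqd_refl // inE cls_rooted block_cls.
Qed.

(** The first form comes from a block of the tree, the second from an articulation, whose subtree
    may comprise several components. The distinction decides the case of two atoms attached at the
    same vertex. *)
Definition block_side w (K : {set vert G + dart G}) : Prop :=
  side w K /\ ((exists s, K = [set z | conn [set w] (inr s) z]) \/
               K = [set z | (z != inl w) && ~~ conn [set w] z rho]).

Lemma notin_conn w z : conn [set w] z (inl w) -> z = inl w.
Proof. by move/connC/conn_in => ->; rewrite ?inE. Qed.

Lemma block_part_side P : block_part P -> exists w K,
  [/\ block_side w K, [exists d, inr d \in K] &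
     P = ((w |: (component_piece K).1, (component_piece K).2), [set w])].
Proof.
case/existsP=> S /andP[SN /existsP[w /and5P[Sc Sw /eqP EP ne _]]].
suff [K [sK EK]] : exists K, block_side w K /\ below_darts S = [set d | inr d \in K].
  have ne' : below_darts S != set0 by move: ne; rewrite EP subtree_piece_cls.
  exists w, K; split=> //.
    by move: ne'; rewrite EK => /set0Pn[d]; rewrite inE => dK; apply/existsP; exists d.
  by rewrite EP subtree_piece_cls (side_piece (proj1 sK) EK).
move: Sw; rewrite /attached_at; have [S2 /eqP ESw | S2] := boolP (S.2 == set0).
  exists [set z | (z != inl w) && ~~ conn [set w] z rho]; split.
    split; last by right.
    split; first by rewrite inE eqxx.
      move=> x y; rewrite !inE => /andP[xw xr] xy; apply/andP; split.
        by apply: contraNneq xw => yw; apply/eqP/notin_conn; rewrite -yw.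
      by apply: contra xr; apply: conn_trans.
    by rewrite inE conn_refl andbF.
  apply/setP=> d; rewrite !inE ESw vertex_below.
  (* If [w] itself is the center, then [rho] is the isolated item [w], no dart reaches it, and every
     block is below [w]. *)
  case: eqP => [cw | _]; last by rewrite orbF.
  rewrite orbT; apply/esym/negP.
  case: rho rho_center => [v|e] /= cE.
    by move: cE; rewrite cw => -[/set1_inj <-] /notin_conn.
  by case/eqP: (cls_neq_vertex e w); rewrite -cE.
case: (rooted_nodeP SN) => [[s ES] | [v ES]]; last by rewrite ES eqxx in S2.
subst S; case/andP=> /and3P[_ wN /orP[]]; rewrite /incident_nodes.
  by rewrite (negPf S2).
case/and3P=> _ _; rewrite sub1set => ws; rewrite /below negb_or negbK => /andP[_ wc].
exists [set z | conn [set w] (inr s) z]; split.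
  split; last by left; exists s.
  split; rewrite ?inE; first by apply/negP=> /notin_conn.
    by move=> x y; rewrite !inE; apply: conn_trans.
  exact: rho_separated.
by apply/setP=> d; rewrite !inE; apply: block_below.
Qed.

End RootedTree.

(** * Proper parts *)

Section ProperParts.
Variable G : centered_graph.
Implicit Types (U W : {set vert G}) (x y z : vert G + dart G) (S T B : piece G)
  (d e f : dart G) (u v w : vert G) (K : {set vert G + dart G}).
Hypothesis G_conn : forall x y, conn set0 x y.

Definition component U x := [set z | conn U x z].

Definition sep_part U K : part G :=
  ((U :|: (component_piece K).1, (component_piece K).2), U).

(** Inside a block [v] alone does not separate [y] from [u], so a path up to its first visit to [u]
    avoids both vertices. *)
Lemma touch b u v y : u \in (cls b).1 -> v \in (cls b).1 -> u != v ->
  y \in items (cls b) -> off [set u; v] y ->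
  exists2 f, inc f = Some u & conn [set u; v] y (inr f).
Proof.
move=> ub vb uv yb yU; apply: first_hit; last first.
  by apply: contraTneq yU => -> /=; rewrite !inE eqxx.
apply: items_clsP2 yb _ _ _; rewrite ?in_items //.
by apply: contraTneq yU => -> /=; rewrite !inE eqxx orbT.
Qed.

Definition separates U b := exists y1 y2 : vert G,
  [/\ y1 \in (cls b).1, y2 \in (cls b).1, y1 \notin U, y2 \notin U
    & ~~ conn U (inl y1) (inl y2)].

Lemma items_connect S a z : a \in items S -> connect (adjacent S) a z -> z \in items S.
Proof.
move=> aS; apply: (connect_ind (P := fun z => z \in items S)) => //.
by move=> [v|d] [w|e] _ //=; rewrite !in_items => /and3P[].
Qed.

Lemma in_items_remove S U z : (z \in items (remove S U)) = off U z && (z \in items S).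
Proof. by case: z => [v|d]; rewrite !in_items // inE. Qed.

(** By [cls_convex], items of a block that are joined in [G \ U] are joined within the block, so the
    components of the cut block can be told apart in the whole graph. *)
Lemma two_cutP U b : reflect (separates U b) (two_cut (cls b) U).
Proof.
apply: (iffP card_gt1P) => [[K1 [K2 []]] | [y1 [y2 [b1 b2 U1 U2 n12]]]].
  rewrite !inE => /andP[/existsP[a1 /andP[h1 /eqP E1]] /set0Pn[y1]].
  rewrite inE E1 inE => c1 /andP[/existsP[a2 /andP[h2 /eqP E2]] /set0Pn[y2]].
  rewrite inE E2 inE => c2 K12.
  have := items_connect h1 c1; have := items_connect h2 c2.
  rewrite !in_items_remove /= !in_items => /andP[U2 b2] /andP[U1 b1].
  exists y1, y2; split=> //; apply: contra K12 => c12.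
  have {}c12 : connect (adjacent (remove (cls b) U)) (inl y1) (inl y2).
    by apply: cls_convex c12; rewrite in_items.
  have sym : connect_sym (adjacent (remove (cls b) U)).
    apply: sym_connect_sym => -[v|d] [w|e] //=; rewrite andbCA; congr [&& _, _ & _].
    by apply/eqP/eqP => ->; rewrite flipK.
  have a12 : connect (adjacent (remove (cls b) U)) a1 a2.
    by apply: connect_trans c1 (connect_trans c12 _); rewrite sym.
  by apply/eqP/setP=> z; rewrite !inE (same_connect sym a12).
pose C (y : vert G) := [set z | connect (adjacent (remove (cls b) U)) (inl y) z].
have mem (y : vert G) : y \in (cls b).1 -> y \notin U ->
    C y \in [set K | is_component (remove (cls b) U) K & (component_piece K).1 != set0].
  move=> yb yU; rewrite inE; apply/andP; split.
    by apply/existsP; exists (inl y); rewrite in_items_remove in_items /= yU yb eqxx.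
  by apply/set0Pn; exists y; rewrite !inE connect0.
exists (C y1), (C y2); split; rewrite ?mem //.
apply: contra n12 => /eqP/setP/(_ (inl y2)); rewrite !inE connect0.
exact: connect_conn.
Qed.

Definition proper_side b u v K :=
  [/\ u != v, u \in (cls b).1 /\ v \in (cls b).1, separates [set u; v] b,
      3 <= degree_in (cls b) u /\ 3 <= degree_in (cls b) v
    & exists y : vert G, [/\ y \in (cls b).1, y \notin [set u; v], K = component [set u; v]
      (inl y)
                  & ~~ ((center G).1 \subset (component_piece K).1)]].

Lemma proper_partP (P : part G) : reflect
  (exists b u v K, proper_side b u v K /\ P = sep_part [set u; v] K)
  (proper_part P).
Proof.
apply: (iffP existsP) => [[B /existsP[u /existsP[v /existsP[K /=]]]] | ].
  case/andP=> /(blockP G_conn)[b ->] /andP[uv] /andP[/subsetP uvB] /andP[/two_cutP sb].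
  case/andP=> du /andP[dv] /andP[/existsP[a /andP[_ /eqP EK]]].
  case/andP=> /existsP[L /andP[/existsP[a' /andP[ha' /eqP EL]] /subsetP LK]].
  case/andP=> /set0Pn[x]; rewrite inE => xK /andP[nc /eqP ->].
  move: ha'; rewrite in_items_remove => /andP[oa' a'b].
  have ub : u \in (cls b).1 by apply: uvB; rewrite !inE eqxx.
  have vb : v \in (cls b).1 by apply: uvB; rewrite !inE eqxx orbT.
  have Ka z : (z \in K) = conn [set u; v] a z by rewrite EK inE connE.
  have a'K : a' \in K by apply: LK; rewrite EL inE connect0.
  have [y [yb yU ay]] : exists y : vert G,
      [/\ y \in (cls b).1, y \notin [set u; v] & conn [set u; v] a' (inl y)].
    case: a' oa' a'b a'K {EL} => [y|d].
      by rewrite in_items => yU yb _; exists y; split=> //; apply: conn_refl.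
    (* The item of the block found in [K] may be a dart. As [K] has a vertex [x], the edge of this
       dart has an end off the cut, and this end is a vertex of the block. *)
    move=> _; rewrite in_items => db; rewrite Ka => ad.
    have dx : conn [set u; v] (inr d) (inl x).
      by apply: conn_trans (connC ad) _; rewrite -Ka.
    have [y yU hy] := conn_dart_vert dx; exists y.
    rewrite mem_cls2 in db; case: hy => hy.
      by split=> //; [apply/mem_cls1; exists d | apply: conn_inc].
    split=> //; first by apply/mem_cls1; exists (flip d) => //; apply: eqd_trans db (eqd_flip
      _).
    exact: conn_trans (conn_flip _ _) (conn_inc hy yU).
  exists b, u, v, K; split=> //; split=> //; exists y; split=> //.
  apply/setP=> z; rewrite Ka inE; rewrite Ka in a'K.
  apply/idP/idP => [az | yz]; last exact: conn_trans a'K (conn_trans ay yz).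
  exact: conn_trans (connC (conn_trans a'K ay)) az.
move=> [b [u [v [K [[uv [ub vb] sb [du dv] [y [yb yU EK nc]]] ->]]]]].
exists (cls b); apply/existsP; exists u; apply/existsP; exists v; apply/existsP; exists K =>
  /=.
rewrite block_cls // uv (introT (two_cutP _ _) sb) du dv nc eqxx !andbT /=.
have yK : inl y \in K by rewrite EK inE conn_refl.
apply/and4P; split.
- by apply/subsetP=> w /set2P[] ->.
- apply/existsP; exists (inl y); rewrite in_items_remove in_items inE /= yU /= EK.
  by apply/eqP/setP=> z; rewrite !inE connE.
- apply/existsP; exists [set z | connect (adjacent (remove (cls b) [set u; v])) (inl y) z].
  apply/andP; split; last by apply/subsetP=> z; rewrite EK !inE; apply: connect_conn.
  by apply/existsP; exists (inl y); rewrite in_items_remove in_items /= yU yb eqxx.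
- by apply/set0Pn; exists y; rewrite inE.
Qed.

Lemma proper_side_sym b u v K : proper_side b u v K -> proper_side b v u K.
Proof.
move=> [uv [ub vb] sb [du dv] ex]; rewrite /proper_side eq_sym (setUC [set v]).
by split.
Qed.

Lemma proper_closed b u v K : proper_side b u v K ->
  forall x y, x \in K -> conn [set u; v] x y -> y \in K.
Proof.
case=> _ _ _ _ [y [_ _ -> _]] a c; rewrite !inE; exact: conn_trans.
Qed.

Lemma proper_off b u v K : proper_side b u v K -> forall z, z \in K -> off [set u; v] z.
Proof.
case=> _ _ _ _ [y [_ yU -> _]] z; rewrite inE => yz; exact: conn_offr yz yU.
Qed.

Lemma proper_conn b u v K : proper_side b u v K ->
  forall x y, x \in K -> y \in K -> conn [set u; v] x y.
Proof.
case=> _ _ _ _ [y [_ _ -> _]] a c; rewrite !inE => /connC; exact: conn_trans.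
Qed.

Lemma sep_included U K U' K' : {subset K' <= K} ->
  (forall v, v \in U' -> v \in U \/ inl v \in K) ->
  included (sep_part U' K').1 (sep_part U K).1.
Proof.
move=> KK UU; apply/andP; split; apply/subsetP=> a; rewrite !inE; last exact: KK.
by case/orP=> [/UU[] -> | /KK ->]; rewrite ?orbT.
Qed.

Lemma atom_min (P Q : part G) : is_atom P -> is_part Q -> included Q.1 P.1 -> Q.1 = P.1.
Proof. by case/andP=> _ /forallP/(_ Q)/implyP h pQ iQ; apply/eqP/h/andP. Qed.

End ProperParts.

(** * Disjointness of atoms *)

Section Disjointness.
Variable G : centered_graph.
Implicit Types (U W : {set vert G}) (x y z : vert G + dart G) (S T B : piece G)
  (d e f : dart G) (u v w : vert G) (K : {set vert G + dart G}) (P Q : part G).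
Hypothesis G_conn : forall x y, conn set0 x y.
Variable rho : vert G + dart G.
Hypothesis rho_center : represents rho.

Lemma to_vert w z : z != inl w ->
  exists2 f, inc f = Some w & conn [set w] z (inr f).
Proof. by move/(first_hit (G_conn z (inl w))); rewrite setU0. Qed.

(** Suppose that [w'] is in [K]. If [w] is in [K'], then so is the center, since it reaches [w]
    outside [K]. Otherwise [K'] lies within [K] and misses [w], against minimality. *)
Lemma block_atoms_cross w K w' K' :
  side rho w K -> side rho w' K' ->
  is_atom (sep_part [set w] K) -> is_part (sep_part [set w'] K') -> inl w' \notin K.
Proof.
move=> [wK clK rK] [w'K' clK' rK'] aP pQ; apply/negP=> w'K.
have ww' : w != w' by apply: contraNneq wK => ->.
have [wK' | wK'] := boolP (inl w \in K').
  case/negP: rK'; have [-> // | rw] := eqVneq rho (inl w).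
  have [f fw rf] := to_vert rw; apply: clK' wK' _; apply: connC.
  apply: conn_trans (conn_inc fw _); last by rewrite inE.
  apply: conn_switch rf => -[v|//] rv; rewrite /= inE; apply: contraNneq rK => vw'.
  by apply: clK w'K (connC _); rewrite -vw'.
have sK z : z \in K' -> z \in K.
  move=> zK'; have zw' : z != inl w' by apply: contraTneq zK' => ->.
  have [f fw' zf] := to_vert zw'; apply: clK w'K (connC _).
  apply: (conn_trans (y := inr f)); last by apply: conn_inc => //; rewrite inE eq_sym.
  apply: conn_switch zf => -[v|//] zv; rewrite /= inE; apply: contraNneq wK' => <-.
  exact: clK' zK' zv.
have inc : included (sep_part [set w'] K').1 (sep_part [set w] K).1.
  by apply: sep_included sK _ => v /set1P ->; right.
have /(congr1 fst)/setP/(_ w) := atom_min aP pQ inc.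
by rewrite !inE eqxx (negPf ww') (negPf wK').
Qed.

(** For different attachments, a common item would lead inside [K] to [w] and put it into [K']. For
    the same attachment, a single component is contained in every side that it meets, so minimality
    applies, and two sides of the second form are equal. *)
Lemma block_block w K w' K' : block_side rho w K -> block_side rho w' K' ->
  is_atom (sep_part [set w] K) -> is_atom (sep_part [set w'] K') ->
  sep_part [set w] K <> sep_part [set w'] K' ->
  inl w' \notin K /\ forall z, z \in K -> z \notin K'.
Proof.
move=> [sP tP] [sQ tQ] aP aQ PQ.
have [pP _] := andP aP; have [pQ _] := andP aQ.
have w'K := block_atoms_cross sP sQ aP pQ; split=> // z zK; apply/negP=> zK'.
have [wK clK rK] := sP; have [_ clK' rK'] := sQ.
have [ww' | ww'] := eqVneq w w'; last first.
  have wz : z != inl w by apply: contraNneq wK => <-.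
  have [f fw zf] := to_vert wz.
  case/negP: (block_atoms_cross sQ sP aQ pP); apply: clK' zK' _.
  apply: conn_trans (conn_inc fw _); last by rewrite inE.
  apply: conn_switch zf => -[v|//] zv; rewrite /= inE; apply: contraNneq w'K => <-.
  exact: clK zK zv.
subst w'; apply: PQ.
have sub K1 K2 : is_atom (sep_part [set w] K2) -> is_part (sep_part [set w] K1) ->
    {subset K1 <= K2} -> sep_part [set w] K1 = sep_part [set w] K2.
  move=> a2 p1 s12; congr pair; apply: (atom_min a2 p1).
  by apply: sep_included s12 _ => v; left.
have single K1 K2 : z \in K1 -> z \in K2 -> side rho w K2 ->
    (exists s, K1 = [set z | conn [set w] (inr s) z]) -> {subset K1 <= K2}.
  move=> z1 z2 [_ cl2 _] [s E1] y; rewrite E1 inE => sy.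
  by apply: cl2 z2 _; apply: conn_trans sy; apply: connC; rewrite E1 inE in z1.
case: tP => [tP | tP]; first exact/sub/single.
case: tQ => [tQ | tQ]; first exact/esym/sub/single.
by rewrite tP tQ.
Qed.

(** The side [K] hangs on the rest of the graph at [w] only, so what lies outside of it reaches [w]
    without entering it. *)
Lemma conn_outside w K U x :
  (forall x y, x \in K -> conn [set w] x y -> y \in K) ->
  (forall v, v \in U -> inl v \in K) -> w \notin U -> x \notin K ->
  conn U x (inl w).
Proof.
move=> clK UK wU xK; have [-> | xw] := eqVneq x (inl w); first exact: conn_refl.
have [f fw xf] := to_vert xw; apply: conn_trans (conn_inc fw wU).
apply: conn_switch xf => -[v|//] xv /=; apply: contra xK => /UK vK.
exact: clK vK (connC xv).
Qed.

(** With the cut inside [K] and [w] in [K'], all that lies outside [K] would be joined to [w] and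
    belong to [K'], including the whole center, which a proper part must not contain. *)
Lemma center_avoids w K b u v K' : side rho w K -> proper_side b u v K' ->
  inl u \in K -> inl v \in K -> inl w \notin K'.
Proof.
move=> [wK clK rK] sQ uK vK; apply/negP=> wK'.
have UK a : a \in [set u; v] -> inl a \in K by case/set2P=> ->.
have wU : w \notin [set u; v] by apply: contra wK => /UK.
have [_ _ _ _ [y [_ _ _ /subsetP]]] := sQ; case=> a ac.
rewrite inE; case: (center_sub rho_center w ac) => [-> // | ra].
have aK : inl a \notin K by apply: contra rK => aK; apply: clK aK (connC ra).
exact: (proper_closed sQ) wK' (connC (conn_outside clK UK wU aK)).
Qed.

Lemma separates_notin b u v K' : proper_side b u v K' ->
  exists y : vert G, [/\ y \in (cls b).1, y \notin [set u; v] & inl y \notin K'].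
Proof.
move=> sQ; have [_ _ [y1 [y2 [b1 b2 U1 U2 n12]]] _ _] := sQ.
have [y1K | y1K] := boolP (inl y1 \in K'); last by exists y1.
exists y2; split=> //; apply: contra n12 => y2K.
exact: proper_conn sQ _ _ y1K y2K.
Qed.

(** If [u] is in [K], the whole block of the cut lies in [K] and [w]. Then [K'] stays in [K] too,
    and its part misses a vertex of the block across the cut, against minimality. *)
Lemma block_proper_vertex w K b u v K' : side rho w K -> proper_side b u v K' ->
  is_atom (sep_part [set w] K) -> is_part (sep_part [set u; v] K') -> inl u \notin K.
Proof.
move=> sP sQ aP pQ; apply/negP=> uK; have [wK clK rK] := sP.
have [uv [ub vb] _ _ [y [yb yU EK' nc]]] := sQ.
have uw : inl u != inl w :> vert G + dart G by apply: contraNneq wK => <-.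
have bK z : z \in items (cls b) -> z != inl w -> z \in K.
  move=> zb zw; apply: clK uK _; apply: items_clsP2 zb uw zw; by rewrite in_items.
have wK' : inl w \notin K'.
  apply/negP=> wK'.
  have wU := proper_off sQ wK'; rewrite /= in wU.
  have vK : inl v \in K.
    by apply: bK; rewrite ?in_items //; apply: contraNneq wU => -[->]; rewrite !inE eqxx orbT.
  by case/negP: (center_avoids sP sQ uK vK).
have yK' : inl y \in K' by rewrite EK' inE conn_refl.
have K'K z : z \in K' -> z \in K.
  move=> zK'; have yK : inl y \in K.
    by apply: bK; rewrite ?in_items //; apply: contraNneq wK' => <-.
  apply: clK yK _; apply: conn_switch (proper_conn sQ yK' zK') => -[a|//] ya /=.
  rewrite inE; apply: contraNneq wK' => <-; exact: proper_closed sQ _ _ yK' ya.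
have inU a : a \in (cls b).1 -> a \in [set w] \/ inl a \in K.
  move=> ab; have [->|aw] := eqVneq a w; [by left; rewrite inE | right].
  by apply: bK; rewrite ?in_items //; apply: contraNneq aw => -[->].
have inc : included (sep_part [set u; v] K').1 (sep_part [set w] K).1.
  by apply: sep_included K'K _ => a /set2P[] ->; apply: inU.
have [a [ab aU aK']] := separates_notin sQ.
have /(congr1 fst)/setP/(_ a) := atom_min aP pQ inc.
rewrite !inE -in_set2 (negPf aU) (negPf aK') => /esym/norP[].
by case: (inU _ ab) => [/set1P -> | ->]; rewrite ?eqxx.
Qed.

(** Since [K] contains neither [u] nor [v], walks inside [K] survive the cut. If [w] were in [K'],
    the block atom would lie in the proper one, and minimality would force both [u] and [v] to be
    [w]. A common item leads to [w], which must then be [u] or [v]; but then the rest of the block,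
    and with it the other cut vertex, lies in [K]. *)
Lemma block_proper w K b u v K' : block_side rho w K -> proper_side b u v K' ->
  is_atom (sep_part [set w] K) -> is_atom (sep_part [set u; v] K') ->
  [/\ inl u \notin K, inl v \notin K, inl w \notin K' & forall z, z \in K -> z \notin K'].
Proof.
move=> [sP _] sQ aP aQ; have [pP _] := andP aP; have [pQ _] := andP aQ.
have uK := block_proper_vertex sP sQ aP pQ.
have sQ' := proper_side_sym sQ.
have vK : inl v \notin K by apply: (block_proper_vertex sP sQ' aP); rewrite setUC.
have [wK clK rK] := sP; have [uv [ub vb] _ _ [y [yb yU EK' nc]]] := sQ.
have toK' z a : z \in K -> conn [set w] z a -> conn [set u; v] z a.
  move=> zK; apply: conn_switch => -[c|//] zc /=; have cK := clK _ _ zK zc.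
  by rewrite !inE; apply/norP; split; [apply: contraNneq uK | apply: contraNneq vK] => <-.
have wK' : inl w \notin K'.
  apply/negP=> wK'; have wU := proper_off sQ wK'.
  have KK' z : z \in K -> z \in K'.
    move=> zK; have zw : z != inl w by apply: contraNneq wK => <-.
    have [f fw zf] := to_vert zw; apply: proper_closed sQ _ _ wK' (connC _).
    exact: conn_trans (toK' _ _ zK zf) (conn_inc fw wU).
  have inc : included (sep_part [set w] K).1 (sep_part [set u; v] K').1.
    by apply: sep_included KK' _ => a /set1P ->; right.
  have /(congr1 fst)/setP E := atom_min aQ pP inc.
  have := E u; have := E v; rewrite !inE !eqxx orbT /= (negPf uK) (negPf vK) !orbF.
  by move=> /eqP vw /eqP uw; rewrite uw vw eqxx in uv.
split=> // z zK; apply/negP=> zK'.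
have zw : z != inl w by apply: contraNneq wK => <-.
have [f fw zf] := to_vert zw; have zf' := toK' _ _ zK zf.
have [wU | wU] := boolP (w \in [set u; v]); last first.
  case/negP: wK'; apply: proper_closed sQ _ _ zK' _.
  exact: conn_trans zf' (conn_inc fw wU).
have yK : inl y \in K.
  apply: clK zK _; apply: (conn_sub (W := [set u; v])); first by rewrite sub1set.
  by apply: proper_conn sQ _ _ zK' _; rewrite EK' inE conn_refl.
have yw : inl y != inl w :> vert G + dart G by apply: contraNneq wK => <-.
have bK a : a \in (cls b).1 -> a != w -> inl a \in K.
  move=> ab aw; apply: clK yK _; by apply: (@items_clsP2 _ b); rewrite ?in_items.
case/set2P: wU => wE; first by rewrite (bK v) // wE eq_sym in vK.
by rewrite (bK u) // wE in uK.
Qed.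

(** Let [w] separate the two blocks and let [Y] be the side of the second. If [w] is in the first
    cut, [u'] is joined within [K] to a block vertex outside [Y], which is absurd. Otherwise [Y] and
    [w] lie in [K], and it remains to ask where [w] is with respect to [K']. *)
Lemma proper_block_sep b u v K b' u' v' K' :
  proper_side b u v K -> proper_side b' u' v' K' -> cls b <> cls b' ->
  is_atom (sep_part [set u; v] K) -> is_part (sep_part [set u'; v'] K') ->
  inl u' \notin K.
Proof.
move=> sP sQ bb' aP pQ; apply/negP=> u'K.
have [w nw] := cls_neq bb'.
have [uv [ub vb] _ _ [y [yb yU EK nc]]] := sP.
have [uv' [ub' vb'] _ _ [y' [yb' yU' EK' nc']]] := sQ.
pose Y := [set z | conn [set w] (inr b') z].
have wY : inl w \notin Y by rewrite inE; apply/negP=> /notin_conn.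
have clY x z : x \in Y -> conn [set w] x z -> z \in Y by rewrite !inE; apply: conn_trans.
have bY a : a \in (cls b).1 -> inl a \notin Y.
  move=> ab; rewrite inE; have [-> | aw] := eqVneq (inl a : vert G + dart G) (inl w).
    by apply/negP=> /notin_conn.
  apply: contra nw => /connC; apply: conn_trans; apply: items_cls_conn => //.
  by rewrite in_items.
have b'Y a : a \in (cls b').1 -> a != w -> inl a \in Y.
  move=> ab aw; rewrite inE; apply: items_cls_conn; first by rewrite in_items.
  by apply: contraNneq aw => -[->].
have avoidU x z : x \in Y -> conn [set w] x z -> conn [set u; v] x z.
  move=> xY; apply: conn_switch => -[a|//] xa /=; apply/set2P=> -[] aE.
    by case/negP: (bY u ub); rewrite -aE; apply: clY xY xa.
  by case/negP: (bY v vb); rewrite -aE; apply: clY xY xa.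
have [wU | wU] := boolP (w \in [set u; v]).
  have u'w : u' != w by apply: contraTneq wU => <-; apply: (proper_off sP u'K).
  case/negP: (bY y yb); apply: clY (b'Y _ ub' u'w) _.
  apply: (conn_sub (W := [set u; v])); first by rewrite sub1set.
  by apply: proper_conn sP _ _ u'K _; rewrite EK inE conn_refl.
have YwU x : x \in Y -> conn [set u; v] x (inl w).
  move=> xY; have xw : x != inl w by apply: contraNneq wY => <-.
  have [f fw xf] := to_vert xw.
  exact: conn_trans (avoidU _ _ xY xf) (conn_inc fw wU).
have wK : inl w \in K.
  have [<- // | u'w] := eqVneq u' w.
  exact: proper_closed sP _ _ u'K (YwU _ (b'Y _ ub' u'w)).
have YK x : x \in Y -> x \in K.
  by move=> xY; apply: proper_closed sP _ _ wK (connC (YwU _ xY)).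
have b'YK a : a \in (cls b').1 -> inl a \in K.
  by move=> ab'; have [-> // | aw] := eqVneq a w; apply/YK/b'Y.
(* If [w] is in [K'], then [K'] contains all that is outside [Y], the two parts cover the graph, and
   one of them swallows the center. If not, [K'] stays within [Y] and hence within [K], against
   minimality. *)
have [wK' | wK'] := boolP (inl w \in K').
  have wU' := proper_off sQ wK'.
  have U'Y a : a \in [set u'; v'] -> inl a \in Y.
    move=> aU; have aw : a != w by apply: contraTneq aU => ->.
    by case/set2P: aU aw => ->; apply: b'Y.
  have outK' x : x \notin Y -> x \in K'.
    move=> xY; apply: proper_closed sQ _ _ wK' (connC _).
    exact: conn_outside clY U'Y wU' xY.
  have [rY | rY] := boolP (rho \in Y).
    case/negP: nc; apply/subsetP=> a ac; rewrite inE.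
    case: (center_sub rho_center w ac) => [-> // | ra]; exact/YK/(clY _ _ rY).
  case/negP: nc'; apply/subsetP=> a ac; rewrite inE.
  case: (center_sub rho_center w ac) => [-> // | ra]; apply: outK'.
  by apply: contra rY => aY; apply: clY aY (connC ra).
have y'K' : inl y' \in K' by rewrite EK' inE conn_refl.
have K'K z : z \in K' -> z \in K.
  move=> zK'; have y'w : y' != w by apply: contraNneq wK' => <-.
  apply: YK; apply: clY (b'Y _ yb' y'w) _.
  apply: conn_switch (proper_conn sQ y'K' zK') => -[a|//] ya /=.
  rewrite inE; apply: contraNneq wK' => <-; exact: proper_closed sQ _ _ y'K' ya.
have inc : included (sep_part [set u'; v'] K').1 (sep_part [set u; v] K).1.
  by apply: sep_included K'K _ => a /set2P[] ->; right; apply: b'YK.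
have uK : inl u \notin K by apply/negP=> /(proper_off sP) /=; rewrite !inE eqxx.
have /(congr1 fst)/setP/(_ u) := atom_min aP pQ inc.
rewrite !inE -in_set2 eqxx /= => /orP[/set2P[] uE | /K'K]; last by rewrite (negPf uK).
  by rewrite uE u'K in uK.
by rewrite uE b'YK in uK.
Qed.



Lemma no_smaller_proper u v K b u' v' K' a :
  is_atom (sep_part [set u; v] K) ->
  proper_side b u' v' K' -> {subset K' <= K} ->
  (forall a, a \in [set u'; v'] -> a \in [set u; v] \/ inl a \in K) ->
  a \in [set u; v] -> a \notin [set u'; v'] -> inl a \notin K' -> False.
Proof.
move=> aP sQ K'K UU aU aU' aK'.
have pQ : is_part (sep_part [set u'; v'] K').
  by apply/or3P; apply: Or32; apply/(proper_partP G_conn); exists b, u', v', K'.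
have /(congr1 fst)/setP/(_ a) := atom_min aP pQ (sep_included K'K UU).
by rewrite !inE -!in_set2 aU (negPf aU') (negPf aK').
Qed.

(** A pair of parallel edges that is already a block part is not a [dipole_part]. In both cases its
    piece belongs to some part, which is all that minimality needs. *)
Lemma dipole_is_part u v d1 d2 : u != v ->
  d1 \in joining u v -> d2 \in joining u v -> [set d1; flip d1] != [set d2; flip d2] ->
  exists2 Q, is_part Q & Q.1 = ([set u; v], joining u v).
Proof.
move=> uv j1 j2 d12; pose P : part G := (([set u; v], joining u v), [set u; v]).
have [/existsP[w pw] | nw] := boolP [exists w, block_part (P.1, [set w])].
  by exists (P.1, [set w]) => //; apply/or3P; apply: Or31.
exists P => //; apply/or3P; apply: Or33; apply/existsP; exists u; apply/existsP; exists v.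
rewrite uv eqxx nw /= andbT; apply/card_gt1P.
by exists [set d1; flip d1], [set d2; flip d2]; split => //; apply: imset_f.
Qed.

(** * Two cuts of the same block *)

Section SameBlock.
Variables (b : dart G) (u v u' v' : vert G) (K K' : {set vert G + dart G}).
Hypotheses (sP : proper_side b u v K) (sQ : proper_side b u' v' K').
Hypothesis (aP : is_atom (sep_part [set u; v] K)).
Hypothesis (u'K : inl u' \in K).

Let uK : inl u \notin K.
Proof. by apply/negP=> /(proper_off sP) /=; rewrite !inE eqxx. Qed.
Let vK : inl v \notin K.
Proof. by apply/negP=> /(proper_off sP) /=; rewrite !inE eqxx orbT. Qed.

(** Let [q] be a vertex of the block beyond the first cut. It reaches both [u] and [v] without
    meeting the second cut. The side of the second cut away from [q] therefore avoids [u] and [v],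
    lies in [K], and gives a smaller proper part. *)
Lemma nested_proper_cuts : v' \in [set u; v] \/ inl v' \in K -> False.
Proof.
move=> v'A.
have [uv [ub vb] _ _ _] := sP; have [uv' [ub' vb'] [y1 [y2 [b1 b2 U1 U2 n12]]] [du' dv'] _] :=
  sQ.
have [q [qb qU qK]] := separates_notin sP.
have UU a : a \in [set u'; v'] -> a \in [set u; v] \/ inl a \in K.
  by case/set2P=> ->; [right | ].
have [y [yb yU yq]] : exists y : vert G,
    [/\ y \in (cls b).1, y \notin [set u'; v'] & ~~ conn [set u'; v'] (inl y) (inl q)].
  have [c1 | ?] := boolP (conn [set u'; v'] (inl y1) (inl q)); last by exists y1.
  exists y2; split=> //; apply: contra n12 => c2; exact: conn_trans c1 (connC c2).
(* The walk from [q] to [a] stays outside [K] and off the first cut, so it meets no vertex of the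
   second one. *)
have touch_q a f : a \in [set u; v] -> inc f = Some a -> conn [set u; v] (inl q) (inr f) ->
    ~~ conn [set u'; v'] (inl y) (inl a).
  move=> aU fa qf; apply/negP=> ya; case/negP: yq.
  have aU' : a \notin [set u'; v'] := conn_offr ya yU.
  apply: conn_trans ya _; apply/connC; apply: conn_trans (conn_inc fa aU').
  apply: conn_switch qf => -[c|//] qc /=; apply/negP=> /UU[cU | cK].
    by have := conn_offr qc qU; rewrite /= cU.
  by case/negP: qK; apply: proper_closed sP _ _ cK (connC qc).
have nyu : ~~ conn [set u'; v'] (inl y) (inl u).
  have [||f fu qf] := touch ub vb uv (y := inl q); rewrite ?in_items //.
  by apply: touch_q fu qf; rewrite !inE eqxx.
have nyv : ~~ conn [set u'; v'] (inl y) (inl v).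
  have vu : v != u by rewrite eq_sym.
  have [||f fu qf] := touch vb ub vu (y := inl q); rewrite ?in_items //.
    by rewrite /= setUC.
  by rewrite setUC in qf; apply: touch_q fu qf; rewrite !inE eqxx orbT.
have toU z : conn [set u'; v'] (inl y) z -> conn [set u; v] (inl y) z.
  apply: conn_switch => -[c|//] yc /=; apply/set2P=> -[] cE.
    by rewrite -cE yc in nyu.
  by rewrite -cE yc in nyv.
have yK : inl y \in K.
  have [||f fu' yf] := touch ub' vb' uv' (y := inl y); rewrite ?in_items //.
  apply: proper_closed sP _ _ u'K (connC (conn_trans (toU _ yf) (conn_inc fu' _))).
  exact: (proper_off sP u'K).
have sub : {subset component [set u'; v'] (inl y) <= K}.
  by move=> z; rewrite inE => yz; apply: proper_closed sP _ _ yK (toU _ yz).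
have side : proper_side b u' v' (component [set u'; v'] (inl y)).
  split=> //; first by exists y1, y2.
  exists y; split=> //; have [_ _ _ _ [_ [_ _ _ nc]]] := sP; apply: contra nc => /subsetP nc.
  by apply/subsetP=> a /nc; rewrite 1!inE => /sub aK; rewrite inE.
have uu' : u != u' by apply: contraNneq uK => ->.
have vu' : v != u' by apply: contraNneq vK => ->.
(* As [u'] is in [K], only [v'] can coincide with [u] or [v], so one of these two is missing from
   the smaller part. *)
have [uv'E | uv'N] := eqVneq u v'.
  apply: (no_smaller_proper (a := v) aP side sub UU); rewrite ?inE ?eqxx ?orbT //.
  by rewrite negb_or vu' -uv'E eq_sym.
apply: (no_smaller_proper (a := u) aP side sub UU); rewrite ?inE ?eqxx //.
by rewrite negb_or uu' uv'N.
Qed.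

Hypotheses (v'U : v' \notin [set u; v]) (v'K : inl v' \notin K).

Let u'U : u' \notin [set u; v].
Proof. exact: (proper_off sP u'K). Qed.

(** An item that reaches neither [u] nor [v] would still be joined to both [u'] and [v'] after the
    deletion of [u] and [v], and would put [v'] into [K]. *)
Lemma crossing_meets z : z \in items (cls b) -> off [set u'; v'] z ->
  conn [set u'; v'] z (inl u) \/ conn [set u'; v'] z (inl v).
Proof.
move=> zb zU; have [uv' [ub' vb'] _ _ _] := sQ.
have [|nzu] := boolP (conn _ z (inl u)); [by left | right].
apply: contraNT v'K => nzv.
have toU x : conn [set u'; v'] z x -> conn [set u; v] z x.
  apply: conn_switch => -[c|//] zc /=; apply/set2P=> -[] cE.
    by rewrite -cE zc in nzu.
  by rewrite -cE zc in nzv.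
have [f fu' zf] := touch ub' vb' uv' zb zU.
have vu' : v' != u' by rewrite eq_sym.
have [|g gv' zg] := touch vb' ub' vu' zb; first by rewrite setUC.
rewrite setUC in zg; apply: proper_closed sP _ _ u'K _.
apply: conn_trans (conn_inc gv' v'U); apply: conn_trans (toU _ zg).
exact/connC/(conn_trans (toU _ zf) (conn_inc fu' u'U)).
Qed.

Lemma crossing_separated : ~~ conn [set u'; v'] (inl u) (inl v).
Proof.
have [_ _ [y1 [y2 [b1 b2 U1 U2 n12]]] _ _] := sQ; apply: contra n12 => cuv.
have tou (y : vert G) : y \in (cls b).1 -> y \notin [set u'; v'] -> conn [set u'; v'] (inl y)
  (inl u).
  move=> yb yU; case: (crossing_meets (z := inl y)); rewrite ?in_items // => yv.
  exact: conn_trans yv (connC cuv).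
exact: conn_trans (tou _ b1 U1) (connC (tou _ b2 U2)).
Qed.

(* If two darts of [u'] lie on the side of [u], then either [u] and [u'] span a
   dipole or they bound a proper part inside [K]. *)
Lemma crossing_side d1 d2 : d1 != d2 -> d1 \in (cls b).2 -> d2 \in (cls b).2 ->
  inc d1 = Some u' -> inc d2 = Some u' ->
  conn [set u'; v'] (inr d1) (inl u) -> conn [set u'; v'] (inr d2) (inl u) -> False.
Proof.
move=> d12 db1 db2 i1 i2 c1 c2; have nuv := crossing_separated.
have [uv [ub vb] _ [du dv] [_ [_ _ _ nc]]] := sP; have [uv' [ub' vb'] _ [du' dv'] _] := sQ.
have u'u : u' != u by apply: contraTneq u'K => ->.
have vu' : v != u' by apply: contraNneq vK => ->.
have vuU : v \notin [set u'; u] by rewrite !inE negb_or vu' eq_sym.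
have end_ d : inc d = Some u' -> conn [set u'; v'] (inr d) (inl u) ->
    exists2 y : vert G, inc (flip d) = Some y & y \notin [set u'; v'].
  move=> i c; have [y yU [h|h]] := conn_dart_vert c; last by exists y.
  by move: yU; rewrite i in h; case: h => <-; rewrite !inE eqxx.
(* If the other end [y] is not [u], its component in [G \ {u', u}] is a proper part inside [K] that
   misses [v]. *)
have far d (y : vert G) : d \in (cls b).2 -> inc d = Some u' -> conn [set u'; v'] (inr d) (inl
  u) ->
    inc (flip d) = Some y -> y \notin [set u'; v'] -> y = u.
  move=> db i c iy yU; apply/eqP; apply: contraT => yu.
  have yU2 : y \notin [set u'; u].
    by move: yU; rewrite !inE !negb_or yu => /andP[-> _].
  have dy : conn [set u'; u] (inr d) (inl y) by apply: conn_trans (conn_flip _ _) (conn_inc iy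
    _).
  have offU2 c0 : conn [set u'; u] (inr d) c0 -> off [set u'; u] c0.
    by move=> h; apply: conn_offr h _.
  have ndu : ~~ conn [set u'; v'] (inr d) (inl v).
    by apply: contra nuv => h; apply: conn_trans (connC c) h.
  have dK : inr d \in K by apply: proper_closed sP _ _ u'K (connC (conn_inc i u'U)).
  (* A walk up to its first visit to [v'] would avoid [u], and also [v], which is not on the side of
     [u]; it would thus put [v'] into [K]. *)
  have nv' : ~~ conn [set u'; u] (inr d) (inl v').
    apply: contra v'K => h; have [f fv' df] := first_hit h isT.
    apply: proper_closed sP _ _ dK _; apply: conn_trans (conn_inc fv' v'U).
    have ndv : ~~ conn (v' |: [set u'; u]) (inr d) (inl v).
      apply: contra ndu; apply: conn_sub; apply/subsetP=> a.
      by rewrite !inE => /orP[] ->; rewrite ?orbT.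
    apply: conn_switch df => -[a|//] da /=; apply/set2P=> -[] aE.
      by have := conn_offr da isT; rewrite aE /= !inE eqxx !orbT.
    by rewrite -aE da in ndv.
  have nv : ~~ conn [set u'; u] (inr d) (inl v).
    apply: contra ndu; apply: conn_switch => -[a|//] da /=; apply/set2P=> -[] aE.
      by have := offU2 _ da; rewrite aE /= !inE eqxx.
    by rewrite -aE da in nv'.
  have toU z : conn [set u'; u] (inr d) z -> conn [set u; v] (inr d) z.
    apply: conn_switch => -[a|//] da /=; apply/set2P=> -[] aE.
      by have := offU2 _ da; rewrite aE /= !inE eqxx orbT.
    by rewrite -aE da in nv.
  have yb : y \in (cls b).1.
    by apply/mem_cls1; exists (flip d) => //; rewrite mem_cls2 in db; apply: eqd_trans db
      (eqd_flip _).
  have sub : {subset component [set u'; u] (inl y) <= K}.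
    move=> z; rewrite inE => yz; apply: proper_closed sP _ _ dK (toU _ _).
    exact: conn_trans dy yz.
  have side : proper_side b u' u (component [set u'; u] (inl y)).
    split=> //.
      exists y, v; split=> //; apply: contra nv; exact: conn_trans.
    exists y; split=> //; apply: contra nc => /subsetP nc.
    by apply/subsetP=> a /nc; rewrite 1!inE => /sub aK; rewrite inE.
  exfalso; apply: (no_smaller_proper (a := v) aP side sub) => //.
  - by move=> a /set2P[] ->; [right | left; rewrite !inE eqxx].
  - by rewrite !inE eqxx orbT.
  - by rewrite inE; apply: contra nv; apply: conn_trans.
have [y1 h1 n1] := end_ _ i1 c1; have [y2 h2 n2] := end_ _ i2 c2.
have y1u := far _ _ db1 i1 c1 h1 n1; have y2u := far _ _ db2 i2 c2 h2 n2; subst y1 y2.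
(* Both darts run from [u'] to [u] and belong to different edges, so they span a dipole inside the
   atom, which misses [v]. *)
have [||| Q pQ EQ] := dipole_is_part u'u (d1 := d1) (d2 := d2).
- by rewrite inE i1 h1 !eqxx.
- by rewrite inE i2 h2 !eqxx.
- apply/negP=> /eqP/setP/(_ d1); rewrite !inE eqxx (negPf d12) /= => /esym/eqP d1E.
  by move: i1; rewrite d1E h2 => -[uE]; rewrite uE eqxx in u'u.
have inc : included Q.1 (sep_part [set u; v] K).1.
  rewrite EQ; apply/andP; split; apply/subsetP=> a; rewrite !inE.
    by case/orP=> /eqP ->; rewrite ?eqxx ?u'K ?orbT.
  move=> /orP[] /andP[/eqP ia /eqP ja].
    by apply: proper_closed sP _ _ u'K (connC (conn_inc ia u'U)).
  apply: proper_closed sP _ _ u'K (connC (conn_trans (conn_flip _ _) (conn_inc ja u'U))).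
have /(congr1 fst)/setP/(_ v) := atom_min aP pQ inc.
by rewrite EQ (negPf vuU) !inE eqxx orbT.
Qed.

End SameBlock.

(** The degree condition enters here: for crossing cuts each dart of [u'] in the block leads to [u]
    or to [v], and by [crossing_side] at most one leads to each. *)
Lemma proper_same_block b u v K u' v' K' :
  proper_side b u v K -> proper_side b u' v' K' ->
  is_atom (sep_part [set u; v] K) -> inl u' \notin K.
Proof.
move=> sP sQ aP; apply/negP=> u'K.
have [v'U | v'U] := boolP (v' \in [set u; v]).
  by apply: (nested_proper_cuts sP sQ aP u'K); left.
have [v'K | v'K] := boolP (inl v' \in K).
  by apply: (nested_proper_cuts sP sQ aP u'K); right.
have [_ _ _ [du' _] _] := sQ.
pose D c := [set d in (cls b).2 | (inc d == Some u') && conn [set u'; v'] (inr d) (inl c)].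
have memD c d : (d \in D c) =
    [&& d \in (cls b).2, inc d == Some u' & conn [set u'; v'] (inr d) (inl c)].
  by rewrite /D 1!in_set.
have no2 (D0 : {set dart G}) : (forall d1 d2, d1 \in D0 -> d2 \in D0 -> d1 != d2 -> False) ->
  #|D0| <= 1.
  by move=> h; rewrite leqNgt; apply/card_gt1P => -[d1 [d2 [h1 h2]]]; apply: h.
have Du : #|D u| <= 1.
  apply: no2 => d1 d2; rewrite !in_set => /and3P[b1 /eqP i1 c1] /and3P[b2 /eqP i2 c2] d12.
  by apply: (crossing_side sP sQ aP u'K v'U v'K d12 _ _ i1 i2 c1 c2); rewrite mem_cls2.
have sP' := proper_side_sym sP; have aP' := aP.
rewrite (setUC [set u]) in aP' v'U.
have Dv : #|D v| <= 1.
  apply: no2 => d1 d2; rewrite !in_set => /and3P[b1 /eqP i1 c1] /and3P[b2 /eqP i2 c2] d12.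
  by apply: (crossing_side sP' sQ aP' u'K v'U v'K d12 _ _ i1 i2 c1 c2); rewrite mem_cls2.
have : #|D u :|: D v| <= 2 by apply: leq_trans (leq_card_setU _ _) (leq_add Du Dv).
suff -> : D u :|: D v = [set d in (cls b).2 | inc d == Some u'] by rewrite leqNgt du'.
apply/setP=> d; rewrite in_setU !memD -!andb_orr 1![RHS]in_set.
have [db | ] //= := boolP (d \in (cls b).2); case: eqP => //= i.
rewrite (setUC [set v]) in v'U.
by case: (crossing_meets sP sQ u'K v'U v'K (z := inr d)) => [||->|->]; rewrite ?in_items ?orbT.
Qed.

Lemma proper_vertex b u v K b' u' v' K' :
  proper_side b u v K -> proper_side b' u' v' K' ->
  is_atom (sep_part [set u; v] K) -> is_part (sep_part [set u'; v'] K') ->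
  inl u' \notin K.
Proof.
move=> sP sQ aP pQ; have [bb' | /eqP bb'] := eqVneq (cls b) (cls b').
  by apply: proper_same_block sP _ aP; rewrite /proper_side /separates bb'; exact: sQ.
exact: proper_block_sep sP sQ bb' aP pQ.
Qed.

Lemma proper_touch b u v K z : proper_side b u v K -> z \in K ->
  exists2 f, inc f = Some u & inr f \in K.
Proof.
move=> sP zK; have [uv [ub vb] _ _ [y [yb yU EK _]]] := sP.
have [||f fu yf] := touch ub vb uv (y := inl y); rewrite ?in_items //.
by exists f => //; rewrite EK inE.
Qed.

(** No cut vertex of one part lies in the other, so each of [K] and [K'] stays connected off the
    other cut, and a common item makes them equal. Each cut vertex then has a dart in the common
    component and, not being in it, belongs to both cuts. *)
Lemma proper_proper b u v K b' u' v' K' :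
  proper_side b u v K -> proper_side b' u' v' K' ->
  is_atom (sep_part [set u; v] K) -> is_atom (sep_part [set u'; v'] K') ->
  sep_part [set u; v] K <> sep_part [set u'; v'] K' ->
  [/\ inl u' \notin K, inl v' \notin K & forall z, z \in K -> z \notin K'].
Proof.
move=> sP sQ aP aQ PQ; have [pP _] := andP aP; have [pQ _] := andP aQ.
have sP' := proper_side_sym sP; have sQ' := proper_side_sym sQ.
have u'K := proper_vertex sP sQ aP pQ; have uK' := proper_vertex sQ sP aQ pP.
have v'K : inl v' \notin K by apply: (proper_vertex sP sQ' aP); rewrite setUC.
have vK' : inl v \notin K' by apply: (proper_vertex sQ sP' aQ); rewrite setUC.
split=> // z zK; apply/negP=> zK'; apply: PQ.
have sub p q p' q' (L L' : {set vert G + dart G}) :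
    (forall x y, x \in L' -> conn [set p'; q'] x y -> y \in L') ->
    (forall x y, x \in L -> y \in L -> conn [set p; q] x y) -> z \in L -> z \in L' ->
    (forall x y, x \in L -> conn [set p; q] x y -> y \in L) ->
    inl p' \notin L -> inl q' \notin L -> forall x, x \in L -> x \in L'.
  move=> cl' cn zL zL' cl pL qL x xL; apply: (cl' _ _ zL'); apply: conn_switch (cn _ _ zL xL).
  move=> -[c|//] zc /=; apply/set2P=> -[] cE.
    by case/negP: pL; rewrite -cE; apply: cl zL zc.
  by case/negP: qL; rewrite -cE; apply: cl zL zc.
have KK' : K = K'.
  apply/setP=> x; apply/idP/idP.
    apply: (sub u v u' v') => //.
    - exact: (proper_closed sQ).
    - exact: (proper_conn sP).
    - exact: (proper_closed sP).
  apply: (sub u' v' u v) => //.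
  - exact: (proper_closed sP).
  - exact: (proper_conn sQ).
  - exact: (proper_closed sQ).
have inU p q p' q' bb bb' : proper_side bb p q K -> proper_side bb' p' q' K -> p \in [set p';
  q'].
  move=> s1 s2; apply: contraT => pU; have [f fp fK] := proper_touch s1 zK.
  have := proper_closed s2 fK (conn_inc fp pU).
  by move/(proper_off s1); rewrite /= !inE eqxx.
rewrite -KK' in sQ sQ' *; have UU : [set u; v] = [set u'; v'].
  apply/setP=> a; apply/set2P/set2P.
    by case=> ->; apply/set2P; [apply: inU sP sQ | apply: inU sP' sQ].
  by case=> ->; apply/set2P; [apply: inU sQ sP | apply: inU sQ' sP].
by rewrite UU.
Qed.

(** One end of the dipole in [K] would draw in all joining darts, and the dipole would lie in the
    atom. A joining dart in [K] has an end off [U], which is reduced to the former case. *)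
Lemma dipole_sep U K u v (P : part G) :
  P = (([set u; v], joining u v), [set u; v]) -> dipole_part P -> u != v ->
  is_atom (sep_part U K) ->
  (forall x y, x \in K -> conn U x y -> y \in K) ->
  (forall z, z \in K -> off U z) ->
  (block_part (sep_part U K) /\ (exists w, U = [set w])) \/ #|U| = 2 ->
  (forall d, d \in joining u v -> inr d \in K ->
     exists2 y, y \notin U & inc d = Some y \/ inc (flip d) = Some y) ->
  [/\ inl u \notin K, inl v \notin K & forall d, d \in joining u v -> inr d \notin K].
Proof.
move=> EP dP uv aS clK oK alt endK.
have pP : is_part P by apply/or3P; apply: Or33.
have [p [q [/eqP EPpq jpq nb]]] : exists p q, [/\ P == (([set p; q], joining p q), [set p; q]),
    1 < #|[set [set d; flip d] | d in joining p q]| & ~~ [exists w, block_part (P.1, [set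
      w])]].
  by case/existsP: dP => p /existsP[q /and4P[_ ? ? ?]]; exists p, q.
have j_ends a d : a \in [set u; v] -> d \in joining u v -> inc d = Some a \/ inc (flip d) =
  Some a.
  by move=> /set2P[] ->; rewrite inE => /orP[] /andP[/eqP h1 /eqP h2]; by [left | right].
have joinE : joining p q = joining u v by move: EPpq; rewrite EP => -[_ ->].
have joinK a : a \in [set u; v] -> inl a \in K -> forall d, d \in joining u v -> inr d \in K.
  move=> aU aK d /(j_ends _ _ aU)[] h.
    exact: clK aK (connC (conn_inc h (oK _ aK))).
  exact: clK aK (connC (conn_trans (conn_flip _ _) (conn_inc h (oK _ aK)))).
have nV a : a \in [set u; v] -> inl a \notin K.
  move=> aU; apply/negP=> aK.
  have [d0 d0j] : exists d, d \in joining u v.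
    apply/set0Pn; apply: contraTneq jpq => j0; rewrite joinE j0.
    by rewrite (_ : _ @: _ = set0) ?cards0 //; apply/setP=> x; rewrite inE; apply/imsetP=>
      -[d]; rewrite inE.
  have inA c : c \in [set u; v] -> c \in U :|: (component_piece K).1.
    move=> cU; rewrite in_setU; have [//|ncU] := boolP (c \in U); rewrite inE /=.
    have dK := joinK _ aU aK _ d0j; case: (j_ends _ _ cU d0j) => h.
      exact: clK dK (conn_inc h ncU).
    exact: clK dK (conn_trans (conn_flip _ _) (conn_inc h ncU)).
  have incl : included P.1 (sep_part U K).1.
    rewrite EP; apply/andP; split; apply/subsetP=> c /=; first exact: inA.
    by move=> cj; rewrite inE; apply: joinK aU aK c cj.
  have E := atom_min aS pP incl.
  (* The pieces are equal by minimality. For a block atom the dipole would be a block part as well,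
     which [dipole_part] excludes. A cut of size two would have to fit into the single vertex other
     than [a]. *)
  case: alt => [[bP [w EU]] | U2].
    case/negP: nb; apply/existsP; exists w; rewrite E.
    by move: bP; rewrite /sep_part EU.
  have /(congr1 (fun X => fst X)) /= E1 := E; rewrite EP /= in E1.
  have sub : U \subset [set u; v] :\ a.
    apply/subsetP=> c cU; rewrite in_setD1; apply/andP; split.
      by apply: contraTneq cU => ->; apply: (oK _ aK).
    by rewrite E1 in_setU cU.
  have := subset_leq_card sub; rewrite U2.
  by have := cardsD1 a [set u; v]; rewrite aU cards2 uv add1n => -[<-].
split; [by apply: nV; rewrite !inE eqxx | by apply: nV; rewrite !inE eqxx orbT | ].
move=> d dj; apply/negP=> dK; have [y yU h] := endK _ dj dK.
have yK : inl y \in K.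
  by case: h => h; apply: clK dK _; [apply: conn_inc | apply: conn_trans (conn_flip _ _)
    (conn_inc h yU)].
suff yUV : y \in [set u; v] by rewrite (negPf (nV y yUV)) in yK.
move: dj; rewrite [_ \in joining _ _]inE.
by case/orP=> /andP[/eqP h1 /eqP h2]; case: h; rewrite ?h1 ?h2 => -[<-]; rewrite !inE eqxx
  ?orbT.
Qed.

Definition block_shape P := exists w K,
  [/\ block_side rho w K, [exists d, inr d \in K], block_part P & P = sep_part [set w] K].
Definition proper_shape P := exists b u v K,
  proper_side b u v K /\ P = sep_part [set u; v] K.
Definition dipole_shape P := exists u v,
  [/\ u != v, dipole_part P & P = (([set u; v], joining u v), [set u; v])].

Lemma part_shape P : is_part P -> [\/ block_shape P, proper_shape P | dipole_shape P].
Proof.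
case/or3P=> [bP | /(proper_partP G_conn) h | dP]; first 1 last.
- exact: Or32.
- apply: Or33; case/existsP: (dP) => u /existsP[v /and4P[uv /eqP E _ _]].
  by exists u, v.
- by have [w [K [h1 h2 h3]]] := block_part_side G_conn rho_center bP; apply: Or31; exists w, K.
Qed.

Definition part_disjoint P Q : Prop :=
  [/\ forall v, v \in P.1.1 -> v \notin P.2 -> v \notin Q.1.1,
      forall v, v \in Q.1.1 -> v \notin Q.2 -> v \notin P.1.1
    & forall d, d \in P.1.2 -> d \notin Q.1.2].

Lemma part_disjoint_sym P Q : part_disjoint P Q -> part_disjoint Q P.
Proof. by case=> h1 h2 h3; split=> // d dQ; apply: contraL dQ; apply: h3. Qed.

Lemma sep_disjoint U K U' K' :
  (forall v, v \in U -> inl v \notin K') -> (forall v, v \in U' -> inl v \notin K) ->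
  (forall z, z \in K -> z \notin K') -> part_disjoint (sep_part U K) (sep_part U' K').
Proof.
move=> UK' U'K KK'; split=> [v|v|d]; rewrite !inE; last exact: KK'.
  by case/orP=> [-> // | vK] _; rewrite (negPf (KK' _ vK)) orbF; apply: contraL vK; apply: U'K.
case/orP=> [-> // | vK'] _; apply/norP; split; first by apply: contraL vK'; apply: UK'.
by apply: contraL vK'; apply: KK'.
Qed.

Lemma block_side_closed w K : block_side rho w K ->
  forall x y, x \in K -> conn [set w] x y -> y \in K.
Proof. by case=> -[]. Qed.

Lemma block_side_off w K : block_side rho w K -> forall z, z \in K -> off [set w] z.
Proof.
by case=> -[wK _ _] _ [v|//] vK; rewrite /= inE; apply: contraNneq wK => <-.
Qed.

Lemma dipole_disjoint U K u v (Q : part G) :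
  Q = (([set u; v], joining u v), [set u; v]) ->
  [/\ inl u \notin K, inl v \notin K & forall d, d \in joining u v -> inr d \notin K] ->
  part_disjoint (sep_part U K) Q.
Proof.
move=> -> [uK vK jK]; split=> /= [a|a -> //|d].
  rewrite in_setU => /orP[-> // | aK] _; rewrite inE in aK.
  by apply: contraL aK => /set2P[] ->.
by rewrite inE => dK; apply: contraL dK; apply: jK.
Qed.

Lemma block_dipole P Q : is_atom P -> block_shape P -> dipole_shape Q -> part_disjoint P Q.
Proof.
move=> aP [w [K [sP _ bP EP]]] [u [v [uv dQ EQ]]]; subst P.
apply: (dipole_disjoint _ EQ); apply: (dipole_sep EQ dQ uv aP (block_side_closed sP)).
- exact: block_side_off sP.
- by left; split=> //; exists w.
move=> d; rewrite inE => dj _; have [uw | uw] := eqVneq u w.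
  exists v; first by rewrite inE -uw eq_sym.
  by case/orP: dj => /andP[/eqP h1 /eqP h2]; [right | left].
exists u; first by rewrite inE.
by case/orP: dj => /andP[/eqP h1 /eqP h2]; [left | right].
Qed.

Lemma proper_dipole P Q : is_atom P -> proper_shape P -> dipole_shape Q -> part_disjoint P Q.
Proof.
move=> aP [b [p [q [K [sP EP]]]]] [u [v [uv dQ EQ]]]; subst P.
have [pq _ _ _ [y [yb yU EK _]]] := sP.
apply: (dipole_disjoint _ EQ); apply: (dipole_sep EQ dQ uv aP (proper_closed sP)).
- exact: proper_off sP.
- by right; rewrite cards2 pq.
move=> d _ dK; apply: (@conn_dart_vert _ _ _ y); apply: proper_conn sP _ _ dK _.
by rewrite EK inE conn_refl.
Qed.

Lemma dipole_dipole P Q : dipole_shape P -> dipole_shape Q -> P <> Q -> part_disjoint P Q.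
Proof.
move=> [u [v [uv _ ->]]] [u' [v' [uv' _ ->]]] PQ; split=> /= [a -> //|a -> //|d].
rewrite !inE => h; apply/negP=> h'; apply: PQ.
suff [[-> ->] // | [-> ->]] : (u = u' /\ v = v') \/ (u = v' /\ v = u').
  rewrite [[set v'; u']]setUC; congr (_, _, _); apply/setP=> e; rewrite !inE; exact: orbC.
case/orP: h => /andP[/eqP h1 /eqP h2]; case/orP: h' => /andP[/eqP h3 /eqP h4];
  move: h1 h2; rewrite h3 h4 => -[<-] -[<-]; by [left | right].
Qed.

Lemma block_block_disjoint P Q : is_atom P -> is_atom Q -> block_shape P -> block_shape Q ->
  P <> Q -> part_disjoint P Q.
Proof.
move=> aP aQ [w [K [sP _ _ EP]]] [w' [K' [sQ _ _ EQ]]] PQ; subst P Q.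
have [w'K KK'] := block_block sP sQ aP aQ PQ.
have [wK' _] := block_block sQ sP aQ aP (not_eq_sym PQ).
by apply: sep_disjoint => // v /set1P ->.
Qed.

Lemma block_proper_disjoint P Q : is_atom P -> is_atom Q -> block_shape P -> proper_shape Q ->
  part_disjoint P Q.
Proof.
move=> aP aQ [w [K [sP _ _ EP]]] [b [u [v [K' [sQ EQ]]]]]; subst P Q.
have [uK vK wK' KK'] := block_proper sP sQ aP aQ.
by apply: sep_disjoint => // a; [move/set1P=> -> | case/set2P=> ->].
Qed.

Lemma proper_proper_disjoint P Q : is_atom P -> is_atom Q -> proper_shape P -> proper_shape Q
  ->
  P <> Q -> part_disjoint P Q.
Proof.
move=> aP aQ [b [u [v [K [sP EP]]]]] [b' [u' [v' [K' [sQ EQ]]]]] PQ; subst P Q.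
have [u'K v'K KK'] := proper_proper sP sQ aP aQ PQ.
have [uK' vK' _] := proper_proper sQ sP aQ aP (not_eq_sym PQ).
by apply: sep_disjoint => // a /set2P[] ->.
Qed.

Lemma atoms_disjoint P Q : is_atom P -> is_atom Q -> P <> Q -> part_disjoint P Q.
Proof.
move=> aP aQ PQ; have QP := not_eq_sym PQ.
have [pP _] := andP aP; have [pQ _] := andP aQ.
case: (part_shape pP) => hP; case: (part_shape pQ) => hQ.
- exact: block_block_disjoint.
- exact: block_proper_disjoint.
- exact: block_dipole.
- exact/part_disjoint_sym/block_proper_disjoint.
- exact: proper_proper_disjoint.
- exact: proper_dipole.
- exact/part_disjoint_sym/block_dipole.
- exact/part_disjoint_sym/proper_dipole.
- exact: dipole_dipole.
Qed.

Lemma sep_boundary U K : (forall z, z \in K -> off U z) ->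
  (forall x y, x \in K -> conn U x y -> y \in K) ->
  forall d v, inc d = Some v -> v \in (sep_part U K).1.1 -> v \notin U -> d \in (sep_part U
    K).1.2.
Proof.
move=> oK clK d v dv; rewrite in_setU => /orP[-> // | ]; rewrite !inE => vK vU.
exact: clK vK (connC (conn_inc dv vU)).
Qed.

Lemma sep_incident U K : (forall x y, x \in K -> conn U x y -> y \in K) ->
  forall d v, inc d = Some v -> d \in (sep_part U K).1.2 -> v \in (sep_part U K).1.1.
Proof.
move=> clK d v dv; rewrite inE in_setU => dK; have [//|vU] := boolP (v \in U).
by rewrite inE /=; apply: clK dK (conn_inc dv vU).
Qed.

Lemma part_interior P d v : is_part P -> inc d = Some v -> v \in P.1.1 -> v \notin P.2 ->
  d \in P.1.2.
Proof.
move=> pP dv; case: (part_shape pP).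
- case=> w [K [sP _ _ ->]].
  exact: (sep_boundary (block_side_off sP) (block_side_closed sP) dv).
- case=> b [u [v' [K [sP ->]]]].
  exact: (sep_boundary (proper_off sP) (proper_closed sP) dv).
- by case=> a [c [_ _ ->]] /= ->.
Qed.

Lemma part_incident P d v : is_part P -> inc d = Some v -> d \in P.1.2 -> v \in P.1.1.
Proof.
move=> pP dv; case: (part_shape pP).
- by case=> w [K [sP _ _ ->]]; apply: (sep_incident (block_side_closed sP) dv).
- by case=> b [u [v' [K [sP ->]]]]; apply: (sep_incident (proper_closed sP) dv).
- case=> a [c [_ _ ->]] /=; rewrite inE dv => /orP[] /andP[/eqP[->] _]; by rewrite !inE eqxx
  ?orbT.
Qed.

Lemma part_boundary_sub P : is_part P -> P.2 \subset P.1.1.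
Proof.
move=> pP; case: (part_shape pP).
- by case=> w [K [sP _ _ ->]]; apply: subsetUl.
- by case=> b [u [v' [K [sP ->]]]]; apply: subsetUl.
- by case=> a [c [_ _ ->]].
Qed.

End Disjointness.

(** * Action of automorphisms on parts *)

Lemma connect_inj (T : finType) (f : T -> T) (e e' : rel T) a b : injective f ->
  (forall a b, e' (f a) (f b) = e a b) -> connect e' (f a) (f b) = connect e a b.
Proof.
move=> f_inj ee'; apply/idP/idP => c.
  have [g fK gK] := injF_bij f_inj.
  rewrite -[b]fK; apply: (connect_ind (P := fun z => connect e a (g z))) c.
    by rewrite fK connect0.
  move=> x y _ xy ax; apply: connect_trans ax (connect1 _).
  by rewrite -ee' !gK.
apply: (connect_ind (P := fun z => connect e' (f a) (f z))) c; first exact: connect0.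
by move=> x y _ xy ax; apply: connect_trans ax (connect1 _); rewrite ee'.
Qed.

(** A quantified formula is invariant under a bijection of the finite type as soon as its body is.
    Most of the invariance lemmas for automorphisms proceed in this way. *)
Lemma exists_inj (T : finType) (f : T -> T) (P Q : pred T) : injective f ->
  (forall x, P (f x) = Q x) -> [exists x, P x] = [exists x, Q x].
Proof.
move=> f_inj PQ; have [g fK gK] := injF_bij f_inj.
apply/existsP/existsP => [[x Px] | [x Qx]]; [exists (g x) | exists (f x)].
  by rewrite -PQ gK.
by rewrite PQ.
Qed.

Lemma forall_inj (T : finType) (f : T -> T) (P Q : pred T) : injective f ->
  (forall x, P (f x) = Q x) -> [forall x, P x] = [forall x, Q x].
Proof.
move=> f_inj PQ; apply: negb_inj; rewrite !negb_forall.
by apply: exists_inj f_inj _ => x; rewrite PQ.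
Qed.

Lemma imset_subset (T T' : finType) (f : T -> T') (A B : {set T}) : injective f ->
  (f @: A \subset f @: B) = (A \subset B).
Proof.
move=> f_inj; apply/subsetP/subsetP => [sAB x xA | sAB _ /imsetP[x xA ->]].
  by rewrite -(mem_imset _ _ f_inj) sAB ?imset_f.
exact/imset_f/sAB.
Qed.

Section Automorphism.
Variables (G : graph) (p : autT G).
Implicit Types (U : {set vert G}) (x y z : vert G + dart G) (S T B : piece G)
  (d e f : dart G) (u v w : vert G) (K : {set vert G + dart G}).
Hypothesis p_aut : p \in AutG G.

Let p1_inj : injective p.1 := @perm_inj _ p.1.
Let p2_inj : injective p.2 := @perm_inj _ p.2.

Lemma autP d : [/\ inc (p.2 d) = omap p.1 (inc d), p.2 (flip d) = flip (p.2 d),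
  color (p.2 d) = color d, etype (p.2 d) = etype d
  & etype d = Directed -> tail (p.2 d) = tail d].
Proof.
move: p_aut; rewrite inE => /forallP/(_ d)/and5P[/eqP h1 /eqP h2 /eqP h3 /eqP h4 /implyP h5].
by split=> // hd; apply/eqP/h5/eqP.
Qed.

Lemma aut_inc d : inc (p.2 d) = omap p.1 (inc d).
Proof. by case: (autP d). Qed.

Lemma aut_flip d : flip (p.2 d) = p.2 (flip d).
Proof. by case: (autP d). Qed.

Lemma aut_inc_eq d v : (inc (p.2 d) == Some (p.1 v)) = (inc d == Some v).
Proof. by rewrite aut_inc; case: (inc d) => //= a; rewrite !(inj_eq (@Some_inj _)) (inj_eq
  p1_inj). Qed.

Definition aut_item x : vert G + dart G :=
  match x with inl v => inl (p.1 v) | inr d => inr (p.2 d) end.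
Definition aut_piece S : piece G := (p.1 @: S.1, p.2 @: S.2).

Lemma aut_item_inj : injective aut_item.
Proof. by case=> [v|d] [w|e] //= [] => [/p1_inj | /p2_inj] ->. Qed.

Lemma aut_piece_inj : injective aut_piece.
Proof.
by move=> [A C] [A' C'] [/(imset_inj p1_inj) -> /(imset_inj p2_inj) ->].
Qed.

Lemma aut_adjacent S x y :
  adjacent (aut_piece S) (aut_item x) (aut_item y) = adjacent S x y.
Proof.
case: x y => [v|d] [w|e] //=;
  by rewrite ?(mem_imset _ _ p1_inj) ?(mem_imset _ _ p2_inj) ?aut_inc_eq ?aut_flip ?(inj_eq
    p2_inj).
Qed.

Lemma aut_whole_remove U : aut_piece (remove whole U) = remove whole (p.1 @: U).
Proof.
congr (_, _); apply/setP=> x; rewrite !inE.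
  by rewrite -[x](permKV p.1) (mem_imset _ _ p1_inj) (mem_imset _ _ p1_inj) !inE.
by rewrite -[x](permKV p.2) (mem_imset _ _ p2_inj) inE.
Qed.

Lemma aut_conn U x y : conn (p.1 @: U) (aut_item x) (aut_item y) = conn U x y.
Proof.
rewrite -!connE -aut_whole_remove.
by apply: connect_inj; [apply: aut_item_inj | apply: aut_adjacent].
Qed.

Lemma aut_conn1 w x y : conn [set p.1 w] (aut_item x) (aut_item y) = conn [set w] x y.
Proof. by rewrite -imset_set1 aut_conn. Qed.

Lemma aut_eqd d e : eqd (p.2 d) (p.2 e) = eqd d e.
Proof. by apply: forall_inj p1_inj _ => w; apply: (aut_conn1 w (inr d) (inr e)). Qed.

Lemma aut_cls1 d v : (p.1 v \in (cls (p.2 d)).1) = (v \in (cls d).1).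
Proof.
rewrite !inE; apply: exists_inj p2_inj _ => e.
by rewrite aut_eqd aut_inc_eq.
Qed.

Lemma aut_cls d : cls (p.2 d) = aut_piece (cls d).
Proof.
congr (_, _); apply/setP=> x.
  by rewrite -[x](permKV p.1) (mem_imset _ _ p1_inj) -aut_cls1 !inE.
by rewrite -[x](permKV p.2) (mem_imset _ _ p2_inj) !inE aut_eqd.
Qed.

Lemma aut_vertex_node v : vertex_node (p.1 v) = aut_piece (vertex_node v).
Proof. by rewrite /vertex_node /aut_piece /= imset_set1 imset0. Qed.

Lemma aut_items S x : (aut_item x \in items (aut_piece S)) = (x \in items S).
Proof.
by case: x => [v|d]; rewrite !in_items /= ?(mem_imset _ _ p1_inj) ?(mem_imset _ _ p2_inj).
Qed.

Lemma aut_connected S : connected (aut_piece S) = connected S.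
Proof.
apply: forall_inj aut_item_inj _ => x; rewrite aut_items; congr (_ ==> _).
apply: forall_inj aut_item_inj _ => y; rewrite aut_items; congr (_ ==> _).
by apply: connect_inj; [apply: aut_item_inj | apply: aut_adjacent].
Qed.

Lemma aut_articulation v : articulation (p.1 v) = articulation v.
Proof. by rewrite /articulation -imset_set1 -aut_whole_remove aut_connected. Qed.

Lemma aut_degree d v : degree_in (cls (p.2 d)) (p.1 v) = degree_in (cls d) v.
Proof.
rewrite /degree_in -[RHS](card_imset _ p2_inj); congr #|pred_of_set _|; apply/setP=> e.
by rewrite -[e](permKV p.2) (mem_imset _ _ p2_inj) !inE aut_eqd aut_inc_eq.
Qed.

Hypothesis G_conn : forall x y, conn (G := G) set0 x y.

Lemma aut_block S : block (aut_piece S) = block S.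
Proof.
apply/(blockP G_conn)/(blockP G_conn) => -[d E].
  exists ((p.2)^-1%g d); apply: aut_piece_inj.
  by rewrite E -aut_cls permKV.
by exists (p.2 d); rewrite E aut_cls.
Qed.

Lemma aut_block_tree_nodes S : (aut_piece S \in block_tree_nodes G) = (S \in block_tree_nodes
  G).
Proof.
rewrite !inE aut_block; congr orb; apply/imsetP/imsetP => -[u]; rewrite inE => au E.
  exists ((p.1)^-1%g u); first by rewrite inE -aut_articulation permKV.
  by apply: aut_piece_inj; rewrite E -aut_vertex_node permKV.
by exists (p.1 u); rewrite ?inE ?aut_articulation // E aut_vertex_node.
Qed.

Lemma aut_incident_nodes S T :
  incident_nodes (aut_piece S) (aut_piece T) = incident_nodes S T.
Proof. by rewrite /incident_nodes /= !imset_eq0 imset_subset. Qed.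

Lemma aut_tree_edge (N : {set piece G}) S T :
  (forall T, (aut_piece T \in N) = (T \in N)) ->
  tree_edge N (aut_piece S) (aut_piece T) = tree_edge N S T.
Proof. by move=> NE; rewrite /tree_edge !NE !aut_incident_nodes. Qed.

End Automorphism.

Section CenteredAutomorphism.
Variables (G : centered_graph) (p : autT G).
Implicit Types (U : {set vert G}) (x y z : vert G + dart G) (S T B : piece G)
  (d e f : dart G) (u v w : vert G) (K : {set vert G + dart G}) (P Q : part G).
Hypothesis p_aut : p \in AutG G.
Hypothesis G_conn : forall x y, conn (G := G) set0 x y.
Hypothesis p_center : aut_piece p (center G) = center G.

Let p1_inj : injective p.1 := @perm_inj _ p.1.
Let p2_inj : injective p.2 := @perm_inj _ p.2.

Lemma aut_rooted S : (aut_piece p S \in rooted_nodes G) = (S \in rooted_nodes G).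
Proof.
rewrite /rooted_nodes in_setU [RHS]in_setU aut_block_tree_nodes // !in_set1.
by rewrite -{1}p_center (inj_eq (@aut_piece_inj _ _)).
Qed.

Lemma aut_below S T : below (aut_piece p S) (aut_piece p T) = below S T.
Proof.
rewrite /below (inj_eq (@aut_piece_inj _ _)) -{1}p_center; congr (_ || ~~ _).
apply: connect_inj; first exact: aut_piece_inj.
by move=> A B /=; rewrite !(inj_eq (@aut_piece_inj _ _)) aut_tree_edge //; apply: aut_rooted.
Qed.

Lemma aut_below_darts S : below_darts (aut_piece p S) = p.2 @: below_darts S.
Proof.
apply/setP=> e; rewrite -[e](permKV p.2) (mem_imset _ _ p2_inj) !in_set.
by rewrite aut_cls // aut_below.
Qed.

Lemma aut_subtree_piece S : subtree_piece (aut_piece p S) = aut_piece p (subtree_piece S).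
Proof.
rewrite (subtree_piece_cls G_conn (aut_piece p S)) (subtree_piece_cls G_conn S).
rewrite aut_below_darts; congr pair; apply/setP=> x.
rewrite -[x](permKV p.1) (mem_imset _ _ p1_inj) !in_set.
by apply: exists_inj p2_inj _ => e; rewrite (mem_imset _ _ p2_inj) aut_inc_eq.
Qed.

Lemma aut_attached_at S v : attached_at (aut_piece p S) (p.1 v) = attached_at S v.
Proof.
rewrite /attached_at imset_eq0 aut_vertex_node (inj_eq (@aut_piece_inj _ _)).
by rewrite aut_tree_edge ?aut_below //; apply: aut_rooted.
Qed.

Lemma aut_single_pendant_edge S :
  single_pendant_edge (aut_piece p S) = single_pendant_edge S.
Proof.
apply: exists_inj p2_inj _ => d.
have -> : [set p.2 d; flip (p.2 d)] = p.2 @: [set d; flip d].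
  by rewrite imsetU !imset_set1 aut_flip.
rewrite (inj_eq (imset_inj p2_inj)) aut_flip // !aut_inc //.
by case: (inc d); case: (inc (flip d)).
Qed.

Lemma part_imageE P : part_image p P = (aut_piece p P.1, p.1 @: P.2).
Proof. by []. Qed.

Lemma part_image_inj : injective (part_image p).
Proof.
by move=> [S U] [S' U'] [] /(imset_inj p1_inj) h1 /(imset_inj p2_inj) h2 /(imset_inj p1_inj)
  ->;
   case: S S' h1 h2 => [A C] [A' C'] /= -> ->.
Qed.

Lemma part_image_eq P S U :
  (part_image p P == (aut_piece p S, p.1 @: U)) = (P == (S, U)).
Proof. by rewrite -[RHS](inj_eq part_image_inj). Qed.

Lemma aut_block_part P : block_part (part_image p P) = block_part P.
Proof.
rewrite /block_part; apply: exists_inj (@aut_piece_inj _ p) _ => S.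
rewrite aut_rooted; congr andb; apply: exists_inj p1_inj _ => u.
rewrite aut_attached_at -{1}p_center (inj_eq (@aut_piece_inj _ _)) !imset_eq0.
by rewrite aut_subtree_piece -imset_set1 part_image_eq aut_single_pendant_edge.
Qed.

Lemma aut_joining u v : joining (p.1 u) (p.1 v) = p.2 @: joining u v.
Proof.
apply/setP=> e; rewrite -[e](permKV p.2) (mem_imset _ _ p2_inj) !in_set.
by rewrite !aut_flip // !aut_inc_eq.
Qed.

Lemma aut_dipole_part P : dipole_part (part_image p P) = dipole_part P.
Proof.
apply: exists_inj p1_inj _ => u; apply: exists_inj p1_inj _ => v.
rewrite (inj_eq p1_inj); congr [&& _, _, _ & ~~ _].
- rewrite -[RHS](inj_eq part_image_inj); congr (_ == _).
  by rewrite part_imageE /aut_piece /= aut_joining imsetU !imset_set1.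
- rewrite -[in RHS](card_imset _ (imset_inj p2_inj)); congr (_ < #|pred_of_set _|).
  rewrite aut_joining -!imset_comp; apply: eq_imset => d /=.
  by rewrite imsetU !imset_set1 aut_flip.
- apply: exists_inj p1_inj _ => w; rewrite -[RHS]aut_block_part !part_imageE /=.
  by rewrite imset_set1.
Qed.

Lemma aut_component U x : component (p.1 @: U) (aut_item p x) = aut_item p @: component U x.
Proof.
have [g gK Kg] := injF_bij (@aut_item_inj _ p).
apply/setP=> z; rewrite -[z]Kg (mem_imset _ _ (@aut_item_inj _ p)) !in_set.
exact: aut_conn.
Qed.

Lemma aut_component_piece K : component_piece (aut_item p @: K) = aut_piece p (component_piece
  K).
Proof.
congr (_, _); apply/setP=> x.
  rewrite -[x](permKV p.1) (mem_imset _ _ p1_inj) !in_set.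
  exact: (mem_imset _ (inl _) (@aut_item_inj _ p)).
rewrite -[x](permKV p.2) (mem_imset _ _ p2_inj) !in_set.
exact: (mem_imset _ (inr _) (@aut_item_inj _ p)).
Qed.

Lemma aut_proper_part P : proper_part P -> proper_part (part_image p P).
Proof.
move/(proper_partP G_conn)=> [b [u [v [K [[uv [ub vb] [y1 [y2 [b1 b2 U1 U2 n12]]] [du dv]
  [y [yb yU EK nc]]] ->]]]]].
have imU : [set p.1 u; p.1 v] = p.1 @: [set u; v] by rewrite imsetU !imset_set1.
apply/(proper_partP G_conn).
exists (p.2 b), (p.1 u), (p.1 v), (aut_item p @: K); rewrite /proper_side imU; split.
  split; rewrite ?(inj_eq p1_inj) ?aut_cls1 ?aut_degree //.
    exists (p.1 y1), (p.1 y2); rewrite !aut_cls1 // !(mem_imset _ _ p1_inj); split=> //.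
    by rewrite -(aut_conn p_aut) in n12.
  exists (p.1 y); rewrite aut_cls1 // (mem_imset _ _ p1_inj); split=> //.
    by rewrite EK -aut_component.
  by rewrite -p_center aut_component_piece /= imset_subset.
rewrite part_imageE /sep_part aut_component_piece /aut_piece /=.
by rewrite imsetU.
Qed.

Lemma aut_is_part P : is_part P -> is_part (part_image p P).
Proof.
rewrite /is_part aut_block_part aut_dipole_part.
by case/or3P=> [-> // | /aut_proper_part -> | ->]; rewrite !orbT.
Qed.

Lemma aut_included S T : included (aut_piece p S) (aut_piece p T) = included S T.
Proof. by rewrite /included /= !imset_subset. Qed.

End CenteredAutomorphism.

Lemma aut_pieceK (G : graph) (p : autT G) : cancel (aut_piece p) (aut_piece p^-1%g).
Proof.
move=> [A C]; rewrite /aut_piece /= -!imset_comp.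
by rewrite !(eq_imset (g := id)) ?imset_id // => x /=; rewrite permK.
Qed.

(** A part inside the image is pulled back by the inverse automorphism, which also fixes the center,
    so one implication for parts suffices. *)
Lemma aut_is_atom (G : centered_graph) (p : autT G) (P : part G) :
  (forall x y, conn (G := G) set0 x y) ->
  aut_piece p (center G) = center G -> p \in AutG G ->
  is_atom P -> is_atom (part_image p P).
Proof.
move=> G_conn pc pA aP; have [pP _] := andP aP.
rewrite /is_atom (aut_is_part pA G_conn pc pP) /=.
apply/forallP=> Q; apply/implyP=> /andP[pQ iQ].
have pc' : aut_piece p^-1%g (center G) = center G by rewrite -{1}pc aut_pieceK.
have pA' : p^-1%g \in AutG G by rewrite groupV.
have pK : aut_piece p (aut_piece p^-1%g Q.1) = Q.1 by rewrite -{1}[p]invgK aut_pieceK.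
have := atom_min aP (aut_is_part pA' G_conn pc' pQ).
rewrite part_imageE /= -(aut_included p) pK => /(_ iQ) E.
by apply/eqP; rewrite -pK E.
Qed.

(** * Maps between parts *)

Section PartMaps.
Variable G : centered_graph.
Implicit Types (d e : dart G) (u v w : vert G) (A B C : part G)
  (F : vert G -> vert G) (H : dart G -> dart G).

(** Under these conditions [subgraph] drops no dart of the piece and no incidence. *)
Definition regular_part A : Prop :=
  [/\ forall d, d \in A.1.2 -> flip d \in A.1.2,
      forall d v, inc d = Some v -> d \in A.1.2 -> v \in A.1.1
    & A.2 \subset A.1.1].

(** Boundary isomorphisms in the form of total maps of [G] that are constrained on [A] only. In this
    form they compose and can be glued without passing between the subtypes of different
    subgraphs. *)
Definition part_map A B F H : Prop :=
  [/\ [/\ F @: A.1.1 = B.1.1, H @: A.1.2 = B.1.2 & F @: A.2 = B.2],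
      {in A.1.1 &, injective F}, {in A.1.2 &, injective H}
    & forall d, d \in A.1.2 ->
      [/\ inc (H d) = omap F (inc d), H (flip d) = flip (H d), color (H d) = color d,
          etype (H d) = etype d & etype d = Directed -> tail (H d) = tail d]].

Lemma part_map_comp A B C F H F' H' : regular_part A ->
  part_map A B F H -> part_map B C F' H' -> part_map A C (F' \o F) (H' \o H).
Proof.
move=> [flA incA _] [[f1 f2 f3] fi hi dA] [[f1' f2' f3'] fi' hi' dB].
have FB v : v \in A.1.1 -> F v \in B.1.1 by rewrite -f1; apply: imset_f.
have HB d : d \in A.1.2 -> H d \in B.1.2 by rewrite -f2; apply: imset_f.
split.
- by rewrite (imset_comp F' F) (imset_comp H' H) f1 f2 (imset_comp F' F) f3.
- by move=> v w vA wA /= /fi'/fi; apply; rewrite ?FB.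
- by move=> v w vA wA /= /hi'/hi; apply; rewrite ?HB.
move=> d dd; have [i1 i2 i3 i4 i5] := dA d dd; have [j1 j2 j3 j4 j5] := dB _ (HB _ dd).
split=> /=; rewrite ?j1 ?j3 ?i3 ?j4 ?i4 ?i1 ?i2 //.
  by case: (inc d).
by move=> tD; rewrite j5 ?i5 ?i4.
Qed.

Lemma aut_part_map (p : autT G) A : p \in AutG G -> part_map A (part_image p A) p.1 p.2.
Proof.
move=> pA; split=> //; [by move=> ? ? _ _; apply: perm_inj | by move=> ? ? _ _; apply:
  perm_inj | ].
by move=> d _; apply: autP.
Qed.

Section Lift.
Variables (A B : part G) (F : vert G -> vert G) (H : dart G -> dart G).
Hypothesis regA : regular_part A.
Hypothesis AB : part_map A B F H.

Lemma lift_vertP (v : sub_vert A.1) : F (val v) \in B.1.1.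
Proof. by have [[<- _ _] _ _ _] := AB; apply/imset_f/valP. Qed.
Lemma lift_dartP (d : sub_dart A.1) : (H (val d) \in B.1.2) && (flip (H (val d)) \in B.1.2).
Proof.
have /andP[dA fdA] := valP d; have [[_ <- _] _ _ /(_ _ dA)[_ <- _ _ _]] := AB.
by rewrite !imset_f.
Qed.
Definition lift_vert (v : sub_vert A.1) : sub_vert B.1 := Sub (F (val v)) (lift_vertP v).
Definition lift_dart (d : sub_dart A.1) : sub_dart B.1 := Sub (H (val d)) (lift_dartP d).

Lemma lift_preserves : @preserves (part_graph A) (part_graph B) lift_vert lift_dart.
Proof.
have [_ _ _ hA] := AB; apply/forallP=> d; have /andP[dA _] := valP d.
have [i1 i2 i3 i4 i5] := hA _ dA; apply/and5P; split.
- rewrite /= i1; case E: (inc (val d)) => [v|] //=.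
  have vA : v \in A.1.1 by case: regA => _ /(_ _ _ E) h _; apply: h.
  rewrite (insubT (mem A.1.1) vA) /=.
  have vB : F v \in B.1.1 by apply: (lift_vertP (Sub v vA)).
  by rewrite (insubT (mem B.1.1) vB) /=; apply/eqP; congr Some; apply: val_inj.
- by apply/eqP/val_inj.
- by rewrite /= i3.
- by rewrite /= i4.
- by apply/implyP=> /eqP /= td; rewrite i5.
Qed.

Lemma lift_iso : boundary_iso lift_vert lift_dart.
Proof.
have [[f1 f2 f3] fi hi hA] := AB; have [flA incA bA] := regA.
have vi : injective lift_vert.
  by move=> v w [E]; apply/val_inj/fi => //; apply: valP.
have di : injective lift_dart.
  move=> d e [E]; apply/val_inj/hi => //; by case/andP: (valP d); case/andP: (valP e).
split.
- apply: inj_card_bij vi _; rewrite !card_sig -f1 card_in_imset //.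
- apply: inj_card_bij di _; rewrite !card_sig.
  have E (C : part G) : (forall d, d \in C.1.2 -> flip d \in C.1.2) ->
      #|[pred d | (d \in C.1.2) && (flip d \in C.1.2)]| = #|C.1.2|.
    by move=> flC; apply: eq_card => d; rewrite !inE; case: (boolP (_ \in _)) => //= /flC.
  rewrite !E //; first by rewrite -f2 card_in_imset.
  move=> e; rewrite -f2 => /imsetP[d dA ->]; have [_ <- _ _ _] := hA _ dA.
  exact/imset_f/flA.
- exact: lift_preserves.
apply/setP=> v; rewrite inE -f3; apply/imsetP/imsetP => [[u] | [u uA E]].
  by rewrite inE => uA ->; exists (val u).
exists (Sub u (subsetP bA u uA)); first by rewrite inE.
exact: val_inj.
Qed.

End Lift.

Lemma iso_part_map A B f g : regular_part A -> regular_part B -> @boundary_iso G A B f g ->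
  exists F H, [/\ part_map A B F H, forall v : sub_vert A.1, F (val v) = val (f v)
    & forall d : sub_dart A.1, H (val d) = val (g d)].
Proof.
move=> [flA incA bA] [flB incB bB] [bf bg /forallP pfg fb].
(* The value outside of [A] is an arbitrary default. *)
pose F (v : vert G) : vert G :=
  if (insub v : option (sub_vert A.1)) is Some v' then val (f v' : sub_vert B.1) else v.
pose H (d : dart G) : dart G :=
  if (insub d : option (sub_dart A.1)) is Some d' then val (g d' : sub_dart B.1) else d.
have FE (v : sub_vert A.1) : F (val v) = val (f v : sub_vert B.1) by rewrite /F valK.
have HE (d : sub_dart A.1) : H (val d) = val (g d : sub_dart B.1) by rewrite /H valK.
have sv (C : part G) v : v \in C.1.1 -> exists v' : sub_vert C.1, val v' = v.
  by move=> vC; exists (Sub v vC).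
have sd (C : part G) d : (forall d, d \in C.1.2 -> flip d \in C.1.2) -> d \in C.1.2 ->
    exists d' : sub_dart C.1, val d' = d.
  move=> flC dC; have h : (d \in C.1.2) && (flip d \in C.1.2) by rewrite dC flC.
  by exists (Sub d h).
have [fi gi fK gK] : [/\ injective f, injective g,
    forall v : sub_vert B.1, exists u : sub_vert A.1, v = f u
    & forall e : sub_dart B.1, exists d : sub_dart A.1, e = g d].
  by case: bf bg => [f' fK f'K] [g' gK g'K]; split; [exact: can_inj fK | exact: can_inj gK |
    move=> v; exists (f' v) | move=> e; exists (g' e)].
exists F, H; split=> //; split.
- split; apply/setP=> x; apply/imsetP/idP => [[y yA ->] | xB].
  + by have [y' <-] := sv _ _ yA; rewrite FE; apply: valP.
  + have [x' <-] := sv _ _ xB; have [y ->] := fK x'; exists (val y); [exact: valP | by rewrite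
    FE].
  + by have [y' <-] := sd _ _ flA yA; rewrite HE; case/andP: (valP (g y')).
  + have [x' <-] := sd _ _ flB xB; have [y ->] := gK x'.
    by exists (val y); [case/andP: (valP y) | rewrite HE].
  + have yA1 := subsetP bA _ yA; have [y' yE] := sv _ _ yA1; rewrite -yE FE.
    have : f y' \in sub_boundary B by rewrite -fb imset_f // inE yE.
    by rewrite inE.
  + have xB1 := subsetP bB _ xB; have [x' xE] := sv _ _ xB1.
    have : x' \in sub_boundary B by rewrite inE xE.
    rewrite -fb => /imsetP[y]; rewrite inE => yA E; exists (val y) => //.
    by rewrite FE -E xE.
- by move=> v w /sv[v' <-] /sv[w' <-]; rewrite !FE => /val_inj/fi ->.
- by move=> d e /(sd _ _ flA)[d' <-] /(sd _ _ flA)[e' <-]; rewrite !HE => /val_inj/gi ->.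
move=> d dA; have [d' dE] := sd _ _ flA dA; rewrite -dE.
have /and5P[/eqP i1 /eqP i2 /eqP i3 /eqP i4 /implyP i5] := pfg d'.
have fE : flip (val d') = val (flip (g := part_graph A) d') by [].
rewrite fE !HE i2; split=> //; last by move=> /eqP/i5/eqP.
move: i1; rewrite /=; case E: (inc (val d')) => [v|] /=.
  have vA : v \in A.1.1 by apply: incA E _; case/andP: (valP d').
  rewrite (insubT (mem A.1.1) vA) /=; have := FE (Sub v vA); rewrite SubK => ->.
  by case: (inc (val (g d'))) => [w|] //=; case: insubP => //= w' _ <- [->].
case E': (inc (val (g d'))) => [w|] //=.
have wB : w \in B.1.1 by apply: incB E' _; case/andP: (valP (g d')).
by rewrite (insubT (mem B.1.1) wB).
Qed.

Definition exchange_map A F H : Prop :=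
  part_map A A F H /\ forall v, v \in A.2 -> F v != v.

Definition halving_map A F H : Prop :=
  [/\ exchange_map A F H,
      forall v, v \in A.1.1 -> F (F v) = v /\ F v != v
    & forall d, d \in A.1.2 ->
      [/\ H (H d) = d, H d != d & etype d != Halvable -> H d != flip d]].

Lemma exchangeableP A : regular_part A ->
  exchangeable A <-> exists F H, exchange_map A F H.
Proof.
move=> regA; split.
  case/existsP=> p /andP[]; rewrite inE => /andP[pA /eqP bA] /forallP ex.
  have iso : boundary_iso p.1 p.2.
    split=> //; [exact/injF_bij/perm_inj | exact/injF_bij/perm_inj | by rewrite inE in pA].
  have [F [H [m FE HE]]] := iso_part_map regA regA iso.
  exists F, H; split=> // v vA; have [_ _ bA1] := regA.
  have vA1 := subsetP bA1 v vA; pose v' : sub_vert A.1 := Sub v vA1.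
  move/implyP: (ex v'); rewrite inE => /(_ vA); apply: contra_neq => E.
  by apply: val_inj; rewrite -FE.
move=> [F [H [m ex]]].
have [bf bg pfg fb] := lift_iso regA m.
have fi := bij_inj bf; have gi := bij_inj bg.
apply/existsP; exists (perm fi, perm gi); apply/andP; split.
  rewrite inE; apply/andP; split.
    rewrite inE; apply/forallP=> d; have := forallP pfg d; rewrite /= !permE.
    by rewrite (eq_omap (permE fi)).
  by rewrite -[X in _ == X]fb; apply/eqP/eq_imset => x; rewrite permE.
apply/forallP=> v; apply/implyP; rewrite inE => vA; rewrite permE.
by apply: contra_neq (ex _ vA) => /(congr1 val).
Qed.

(** A group of order two has a single nontrivial element, so its semiregularity is a pointwise
    condition on the generator. *)
Lemma halvableP A : regular_part A -> A.2 != set0 ->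
  halvable A <-> exists F H, halving_map A F H.
Proof.
move=> regA nA; have [flA incA bA1] := regA; split.
  case/existsP=> p /andP[]; rewrite inE => /andP[pA /eqP bA].
  case/and3P=> /eqP p2 /forallP/(_ p) sr /forallP ex.
  have pn1 : p != 1%g by rewrite -order_eq1 p2.
  move: sr; rewrite cycle_id pn1 /= => /and3P[/forallP nv /forallP nd /forallP ne].
  have pp : (p * p = 1)%g by rewrite -{2}[p]expg1 -expgS -p2 expg_order.
  have iso : boundary_iso p.1 p.2.
    split=> //; [exact/injF_bij/perm_inj | exact/injF_bij/perm_inj | by rewrite inE in pA].
  have [F [H [m FE HE]]] := iso_part_map regA regA iso.
  exists F, H; split.
  - split=> // v vA; have vA1 := subsetP bA1 v vA; pose v' : sub_vert A.1 := Sub v vA1.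
    move/implyP: (ex v'); rewrite inE => /(_ vA); apply: contra_neq => E.
    by apply: val_inj; rewrite -FE.
  - move=> v vA1; pose v' : sub_vert A.1 := Sub v vA1.
    have -> : v = val v' by []; rewrite !FE; split.
      by rewrite -permM -[(p.1 * p.1)%g]/((p * p)%g.1) pp perm1.
    by apply: contraNneq (nv v') => /val_inj ->.
  - move=> d dA; have h : (d \in A.1.2) && (flip d \in A.1.2) by rewrite dA flA.
    pose d' : sub_dart A.1 := Sub d h.
    have -> : d = val d' by []; rewrite !HE; split.
    + by rewrite -permM -[(p.2 * p.2)%g]/((p * p)%g.2) pp perm1.
    + by apply: contraNneq (nd d') => /val_inj ->.
    + move=> ty; move/implyP: (ne d') => /(_ ty); apply: contra => /eqP E.
      by rewrite !inE; apply/orP; right; apply/eqP/val_inj.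
move=> [F [H [[m ex] hv hd]]].
have [bf bg pfg fb] := lift_iso regA m.
have fi := bij_inj bf; have gi := bij_inj bg.
pose p : autT (part_graph A) := (perm fi, perm gi).
(* A boundary vertex is moved, so the involution is nontrivial and its order is exactly 2. *)
have [v0 v0A] := set0Pn _ nA; pose v0' : sub_vert A.1 := Sub v0 (subsetP bA1 _ v0A).
have pn1 : p != 1%g.
  apply: contra_neq (ex _ v0A) => p1.
  by have := perm1 (v0' : vert (part_graph A)); rewrite -[1%g]/((1 : autT _)%g.1) -p1 permE =>
    /(congr1 val).
have pp : (p ^+ 2 = 1)%g.
  rewrite expgS expg1; congr (_, _); apply/permP=> x; rewrite permM !permE; apply: val_inj =>
    /=.
    by case: (hv _ (valP x)).
  by case/andP: (valP x) => /hd[].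
have p2 : #[p]%g = 2 by apply: nt_prime_order.
apply/existsP; exists p; apply/andP; split.
  rewrite inE; apply/andP; split.
    rewrite inE; apply/forallP=> d; have := forallP pfg d; rewrite /= !permE.
    by rewrite (eq_omap (permE fi)).
  by rewrite -[X in _ == X]fb; apply/eqP/eq_imset => x; rewrite permE.
apply/and3P; split; first by apply/eqP.
  apply/forallP=> q; apply/implyP; rewrite (cycle2g p2) !inE => /orP[/eqP -> | /eqP ->].
    by rewrite eqxx.
  apply/implyP=> _; apply/and3P; split; apply/forallP=> x; rewrite /= permE.
  - by apply: contraTneq isT => /(congr1 val) /= E; case: (hv _ (valP x)) => _; rewrite E eqxx.
  - apply: contraTneq isT => /(congr1 val) /= E; case/andP: (valP x) => /hd[_ + _] _.
    by rewrite E eqxx.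
  apply/implyP=> ty; case/andP: (valP x) => /hd[_ n1 /(_ ty) n2] _.
  rewrite !inE; apply/norP; split.
    by apply: contra_neq n1 => /(congr1 val).
  by apply: contra_neq n2 => /(congr1 val).
apply/forallP=> v; apply/implyP; rewrite inE => vA; rewrite permE.
by apply: contra_neq (ex _ vA) => /(congr1 val).
Qed.

Section Conjugate.
Variables (p : autT G) (A : part G).
Hypotheses (pA : p \in AutG G) (regA : regular_part A).

Lemma part_imageK : part_image p^-1%g (part_image p A) = A.
Proof.
case: A => [[X Y] Z]; rewrite /part_image /= -!imset_comp.
by rewrite !(eq_imset (g := id)) ?imset_id // => x /=; rewrite permK.
Qed.

Lemma aut_regular_part : regular_part (part_image p A).
Proof.
have [flA incA bA1] := regA; split.
- move=> _ /imsetP[d dA ->]; rewrite (aut_flip pA); exact/imset_f/flA.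
- move=> d' v + /imsetP[d dA dE]; rewrite dE (aut_inc pA).
  by case E: (inc d) => [w|] //= [<-]; apply/imset_f/(incA _ _ E).
- exact: imsetS.
Qed.

Lemma conjugate_exchange F H : exchange_map A F H ->
  exchange_map (part_image p A) (p.1 \o (F \o p.1^-1%g)) (p.2 \o (H \o p.2^-1%g)).
Proof.
move=> [m ex]; split.
  apply: (part_map_comp (B := A) aut_regular_part) (aut_part_map A pA).
  apply: part_map_comp aut_regular_part _ m.
  rewrite -[A in part_map _ A]part_imageK; apply: (aut_part_map (p := p^-1%g)).
  by rewrite groupV.
by move=> _ /imsetP[v vA ->] /=; rewrite permK (inj_eq perm_inj) ex.
Qed.

Lemma conjugate_halving F H : halving_map A F H ->
  halving_map (part_image p A) (p.1 \o (F \o p.1^-1%g)) (p.2 \o (H \o p.2^-1%g)).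
Proof.
move=> [ex hv hd]; split; first exact: conjugate_exchange.
  move=> _ /imsetP[v vA ->] /=; rewrite !permK (inj_eq perm_inj).
  by case: (hv _ vA) => ->.
move=> _ /imsetP[d dA ->] /=; rewrite !permK (inj_eq perm_inj).
have [-> n1 n2] := hd _ dA; have [_ f _ -> _] := autP pA d.
by split=> // /n2; rewrite -f (inj_eq perm_inj).
Qed.

End Conjugate.

Lemma aut_new_type (p : autT G) A : p \in AutG G -> regular_part A -> A.2 != set0 ->
  new_type (part_image p A) = new_type A.
Proof.
move=> pA regA nA; have regB := aut_regular_part pA regA.
have pA' : p^-1%g \in AutG G by rewrite groupV.
have nB : (part_image p A).2 != set0 by rewrite imset_eq0.
rewrite /new_type card_imset; last exact: perm_inj.
have -> : halvable (part_image p A) = halvable A.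
  apply/idP/idP => /halvableP.
    move=> /(_ regB nB)[F [H]] /(conjugate_halving pA' regB); rewrite part_imageK => h.
    by apply/(halvableP regA nA); do 2 eexists; exact: h.
  by move=> /(_ regA nA)[F [H]] /(conjugate_halving pA regA) h; apply/(halvableP regB nB); do
    2 eexists; exact: h.
have -> // : exchangeable (part_image p A) = exchangeable A.
apply/idP/idP => /exchangeableP.
  move=> /(_ regB)[F [H]] /(conjugate_exchange pA' regB); rewrite part_imageK => h.
  by apply/(exchangeableP regA); do 2 eexists; exact: h.
by move=> /(_ regA)[F [H]] /(conjugate_exchange pA regA) h; apply/(exchangeableP regB); do 2
  eexists; exact: h.
Qed.

Lemma halvable_exchangeable A : regular_part A -> A.2 != set0 -> halvable A -> exchangeable A.
Proof.
by move=> regA nA /(halvableP regA nA)[F [H [ex _ _]]]; apply/(exchangeableP regA); exists F,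
  H.
Qed.

End PartMaps.

(** * Automorphisms of the reduced graph *)

(** The invariant of the reduction series. It retains from [is_center] what a reduction step uses,
    so that no eccentricities have to be computed in the reduced graphs. *)
Definition well_centered (G : centered_graph) : Prop :=
  [/\ forall x y, conn (G := G) set0 x y,
      exists rho : vert G + dart G, represents rho
    & forall p, p \in AutG G -> aut_piece p (center G) = center G].

Section Step.
Variables (G : centered_graph) (c : choices G).
Hypothesis G_centered : well_centered G.
Implicit Types (A B : atom G) (p : autT G) (q : autT (reduction c))
  (v w : vert G) (d : dart G).

Lemma atom_is_part A : is_part (val A).
Proof. by case/andP: (valP A). Qed.

Lemma atom_regular A : regular_part (val A).
Proof.
have [G_conn [rho rho_center] _] := G_centered; have pA := atom_is_part A.
split; first by move=> d; apply: is_part_flip.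
  by move=> d v dv; apply: (part_incident G_conn rho_center pA dv).
exact: (part_boundary_sub G_conn rho_center pA).
Qed.

Lemma atom_boundary_neq0 A : (val A).2 != set0.
Proof. by rewrite -card_gt0; case/orP: (is_part_boundary (atom_is_part A)) => /eqP ->. Qed.

Lemma atoms_disj A B : A <> B -> part_disjoint (val A) (val B).
Proof.
have [G_conn [rho rho_center] _] := G_centered => AB.
by apply: (atoms_disjoint G_conn rho_center); rewrite ?(valP A) ?(valP B) // => /val_inj.
Qed.

Lemma atom_eq_dart A B d : d \in (val A).1.2 -> d \in (val B).1.2 -> A = B.
Proof.
move=> dA dB; apply/eqP; apply: contraT => /eqP /atoms_disj[_ _ /(_ _ dA)].
by rewrite dB.
Qed.

Lemma atom_eq_vert A B v : v \in (val A).1.1 -> v \notin (val A).2 -> v \in (val B).1.1 -> A =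
  B.
Proof.
move=> vA nvA vB; apply/eqP; apply: contraT => /eqP /atoms_disj[/(_ _ vA nvA)].
by rewrite vB.
Qed.

Lemma atom_interior A d v : inc d = Some v -> v \in (val A).1.1 -> v \notin (val A).2 ->
  d \in (val A).1.2.
Proof.
have [G_conn [rho rho_center] _] := G_centered.
exact: (part_interior G_conn rho_center (atom_is_part A)).
Qed.

Lemma kept_vertPn v : reflect (exists2 A : atom G, v \in (val A).1.1 & v \notin (val A).2) (~~
  kept_vert v).
Proof.
rewrite negbK; apply: (iffP existsP) => [[A] | [A h1 h2]].
  by rewrite inE => /andP[h1 h2]; exists A.
by exists A; rewrite inE h2.
Qed.

Lemma kept_dartPn d : reflect (exists A : atom G, d \in (val A).1.2) (~~ kept_dart d).
Proof. rewrite negbK; exact: existsP. Qed.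

Lemma interior_not_kept A v : v \in (val A).1.1 -> v \notin (val A).2 -> ~~ kept_vert v.
Proof. by move=> h1 h2; apply/kept_vertPn; exists A. Qed.

Lemma dart_not_kept A d : d \in (val A).1.2 -> ~~ kept_dart d.
Proof. by move=> h; apply/kept_dartPn; exists A. Qed.

Lemma boundary_kept A v : v \in (val A).2 -> kept_vert v.
Proof.
move=> vA; apply: contraT => /kept_vertPn[B vB nvB]; have [_ _ bA] := atom_regular A.
by have E := atom_eq_vert vB nvB (subsetP bA v vA); rewrite E vA in nvB.
Qed.

Lemma kept_inc d v : kept_dart d -> inc d = Some v -> kept_vert v.
Proof.
move=> kd dv; apply: contraT => /kept_vertPn[A vA nvA].
by have := dart_not_kept (atom_interior dv vA nvA); rewrite kd.
Qed.

Section AtomImage.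
Variable p : autT G.
Hypothesis pG : p \in AutG G.

Lemma aut_atom_subproof A : is_atom (part_image p (val A)).
Proof.
have [G_conn _ cG] := G_centered.
by apply: aut_is_atom (valP A); rewrite ?cG.
Qed.
Definition aut_atom A : atom G := Sub (part_image p (val A)) (aut_atom_subproof A).

End AtomImage.

Lemma aut_kept_vert p v : p \in AutG G -> kept_vert v -> kept_vert (p.1 v).
Proof.
move=> pG; apply: contraTT => /kept_vertPn[A vA nvA]; apply/kept_vertPn.
have pG' : p^-1%g \in AutG G by rewrite groupV.
exists (aut_atom pG' A); rewrite -[v](permK p.1) /= ?(mem_imset _ _ perm_inj) //.
Qed.

Lemma aut_kept_dart p d : p \in AutG G -> kept_dart d -> kept_dart (p.2 d).
Proof.
move=> pG; apply: contraTT => /kept_dartPn[A dA]; apply/kept_dartPn.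
have pG' : p^-1%g \in AutG G by rewrite groupV.
exists (aut_atom pG' A); rewrite -[d](permK p.2) /= ?(mem_imset _ _ perm_inj) //.
Qed.

Lemma mem_ends_image p (P : part G) x : (omap p.1 x \in ends (part_image p P)) = (x \in ends
  P).
Proof.
have p1_inj : injective p.1 := @perm_inj _ p.1.
have S_inj : injective (@Some (vert G)) := @Some_inj _.
rewrite /ends /= card_imset // !in_setU; congr orb.
  case: x => [v|] /=; first by rewrite !(mem_imset _ _ S_inj) (mem_imset _ _ p1_inj).
  by apply/imsetP/imsetP => -[].
by case: ifP; rewrite !inE //; case: x.
Qed.

Lemma omap_inj p : injective (omap p.1).
Proof. by move=> [v|] [w|] //= [] /perm_inj ->. Qed.

Lemma other_end_image p (P : part G) x : is_part P -> is_part (part_image p P) -> x \in ends P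
  ->
  other_end (part_image p P) (omap p.1 x) = omap p.1 (other_end P x).
Proof.
move=> pP pQ xP; have [E n] := other_endP pP xP.
have [|E' n'] := other_endP (x := omap p.1 x) pQ; first by rewrite mem_ends_image.
have : omap p.1 (other_end P x) \in ends (part_image p P).
  by rewrite mem_ends_image E !inE eqxx orbT.
by rewrite E' !inE (inj_eq (@omap_inj p)) (negPf n) => /eqP.
Qed.

Section Induced.
Variable p : autT G.
Hypothesis pG : p \in AutG G.
Hypothesis c_valid : valid_choices c.

Definition ind_vert (v : red_vert G) : red_vert G :=
  Sub (p.1 (val v)) (aut_kept_vert pG (valP v)).
Definition ind_old (d : old_dart G) : old_dart G :=
  Sub (p.2 (val d)) (aut_kept_dart pG (valP d)).
Lemma ind_new_subproof (e : new_dart G) :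
  omap p.1 (val e).2 \in ends (val (aut_atom pG (val e).1)).
Proof. by rewrite mem_ends_image; apply: (valP e). Qed.
Definition ind_new (e : new_dart G) : new_dart G :=
  Sub (aut_atom pG (val e).1, omap p.1 (val e).2) (ind_new_subproof e).
Definition ind_dart (d : red_dart G) : red_dart G :=
  match d with inl d => inl (ind_old d) | inr e => inr (ind_new e) end.

Lemma ind_vert_inj : injective ind_vert.
Proof. by move=> v w [] /perm_inj/val_inj. Qed.

Lemma part_image_val_inj A B : part_image p (val A) = part_image p (val B) -> A = B.
Proof. by move/(part_image_inj (p := p))/val_inj. Qed.

Lemma ind_dart_inj : injective ind_dart.
Proof.
move=> [d|e] [d'|e'] //= [].
  by move=> /perm_inj/val_inj ->.
case: e e' => [[A x] hx] [[A' x'] hx'] /= h1 h2 h3 h4.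
congr inr; apply: val_inj => /=; congr (_, _); last exact: omap_inj h4.
apply: part_image_val_inj; rewrite /part_image; congr (_, _, _); assumption.
Qed.

Definition induced : autT (reduction c) := (perm ind_vert_inj, perm ind_dart_inj).

Lemma ind_inc x : obind (insub : vert G -> option (red_vert G)) (omap p.1 x) =
  omap ind_vert (obind insub x).
Proof.
case: x => [v|] //=; case: insubP => [u kv vE|].
  case: insubP => [u' kv' vE'|]; last first.
    by case/negP; rewrite -[v](permK p.1); apply: (aut_kept_vert (p := p^-1%g)); rewrite
      ?groupV.
  by congr Some; apply: val_inj; rewrite /= vE vE'.
case: insubP => //= u' kv _; case/negP; exact: aut_kept_vert.
Qed.

Lemma boundary_iso_aut A : boundary_isomorphic (val A) (part_image p (val A)).
Proof.
by eexists; eexists; apply: (lift_iso (atom_regular A) (aut_part_map (val A) pG)).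
Qed.

(** On a new edge, [p] itself provides the boundary isomorphism from the atom to its image. It gives
    the color and, by the consistency of tails in [valid_choices], the orientation; the type is
    preserved since exchanges can be conjugated by [p]. *)
Lemma induced_aut : induced \in AutG (reduction c).
Proof.
have [cc ciso ctail] := c_valid.
rewrite inE; apply/forallP=> d; rewrite /= !permE (eq_omap (permE _)).
case: d => [d|e] /=.
  have [i1 i2 i3 i4 i5] := autP pG (val d).
  rewrite /red_inc i1 ind_inc i3 i4 !eqxx /=; apply/andP; split.
    by apply/eqP; congr inl; apply: val_inj.
  by apply/implyP=> /eqP/i5 ->.
have nt : new_type (part_image p (val (val e).1)) = new_type (val (val e).1).
  exact: aut_new_type pG (atom_regular _) (atom_boundary_neq0 _).
apply/and5P; split.
- by apply/eqP; apply: ind_inc.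
- apply/eqP; congr inr; apply: val_inj; rewrite /=; congr (_, _).
  rewrite -other_end_image //; [exact: atom_is_part | | exact: (valP e)].
  by case/andP: (aut_atom_subproof pG (val e).1).
- by apply/eqP/esym/ciso/boundary_iso_aut.
- by rewrite nt.
apply/implyP=> /eqP tD; set A := (val e).1 in tD *; set x := (val e).2.
have := ctail A (aut_atom pG A) _ _ tD (lift_iso (atom_regular A) (aut_part_map (val A) pG)).
move=> h; have [t tA tE] : exists2 t, t \in (val A).2 & t = val (new_tail c A).
  by exists (val (new_tail c A)) => //; apply: (valP (new_tail c A)).
have [_ _ bA] := atom_regular A.
have /= <- := h (Sub t (subsetP bA t tA)) tE.
by rewrite -tE -[Some (p.1 t)]/(omap p.1 (Some t)) (inj_eq (@omap_inj p)).
Qed.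

Lemma induced_induces : induces p induced.
Proof.
split=> [v|d|e]; first by rewrite permE.
  by exists (ind_old d); rewrite // permE.
by exists (ind_new e); rewrite // permE.
Qed.

End Induced.

(** Together with [induces_mul] this yields the homomorphism property for any choice of induced
    automorphisms, without computing with [induced], which depends on a proof that [p] is an
    automorphism. *)
Lemma induces_unique p q q' : induces p q -> induces p q' -> q = q'.
Proof.
move=> [h1 h2 h3] [h1' h2' h3'].
suff [E1 E2] : q.1 = q'.1 /\ q.2 = q'.2 by case: q q' E1 E2 {h1 h2 h3 h1' h2' h3'} => [? ?] [?
  ?] /= -> ->.
split; apply/permP=> x; first by apply: val_inj; rewrite h1 h1'.
case: x => [d|e].
  by have [d1 -> E1] := h2 d; have [d2 -> E2] := h2' d; congr inl; apply: val_inj; rewrite E1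
    E2.
have [e1 -> [E1 F1]] := h3 e; have [e2 -> [E2 F2]] := h3' e; congr inr; apply: val_inj.
by apply/eqP; rewrite -pair_eqE /pair_eq /= F1 F2 eqxx andbT -(inj_eq val_inj) E1 E2.
Qed.

Lemma induces_mul p p' q q' : induces p q -> induces p' q' -> induces (p * p')%g (q * q')%g.
Proof.
move=> [h1 h2 h3] [h1' h2' h3']; split=> [v|d|e].
- by rewrite /= permM h1' h1 permM.
- have [d1 E1 F1] := h2 d; have [d2 E2 F2] := h2' d1; exists d2; first by rewrite /= permM E1
  E2.
  by rewrite F2 F1 /= permM.
have [e1 E1 [F1 H1]] := h3 e; have [e2 E2 [F2 H2]] := h3' e1.
exists e2; first by rewrite /= permM E1 E2.
rewrite F2 H2 F1 H1 /part_image /= -!imset_comp; split.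
  by congr (_, _, _); apply: eq_imset => x; rewrite /= permM.
by case: (val e).2 => //= v; rewrite permM.
Qed.

End Step.

(** * Surjectivity *)

Section Glue.
Variables (G : centered_graph) (c : choices G).
Hypothesis G_centered : well_centered G.
Hypothesis c_valid : valid_choices c.
Implicit Types (A B : atom G) (v w : vert G) (d : dart G) (e : new_dart G).
Variable q : autT (reduction c).
Hypothesis qR : q \in AutG (reduction c).

(** New colors differ from all colors of [G], so [q] cannot mix old and new edges. *)
Lemma q_new e : exists e' : new_dart G, q.2 (inr e) = inr e'.
Proof.
have [cc _ _] := c_valid; have [_ _ + _ _] := autP qR (inr e).
by case: (q.2 (inr e)) => [d|e'] /= E; [case: (cc (val e).1 (val d)) | exists e'].
Qed.

Lemma q_old (d : old_dart G) : exists d' : old_dart G, q.2 (inl d) = inl d'.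
Proof.
have [cc _ _] := c_valid; have [_ _ + _ _] := autP qR (inl d).
by case: (q.2 (inl d)) => [d'|e'] /= E; [exists d' | case: (cc (val e').1 (val d))].
Qed.

Definition q_vert v : vert G :=
  if (insub v : option (red_vert G)) is Some u then val (q.1 u : red_vert G) else v.

Lemma q_vertE (u : red_vert G) : q_vert (val u) = val (q.1 u : red_vert G).
Proof. by rewrite /q_vert valK. Qed.

Lemma q_vert_inj v w : kept_vert v -> kept_vert w -> q_vert v = q_vert w -> v = w.
Proof.
move=> kv kw; have -> : v = val (Sub v kv : red_vert G) by [].
have -> : w = val (Sub w kw : red_vert G) by [].
by rewrite !q_vertE => /val_inj/perm_inj ->.
Qed.

Lemma some_ends (P : part G) v : (Some v \in ends P) = (v \in P.2).
Proof.
rewrite /ends in_setU (mem_imset _ _ (@Some_inj _)).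
by case: ifP; rewrite !inE ?orbF.
Qed.

(** Boundary vertices of atoms are kept, so [red_inc] forgets nothing of the name of a new dart and
    the name of its image can be read off from incidence. *)
Lemma q_end e e' : q.2 (inr e) = inr e' -> (val e').2 = omap q_vert (val e).2.
Proof.
move=> E; have := aut_inc qR (inr e); rewrite E /= /red_inc.
have hx := valP e; have hy := valP e'.
case Ex: (val e).2 => [v|] /=; rewrite Ex in hx.
  have kv : kept_vert v by apply: (boundary_kept G_centered (A := (val e).1)); rewrite
    -some_ends.
  rewrite (insubT (@kept_vert G) kv) /=; have := q_vertE (Sub v kv); rewrite SubK => ->.
  case: (val e').2 => [w|] //=; by case: insubP => //= w' _ <- [->].
case Ey: (val e').2 => [w|] //=; rewrite Ey in hy.
have kw : kept_vert w by apply: (boundary_kept G_centered (A := (val e').1)); rewrite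
  -some_ends.
by rewrite (insubT (@kept_vert G) kw).
Qed.

Lemma ends_cases e e' : (val e).1 = (val e').1 -> e' = e \/ e' = new_flip e.
Proof.
case: e e' => [[A x] hx] [[A' y] hy] /= E; subst A'.
have [Ee _] := other_endP (atom_part A) hx.
have : y \in ends (val A) by [].
by rewrite Ee => /set2P[yE|yE]; [left | right]; apply: val_inj; rewrite /= yE.
Qed.

Lemma q_flip e e' : q.2 (inr e) = inr e' -> q.2 (inr (new_flip e)) = inr (new_flip e').
Proof. by move=> E; have := aut_flip qR (inr e); rewrite E /= => <-. Qed.

Definition glues A (t : atom G * (vert G -> vert G) * (dart G -> dart G)) : Prop :=
  [/\ part_map (val A) (val t.1.1) t.1.2 t.2,
      forall v, v \in (val A).2 -> t.1.2 v = q_vert v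
    & forall e, (val e).1 = A -> exists2 e', q.2 (inr e) = inr e' & (val e').1 = t.1.1].

Lemma atom_end A v : v \in (val A).2 -> exists2 e : new_dart G, (val e).1 = A & (val e).2 =
  Some v.
Proof.
move=> vA; have h : Some v \in ends (val A) by rewrite some_ends.
by exists (Sub (A, Some v) h : new_dart G).
Qed.

Lemma atom_glue A : exists t, glues A t.
Proof.
have [cc ciso ctail] := c_valid.
have [u0 u0A] := set0Pn _ (atom_boundary_neq0 A).
have [e0 A0 x0] := atom_end u0A; have [e0' E0] := q_new e0.
pose B := (val e0').1.
have toB e : (val e).1 = A -> exists2 e', q.2 (inr e) = inr e' & (val e').1 = B.
  rewrite -A0 => /esym/ends_cases[] ->; first by exists e0'.
  by exists (new_flip e0'); [apply: q_flip | ].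
have bd v : v \in (val A).2 -> q_vert v \in (val B).2.
  move=> vA; have [e eA eE] := atom_end vA; have [e' Ee eB] := toB e eA.
  have := q_end Ee; rewrite eE /= => yE; rewrite -some_ends -yE -eB.
  exact: (valP e').
have [f [g iso]] : boundary_isomorphic (val A) (val B).
  by apply/ciso; have [_ _ + _ _] := autP qR (inr e0); rewrite E0 /= A0 => ->.
have rA := atom_regular G_centered A; have rB := atom_regular G_centered B.
have [F [H [m FE HE]]] := iso_part_map rA rB iso.
suff [F' [H' [m' F'E]]] : exists F' H', part_map (val A) (val B) F' H' /\
    forall v, v \in (val A).2 -> F' v = q_vert v.
  by exists (B, F', H').
have [[_ _ bAB] Fi _ _] := m; have [_ _ bA1] := rA.
(* On a boundary of size one every boundary isomorphism agrees with [q]. On a boundary of size two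
   it agrees with [q] or differs from it by the exchange. *)
have [/cards1P[u Eu] | cA] := boolP (#|(val A).2| == 1).
  exists F, H; split=> // v; have := bd u; rewrite Eu -bAB Eu imset_set1 !inE eqxx => /(_
    isT)/eqP qu.
  by move=> /eqP ->.
have /cards2P[u [v [uv Euv]]] : #|(val A).2| == 2.
  by case/orP: (is_part_boundary (atom_is_part A)) => // /idPn.
have uA : u \in (val A).2 by rewrite Euv !inE eqxx.
have vA : v \in (val A).2 by rewrite Euv !inE eqxx orbT.
have [qu qv] := (bd u uA, bd v vA).
rewrite -bAB Euv imsetU !imset_set1 !inE in qu qv.
have Fuv : F u != F v by apply: contra_neq uv => /Fi; apply; apply: (subsetP bA1).
have quv : q_vert u != q_vert v.
  by apply: contra_neq uv => /q_vert_inj; apply; apply: boundary_kept; eassumption.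
have [quF | quF] := eqVneq (q_vert u) (F u).
  exists F, H; split=> // a; rewrite Euv => /set2P[] -> //.
  by case/orP: qv => /eqP // qvF; rewrite quF qvF eqxx in quv.
rewrite (negPf quF) /= in qu.
have qvF : q_vert v = F u.
  by case/orP: qv => /eqP // qvF; rewrite (eqP qu) qvF eqxx in quv.
(* For a directed edge both [q] and the isomorphism take the tail of [A] to the tail of [B], so they
   agree at one boundary vertex, which contradicts the exchanged position. *)
have [tyD | tyN] := eqVneq (new_type (val A)) Directed.
  exfalso; have tA := valP (new_tail c A); set t := val (new_tail c A) in tA.
  have tF : F t = val (new_tail c B).
    have t1 := subsetP bA1 t tA.
    by have := FE (Sub t t1); rewrite SubK => ->; apply: (ctail A B f g tyD iso).
  have [e eA eE] := atom_end tA; have [e' Ee eB] := toB e eA.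
  have tq : q_vert t = F t.
    have [_ _ _ _] := autP qR (inr e); rewrite Ee /= eA => /(_ tyD).
    rewrite eE eqxx (q_end Ee) eE eB /= => /eqP[->].
    by rewrite tF.
  move: tA; rewrite Euv => /set2P[] tE; move: tq; rewrite tE.
    by move=> E; rewrite E eqxx in quF.
  by rewrite qvF => E; rewrite E eqxx in Fuv.
(* The remaining types allow an exchange of the boundary of [A], which is applied before the
   isomorphism. *)
have exA : exchangeable (val A).
  move: tyN; rewrite /new_type (negPf cA).
  case: ifP => [hA _ | _]; first exact: (halvable_exchangeable rA (atom_boundary_neq0 A)).
  by case: ifP.
have [F0 [H0 [m0 ex0]]] := proj1 (exchangeableP rA) exA.
have [[_ _ b00] _ _ _] := m0.
have F0u : F0 u = v.
  have : F0 u \in (val A).2 by rewrite -b00 imset_f.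
  by rewrite Euv => /set2P[] // E; have := ex0 _ uA; rewrite E eqxx.
have F0v : F0 v = u.
  have : F0 v \in (val A).2 by rewrite -b00 imset_f.
  by rewrite Euv => /set2P[] // E; have := ex0 _ vA; rewrite E eqxx.
exists (F \o F0), (H \o H0); split; first exact: part_map_comp m0 m.
by move=> a; rewrite Euv => /set2P[] -> /=; rewrite ?F0u ?F0v ?qvF ?(eqP qu).
Qed.

Section Assemble.
Variable t : atom G -> atom G * (vert G -> vert G) * (dart G -> dart G).
Hypothesis tP : forall A, glues A (t A).

Let img A := (t A).1.1.

Lemma img_inj : injective img.
Proof.
move=> A A' E; have [u uA] := set0Pn _ (atom_boundary_neq0 A).
have [u' uA'] := set0Pn _ (atom_boundary_neq0 A').
have [e eA _] := atom_end uA; have [e' eA' _] := atom_end uA'.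
have [_ _ /(_ e eA)[a qe aE]] := tP A; have [_ _ /(_ e' eA')[a' qe' aE']] := tP A'.
rewrite -eA -eA'.
have : (val a).1 = (val a').1 by rewrite aE aE'.
case/ends_cases=> aa.
  have : q.2 (inr e') = q.2 (inr e) by rewrite qe qe' aa.
  by move/perm_inj => [->].
have : q.2 (inr e') = q.2 (inr (new_flip e)) by rewrite (q_flip qe) qe' aa.
by move/perm_inj => [->].
Qed.

Definition glue_vert v : vert G :=
  if [pick A : atom G | v \in (val A).1.1 :\: (val A).2] is Some A
  then (t A).1.2 v else q_vert v.

Definition q_dart d : dart G :=
  if (insub d : option (old_dart G)) is Some d' then
    if q.2 (inl d') is inl d'' then val d'' else d
  else d.

Definition glue_dart d : dart G :=
  if [pick A : atom G | d \in (val A).1.2] is Some A then (t A).2 d else q_dart d.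

Lemma glue_vert_kept (u : red_vert G) : glue_vert (val u) = val (q.1 u : red_vert G).
Proof.
rewrite /glue_vert; case: pickP => [A|_]; last exact: q_vertE.
by rewrite inE => /andP[h1 h2]; have := interior_not_kept h2 h1; rewrite (valP u).
Qed.

(** The local map also gives the value at a boundary vertex, which several atoms may share, because
    there every local map agrees with [q]. *)
Lemma glue_vert_atom A v : v \in (val A).1.1 -> glue_vert v = (t A).1.2 v.
Proof.
move=> vA; have [vb | nvb] := boolP (v \in (val A).2).
  have kv := boundary_kept G_centered vb; have -> : v = val (Sub v kv : red_vert G) by [].
  by rewrite glue_vert_kept -q_vertE; have [_ -> //] := tP A.
rewrite /glue_vert; case: pickP => [B|/(_ A)]; last by rewrite inE vA nvb.
by rewrite inE => /andP[h1 h2]; rewrite (atom_eq_vert G_centered h2 h1 vA).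
Qed.

Lemma glue_dart_atom A d : d \in (val A).1.2 -> glue_dart d = (t A).2 d.
Proof.
move=> dA; rewrite /glue_dart; case: pickP => [B dB|/(_ A)]; last by rewrite dA.
by rewrite (atom_eq_dart G_centered dA dB).
Qed.

Lemma glue_dart_kept (d d' : old_dart G) : q.2 (inl d) = inl d' -> glue_dart (val d) = val d'.
Proof.
move=> E; rewrite /glue_dart; case: pickP => [A dA|_]; last by rewrite /q_dart valK E.
by have := dart_not_kept dA; rewrite (valP d).
Qed.

Lemma img_vert A v : v \in (val A).1.1 -> glue_vert v \in (val (img A)).1.1.
Proof.
by move=> vA; rewrite (glue_vert_atom vA); have [[[<- _ _] _ _ _] _ _] := tP A; apply: imset_f.
Qed.

Lemma img_interior A v : v \in (val A).1.1 -> v \notin (val A).2 ->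
  glue_vert v \notin (val (img A)).2.
Proof.
move=> vA; rewrite (glue_vert_atom vA); have [[[_ _ <-] Fi _ _] _ _] := tP A.
have [_ _ bA] := atom_regular G_centered A.
by apply: contra => /imsetP[w wA /Fi -> //]; apply: (subsetP bA).
Qed.

Lemma img_dart A d : d \in (val A).1.2 -> glue_dart d \in (val (img A)).1.2.
Proof.
by move=> dA; rewrite (glue_dart_atom dA); have [[[_ <- _] _ _ _] _ _] := tP A; apply: imset_f.
Qed.

Lemma glue_vert_inj : injective glue_vert.
Proof.
move=> v w E; have [kv | /kept_vertPn[A vA nvA]] := boolP (kept_vert v);
  have [kw | /kept_vertPn[B wB nwB]] := boolP (kept_vert w).
- have Ev : v = val (Sub v kv : red_vert G) by [].
  have Ew : w = val (Sub w kw : red_vert G) by [].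
  by move: E; rewrite Ev Ew !glue_vert_kept => /val_inj/perm_inj ->.
- have Ev : v = val (Sub v kv : red_vert G) by [].
  have := interior_not_kept (img_vert wB) (img_interior wB nwB).
  by rewrite -E Ev glue_vert_kept (valP (q.1 _ : red_vert G)).
- have Ew : w = val (Sub w kw : red_vert G) by [].
  have := interior_not_kept (img_vert vA) (img_interior vA nvA).
  by rewrite E Ew glue_vert_kept (valP (q.1 _ : red_vert G)).
have AB : A = B.
  apply: img_inj; apply: (atom_eq_vert G_centered (img_vert vA) (img_interior vA nvA)).
  by rewrite E img_vert.
subst B; move: E; rewrite (glue_vert_atom vA) (glue_vert_atom wB).
by have [[_ Fi _ _] _ _] := tP A; apply: Fi.
Qed.

Lemma glue_dart_inj : injective glue_dart.
Proof.
move=> d d' E; have [kd | /kept_dartPn[A dA]] := boolP (kept_dart d);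
  have [kd' | /kept_dartPn[B dB]] := boolP (kept_dart d').
- have Ed : d = val (Sub d kd : old_dart G) by [].
  have Ed' : d' = val (Sub d' kd' : old_dart G) by [].
  have [a qa] := q_old (Sub d kd); have [a' qa'] := q_old (Sub d' kd').
  move: E; rewrite Ed Ed' (glue_dart_kept qa) (glue_dart_kept qa') => /val_inj aa.
  have : q.2 (inl (Sub d kd)) = q.2 (inl (Sub d' kd')) by rewrite qa qa' aa.
  by move/perm_inj/(congr1 (fun x : red_dart G => if x is inl y then val y else d)).
- have Ed : d = val (Sub d kd : old_dart G) by [].
  have [a qa] := q_old (Sub d kd).
  by have := dart_not_kept (img_dart dB); rewrite -E Ed (glue_dart_kept qa) (valP a).
- have Ed : d' = val (Sub d' kd' : old_dart G) by [].
  have [a qa] := q_old (Sub d' kd').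
  by have := dart_not_kept (img_dart dA); rewrite E Ed (glue_dart_kept qa) (valP a).
have AB : A = B.
  by apply: img_inj; apply: (atom_eq_dart G_centered (img_dart dA)); rewrite E img_dart.
subst B; move: E; rewrite (glue_dart_atom dA) (glue_dart_atom dB).
by have [[_ _ Hi _] _ _] := tP A; apply: Hi.
Qed.

Definition glued : autT G := (perm glue_vert_inj, perm glue_dart_inj).

Lemma glued_aut : glued \in AutG G.
Proof.
rewrite inE; apply/forallP=> d; rewrite /= !permE (eq_omap (permE _)).
have [kd | /kept_dartPn[A dA]] := boolP (kept_dart d).
  pose d0 : old_dart G := Sub d kd; have -> : d = val d0 by [].
  have [a qa] := q_old d0; rewrite (glue_dart_kept qa).
  have [i1 i2 i3 i4 i5] := autP qR (inl d0); rewrite qa /= in i1 i2 i3 i4 i5.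
  apply/and5P; split.
  - move: i1; rewrite /red_inc /=; case Ea: (inc (val a)) => [w|] /=;
      case Ed: (inc d) => [v|] //=.
    + have kw := kept_inc G_centered (valP a) Ea; have kv := kept_inc G_centered kd Ed.
      rewrite (insubT (@kept_vert G) kw) (insubT (@kept_vert G) kv) /= => -[E].
      have := glue_vert_kept (Sub v kv); rewrite SubK => ->.
      by rewrite -E.
    + have kw := kept_inc G_centered (valP a) Ea.
      by rewrite (insubT (@kept_vert G) kw).
    + have kv := kept_inc G_centered kd Ed.
      by rewrite (insubT (@kept_vert G) kv).
  - have -> : flip (val d0) = val (old_flip d0) by [].
    by rewrite (glue_dart_kept (d' := old_flip a)) // -i2.
  - by rewrite i3.
  - by rewrite i4.
  - by apply/implyP=> /eqP/i5/eqP.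
have [flA incA _] := atom_regular G_centered A.
have [[_ _ _ /(_ d dA)[i1 i2 i3 i4 i5]] _ _] := tP A.
rewrite (glue_dart_atom dA) (glue_dart_atom (flA _ dA)); apply/and5P; split.
- rewrite i1; case Ed: (inc d) => [v|] //=.
  by rewrite (glue_vert_atom (incA _ _ Ed dA)).
- by rewrite i2.
- by rewrite i3.
- by rewrite i4.
- by apply/implyP=> /eqP/i5 ->.
Qed.

Lemma glued_induces : induces glued q.
Proof.
split=> [u|d|e].
- by rewrite permE glue_vert_kept.
- by have [d' qd] := q_old d; exists d'; rewrite // permE (glue_dart_kept qd).
have [[[i1 i2 i3] _ _ _] bE /(_ e erefl)[e' qe eE]] := tP (val e).1.
exists e' => //; have [_ _ bA] := atom_regular G_centered (val e).1; split.
  rewrite eE; have -> : val (t (val e).1).1.1 = (((val (t (val e).1).1.1).1.1, (val (t (val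
    e).1).1.1).1.2), (val (t (val e).1).1.1).2).
    by case: (val _) => [[? ?] ?].
  rewrite -i1 -i2 -i3 /part_image; congr (_, _, _); apply: eq_in_imset => x hx; rewrite permE.
  - by rewrite (glue_vert_atom hx).
  - by rewrite (glue_dart_atom hx).
  - by rewrite (glue_vert_atom (subsetP bA _ hx)).
rewrite (q_end qe); have := valP e; case: (val e).2 => [v|] //=; rewrite some_ends => hv.
by rewrite permE (glue_vert_atom (subsetP bA _ hv)) bE.
Qed.

End Assemble.

Lemma induces_surjective : exists2 p, p \in AutG G & induces p q.
Proof.
have [t tP] := fin_all_exists atom_glue.
by exists (glued tP); [apply: glued_aut | apply: glued_induces].
Qed.

End Glue.

(** * The center of the reduced graph *)

Section ReducedCenter.
Variable G : centered_graph.
Hypothesis G_centered : well_centered G.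
Implicit Types (A B : atom G) (v w : vert G) (d f : dart G)
  (x y z : vert G + dart G) (K : {set vert G + dart G}).

Let G_conn x y : conn (G := G) set0 x y.
Proof. by have [h _ _] := G_centered; apply: h. Qed.

Lemma atom_dart A : exists d, d \in (val A).1.2.
Proof.
apply/set0Pn; case/or3P: (atom_is_part A).
- by case/existsP=> S /andP[_ /existsP[u /and5P[]]].
- move/(proper_partP G_conn)=> [b [u [v [K [sP ->]]]]].
  have [_ _ _ _ [y [_ _ EK _]]] := sP.
  have yK : inl y \in K by rewrite EK inE conn_refl.
  by have [f _ fK] := proper_touch sP yK; apply/set0Pn; exists f; rewrite inE.
case/existsP=> u /existsP[v /and4P[_ /eqP -> j _]] /=.
apply: contraTneq j => ->; rewrite (_ : _ @: _ = set0) ?cards0 //.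
by apply/setP=> x; rewrite inE; apply/imsetP=> -[d]; rewrite inE.
Qed.

Lemma boundary_dart A v : v \in (val A).2 -> exists2 f, f \in (val A).1.2 & inc f = Some v.
Proof.
have [_ [rho rho_center] _] := G_centered.
case: (part_shape G_conn rho_center (atom_is_part A)).
- case=> w [K [sP /existsP[d dK] _ ->]] /set1P ->.
  have [f fw df] := to_vert G_conn (isT : inr d != inl w); exists f => //.
  by rewrite inE; apply: (block_side_closed sP) dK df.
- case=> b [u [u' [K [sP ->]]]]; have [_ _ _ _ [y [_ _ EK _]]] := sP.
  have yK : inl y \in K by rewrite EK inE conn_refl.
  case/set2P=> ->.
    by have [f fu fK] := proper_touch sP yK; exists f; rewrite ?inE.
  by have [f fu fK] := proper_touch (proper_side_sym sP) yK; exists f; rewrite ?inE.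
case=> a [b [ab _ EA]]; have [d] := atom_dart A; rewrite EA /= => dj /set2P vE.
have fj : flip d \in joining a b by move: dj; rewrite !inE flipK orbC andbC [X in _ || X]andbC.
move: (dj); rewrite inE => /orP[] /andP[/eqP h1 /eqP h2]; case: vE => ->;
  by [exists d | exists (flip d)].
Qed.

(** For a proper atom this is a dart of the cut block at an inner vertex, which no single vertex
    separates from the boundary. It serves as the representative of the new edge in
    [kept_separator]. *)
Lemma spanning_dart A : exists2 d, d \in (val A).1.2 &
  #|(val A).2| = 2 -> forall v w, v \in (val A).2 -> w \in (val A).1.1 -> w \notin (val A).2 ->
    conn [set w] (inr d) (inl v).
Proof.
have [_ [rho rho_center] _] := G_centered; have [d0 d0A] := atom_dart A.
case: (part_shape G_conn rho_center (atom_is_part A)).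
- by case=> w [K [_ _ _ E]]; exists d0; rewrite // E /= cards1.
- case=> b [u [v [K [sP E]]]]; have [uv [ub vb] _ _ [y [yb yU EK _]]] := sP.
  have yK : inl y \in K by rewrite EK inE conn_refl.
  have [d bd dy] := mem_cls1 _ _ yb.
  have dK : inr d \in K by apply: (proper_closed sP) yK (connC (conn_inc dy yU)).
  exists d; first by rewrite E inE.
  move=> _ a w; rewrite E => aU _ wU; apply: (@items_clsP2 _ b); rewrite ?in_items ?mem_cls2
    //.
    by case/set2P: aU => ->.
  by apply: contraNneq wU => -[<-].
by case=> a [b [_ _ E]]; exists d0 => // _ v w _; rewrite E => /= ->.
Qed.

Lemma proper_all_conn u v b K w z1 z2 : proper_side b u v K -> inl w \notin K ->
  z1 \in K -> z2 \in K -> conn [set w] z1 z2.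
Proof.
move=> sP wK h1 h2; apply: conn_switch (proper_conn sP h1 h2) => -[a|//] ya /=.
rewrite inE; apply: contraNneq wK => <-; exact: proper_closed sP _ _ h1 ya.
Qed.

(** * Separation from a central block by surviving vertices *)

Section BlockCenter.
Variable r : dart G.
Hypothesis r_center : center G = cls r.

Let r_rep : represents (inr r : vert G + dart G) := r_center.

(** A kept vertex is not interior, so its deletion leaves the darts of an atom joined to each other.
    The exception is a block atom attached at [w], none of whose darts is on the side of the
    center. *)
Lemma all_or_nothing A w d1 d2 : kept_vert w -> d1 \in (val A).1.2 -> d2 \in (val A).1.2 ->
  conn [set w] (inr r) (inr d1) -> conn [set w] (inr r) (inr d2).
Proof.
move=> kw h1 h2; have nw : w \in (val A).1.1 -> w \in (val A).2.
  by move=> wA; apply: contraT => nwA; rewrite (negPf (interior_not_kept wA nwA)) in kw.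
case: (part_shape G_conn r_rep (atom_is_part A)).
- case=> x [K [sP _ _ E]]; rewrite E !inE in h1 h2 nw.
  have [[xK clK rK] _] := sP.
  have [wx | wx] := eqVneq w x.
    by subst x => /connC rd; case/negP: rK; apply: clK h1 rd.
  have wK : inl w \notin K by apply/negP=> wK; move: nw; rewrite wK orbT (negPf wx) => /(_
    isT).
  have tox d : inr d \in K -> conn [set w] (inr d) (inl x).
    move=> dK; have [f fx df] := to_vert G_conn (isT : inr d != inl x).
    apply: conn_trans (conn_inc fx _); last by rewrite inE eq_sym.
    apply: conn_switch df => -[a|//] da /=; rewrite inE; apply: contraNneq wK => <-.
    exact: clK dK da.
  by move=> h; apply: conn_trans h (conn_trans (tox _ h1) (connC (tox _ h2))).
- case=> b [u [v [K [sP E]]]]; rewrite E !inE in h1 h2 nw.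
  have wK : inl w \notin K.
    apply/negP=> wK; have := proper_off sP wK; rewrite /= !inE => /norP[wu wv].
    by move: nw; rewrite wK (negPf wu) (negPf wv) => /(_ isT).
  by move=> h; apply: conn_trans h (proper_all_conn sP wK h1 h2).
case=> a [b [ab _ E]]; rewrite E /= in h1 h2.
have ends_of (x : vert G) d : x \in [set a; b] -> d \in joining a b -> inc d = Some x \/ inc
  (flip d) = Some x.
  by move=> /set2P[] ->; rewrite inE => /orP[] /andP[/eqP e1 /eqP e2]; by [left | right].
have [x xab xw] : exists2 x : vert G, x \in [set a; b] & x != w.
  have [aw|aw] := eqVneq a w; last by exists a; rewrite ?inE ?eqxx.
  by exists b; rewrite ?inE ?eqxx ?orbT // -aw eq_sym.
have tox d : d \in joining a b -> conn [set w] (inr d) (inl x).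
  have xnw : x \notin [set w] by rewrite inE.
  by move=> /(ends_of _ _ xab)[] h; [apply: conn_inc | apply: conn_trans (conn_flip _ _)
    (conn_inc h xnw)].
by move=> h; apply: conn_trans h (conn_trans (tox _ h1) (connC (tox _ h2))).
Qed.

(** If the blocks differ, some [w] separates them. The central block then reaches the cut only
    through [w], and the component that contains one of its darts would contain all of its
    vertices. *)
Lemma center_proper b u v K f : proper_side b u v K -> inr f \in K -> eqd r f -> cls b = cls r.
Proof.
move=> sP fK rf; apply/eqP; apply: contraT => /eqP bb.
have [w nw] := cls_neq bb.
have [uv [ub vb] _ _ [y [yb yU EK nc]]] := sP.
have yK : inl y \in K by rewrite EK inE conn_refl.
have wf : conn [set w] (inr r) (inr f) by move/eqdP: rf; apply.
have nY a : a \in (cls b).1 -> ~~ conn [set w] (inr r) (inl a).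
  move=> ab; have [-> | aw] := eqVneq (inl a : vert G + dart G) (inl w).
    by apply/negP=> /notin_conn.
  apply: contra nw => ra; apply: conn_trans (connC ra); apply: items_cls_conn => //.
  by rewrite in_items.
have avoidU z : conn [set w] (inr r) z -> conn [set u; v] (inr r) z.
  apply: conn_switch => -[a|//] ra /=; apply/set2P=> -[] aE.
    by case/negP: (nY u ub); rewrite -aE.
  by case/negP: (nY v vb); rewrite -aE.
have [wU | wU] := boolP (w \in [set u; v]).
  case/negP: (nY y yb); apply: conn_trans wf _.
  apply: (conn_sub (W := [set u; v])); first by rewrite sub1set.
  exact: proper_conn sP _ _ fK yK.
have [g gw rg] := to_vert G_conn (isT : inr r != inl w).
have rK : inr r \in K by apply: (proper_closed sP) fK (connC (avoidU _ wf)).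
have wK : inl w \in K.
  by apply: (proper_closed sP) rK (conn_trans (avoidU _ rg) (conn_inc gw wU)).
case/negP: nc; apply/subsetP=> a; rewrite r_center => ar; rewrite inE.
have [-> // | aw] := eqVneq a w; apply: (proper_closed sP) rK (avoidU _ _).
by apply: items_cls_conn; [rewrite in_items | apply: contraNneq aw => -[->]].
Qed.

(* A separating vertex in the interior of a block atom is replaced by the
   boundary of that atom; one in the interior of a proper atom would leave the
   boundary on the side of [d] and hence the center inside the atom. *)
Lemma kept_separator d : ~~ eqd r d ->
  kept_dart d \/ (exists2 A : atom G, d \in (val A).1.2 &
     #|(val A).2| = 2 -> forall v w, v \in (val A).2 -> w \in (val A).1.1 ->
        w \notin (val A).2 -> conn [set w] (inr d) (inl v)) ->
  exists2 w, kept_vert w & ~~ conn [set w] (inr r) (inr d).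
Proof.
move=> nrd dP; have [w nw] : exists w, ~~ conn [set w] (inr r) (inr d).
  by apply/existsP; rewrite -negb_forall.
have [kw | /kept_vertPn[A wA nwA]] := boolP (kept_vert w); first by exists w.
case: (part_shape G_conn r_rep (atom_is_part A)).
- case=> x [K [sP _ _ E]]; rewrite E !inE in wA nwA; rewrite (negPf nwA) /= in wA.
  have [[xK clK rK] _] := sP.
  have kx : kept_vert x by apply: (boundary_kept G_centered (A := A)); rewrite E inE.
  exists x => //; apply: contra (rK) => rd.
  (* Otherwise both [r] and [d] reach [x] outside [K], hence without meeting [w], and [w] would not
     separate them. *)
  have dK : inr d \in K.
    apply: contraT => dK; case/negP: nw.
    have noK v : v \in [set w] -> inl v \in K by move/set1P ->.
    have xw : x \notin [set w] by rewrite inE eq_sym.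
    apply: conn_trans (conn_outside G_conn clK noK xw rK) _.
    exact/connC/(conn_outside G_conn clK noK xw dK).
  exact: clK dK (connC rd).
- case=> b [u [v [K [sP E]]]]; have [uv [ub vb] _ _ [y [yb yU EK nc]]] := sP.
  have wK : inl w \in K.
    by move: wA nwA; rewrite E in_setU /= => /orP[-> // | ]; rewrite inE.
  have wU := proper_off sP wK.
  have uw : u != w by apply: contraNneq wU => <-; rewrite !inE eqxx.
  have vw : v != w by apply: contraNneq wU => <-; rewrite !inE eqxx orbT.
  have uvw : conn [set w] (inl u) (inl v).
    apply: (@items_clsP2 _ b); rewrite ?in_items //.
  (* If [d] reaches the boundary without [w], then [r] does not. So [r] reaches [w] without crossing
     the cut, and the central block lies in [K]. *)
  have [du | ndu] := boolP (conn [set w] (inr d) (inl u)).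
    case/negP: nc; have rK : inr r \in K.
      have [f fw rf] := to_vert G_conn (isT : inr r != inl w).
      apply: (proper_closed sP) wK (connC (conn_trans _ (conn_inc fw wU))).
      apply: conn_switch rf => -[a|//] ra /=; apply/set2P=> aE; case/negP: nw.
      apply: conn_trans ra (connC _).
      by case: aE => ->; [ | apply: conn_trans uvw].
    apply/subsetP=> a; rewrite r_center => ar; rewrite inE.
    have [-> // | aw] := eqVneq a w; apply: (proper_closed sP) rK _.
    have : conn [set w] (inr r) (inl a).
      by apply: items_cls_conn; [rewrite in_items | apply: contraNneq aw => -[->]].
    apply: conn_switch => -[a'|//] ra /=; apply/set2P=> aE; case/negP: nw.
    apply: conn_trans ra (connC _).
    by case: aE => ->; [ | apply: conn_trans uvw].
  (* Now [d] is cut off from the boundary by [w], so it lies in [K] and is not kept. It is thus the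
     representative chosen for this very atom, which no inner vertex separates from the boundary. *)
  have dK : inr d \in K.
    have [f fw df] := to_vert G_conn (isT : inr d != inl w).
    apply: (proper_closed sP) wK (connC (conn_trans _ (conn_inc fw wU))).
    apply: conn_switch df => -[a|//] da /=; apply/set2P=> -[] aE; case/negP: ndu.
      by rewrite -aE.
    by apply: conn_trans da _; rewrite aE; apply: connC.
  have dA : d \in (val A).1.2 by rewrite E inE.
  case: dP => [kd | [A0 dA0]]; first by rewrite (negPf (dart_not_kept dA)) in kd.
  rewrite -(atom_eq_dart G_centered dA dA0) => span.
  by case/negP: ndu; apply: span; rewrite ?E ?cards2 ?uv // ?inE ?eqxx // wK orbT.
by case=> a [b [_ _ E]]; rewrite E /= in wA nwA; rewrite wA in nwA.
Qed.

End BlockCenter.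

End ReducedCenter.

(** * Connectivity of the reduced graph and its center *)

Section ReducedConnectivity.
Variables (G : centered_graph) (c : choices G).
Hypothesis G_centered : well_centered G.
Implicit Types (A B : atom G) (v w : vert G) (d f : dart G) (e : new_dart G)
  (z : vert G + dart G) (W : {set vert (reduction c)}) (u : red_vert G).

Let G_conn x y : conn (G := G) set0 x y.
Proof. by have [h _ _] := G_centered; apply: h. Qed.

(** A relation instead of a function, since both darts of a new edge stand for the darts and the
    interior vertices of its atom. *)
Definition lifts z (z' : red_vert G + red_dart G) : Prop :=
  match z' with
  | inl u => z = inl (val u)
  | inr (inl d) => z = inr (val d)
  | inr (inr e) =>
    match z with
    | inl v => v \in (val (val e).1).1.1 /\ v \notin (val (val e).1).2
    | inr d => d \in (val (val e).1).1.2
    end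
  end.

Lemma lift_exists z : exists z' : red_vert G + red_dart G, lifts z z'.
Proof.
have new A : exists e, (val e).1 = A.
  have [v vA] := set0Pn _ (atom_boundary_neq0 A).
  by have [e eA _] := atom_end vA; exists e.
case: z => [v|d].
  have [kv | /kept_vertPn[A vA nvA]] := boolP (kept_vert v).
    by exists (inl (Sub v kv)).
  by have [e eA] := new A; exists (inr (inr e)); rewrite /= eA.
have [kd | /kept_dartPn[A dA]] := boolP (kept_dart d).
  by exists (inr (inl (Sub d kd))).
by have [e eA] := new A; exists (inr (inr e)); rewrite /= eA.
Qed.

Lemma exists_lift (z' : red_vert G + red_dart G) : exists z : vert G + dart G, lifts z z'.
Proof.
case: z' => [u|[d|e]]; [by exists (inl (val u)) | by exists (inr (val d)) | ].
by have [d dA] := atom_dart G_centered (val e).1; exists (inr d).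
Qed.

Lemma red_inc_some (x : red_dart G) u : red_inc x = Some u ->
  match x with inl d => inc (val d) | inr e => (val e).2 end = Some (val u).
Proof.
have some_val (y : option (vert G)) : obind insub y = Some u -> y = Some (val u).
  by case: y => [v|] //=; case: insubP => //= u' _ <- [->].
by case: x => [d|e] /some_val.
Qed.

Lemma same_atom_conn W e e' : (val e).1 = (val e').1 ->
  conn (G := reduction c) W (inr (inr e)) (inr (inr e')).
Proof.
case/ends_cases=> ->; first exact: conn_refl.
exact: (conn_flip (G := reduction c) W (inr e)).
Qed.

Lemma boundary_conn W e u : val u \in (val (val e).1).2 -> u \notin W ->
  conn (G := reduction c) W (inr (inr e)) (inl u).
Proof.
move=> uA uW; have [e' e'A e'E] := atom_end uA.
apply: conn_trans (same_atom_conn W (esym e'A)) (conn_inc _ uW).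
by rewrite /= /red_inc e'E /= valK.
Qed.

Lemma lifts_inc W d v a' b' : inc d = Some v -> v \notin val @: W ->
  lifts (inr d) a' -> lifts (inl v) b' -> conn (G := reduction c) W a' b'.
Proof.
move=> dv vW; case: a' => [u|[d0|e]] //=; case: b' => [u|[d1|e']] //=.
- move=> [dE] [vE]; subst d v; apply: conn_inc; first by rewrite /= /red_inc dv /= valK.
  by apply: contra vW => uW; apply: imset_f.
- move=> [dE] [vA nvA]; have := dart_not_kept (atom_interior G_centered dv vA nvA).
  by rewrite dE (valP d0).
- move=> dA [vE]; subst v; have [_ incA _] := atom_regular G_centered (val e).1.
  have uA := incA _ _ dv dA; apply: boundary_conn; last first.
    by apply: contra vW => uW; apply: imset_f.
  by apply: contraT => nuA; have := interior_not_kept uA nuA; rewrite (valP u).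
- move=> dA [vA nvA]; apply: same_atom_conn.
  have [_ incA _] := atom_regular G_centered (val e).1.
  by rewrite (atom_eq_vert G_centered vA nvA (incA _ _ dv dA)).
Qed.

Lemma lifts_flip W d a' b' : lifts (inr d) a' -> lifts (inr (flip d)) b' ->
  conn (G := reduction c) W a' b'.
Proof.
case: a' => [u|[d0|e]] //=; case: b' => [u|[d1|e']] //=.
- move=> [dE] [fE]; have -> : d1 = old_flip d0 by apply: val_inj; rewrite /= -fE dE.
  exact: (conn_flip (G := reduction c) W (inl d0)).
- move=> [dE] fA; have [flA _ _] := atom_regular G_centered (val e').1.
  by have := dart_not_kept (flA _ fA); rewrite flipK dE (valP d0).
- move=> dA [fE]; have [flA _ _] := atom_regular G_centered (val e).1.
  by have := dart_not_kept (flA _ dA); rewrite fE (valP d1).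
- move=> dA fA; apply: same_atom_conn; have [flA _ _] := atom_regular G_centered (val e).1.
  exact: (atom_eq_dart G_centered (flA _ dA) fA).
Qed.

Lemma lifts_same W z a' b' : lifts z a' -> lifts z b' -> conn (G := reduction c) W a' b'.
Proof.
case: a' => [u|[d0|e]] /=; case: b' => [u'|[d1|e']] /=; try by [move=> -> | move=> ? ->].
- by move=> -> [/val_inj ->]; apply: conn_refl.
- by move=> -> [h1 h2]; have := interior_not_kept h1 h2; rewrite (valP u).
- by move=> -> [/val_inj ->]; apply: conn_refl.
- by move=> -> h; have := dart_not_kept h; rewrite (valP d0).
- by move=> + zE; rewrite zE => -[h1 h2]; have := interior_not_kept h1 h2; rewrite (valP u').
- by move=> + zE; rewrite zE => h; have := dart_not_kept h; rewrite (valP d1).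
case: z => [v [h1 h2] [h3 _]|d h1 h2]; apply: same_atom_conn.
  exact: (atom_eq_vert G_centered h1 h2 h3).
exact: (atom_eq_dart G_centered h1 h2).
Qed.

(** A walk of [G] projects to the reduced graph: a stretch inside an atom collapses to its new edge,
    whose two darts are joined by [flip] whatever is deleted. *)
Lemma lifts_conn W z1 z2 a' b' : conn (val @: W) z1 z2 ->
  lifts z1 a' -> lifts z2 b' -> conn (G := reduction c) W a' b'.
Proof.
move=> h l1 l2.
pose P z := forall z' : red_vert G + red_dart G, lifts z z' -> conn (G := reduction c) W a' z'.
suff: P z2 by apply.
apply: connect_ind h; first by move=> z'; apply: lifts_same.
move=> x y _ xy Px y' ly; have [x' lx] := lift_exists x.
apply: conn_trans (Px _ lx) _.
case: x y xy lx ly {Px} => [v|d] [v'|d'] //=.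
- by case/andP=> vW /eqP dv lx ly; apply: connC; apply: lifts_inc dv vW ly lx.
- by case/andP=> vW /eqP dv lx ly; apply: lifts_inc dv vW lx ly.
- by move/eqP->; apply: lifts_flip.
Qed.

Lemma reduction_conn x y : conn (G := reduction c) set0 x y.
Proof.
have [z1 l1] := exists_lift x; have [z2 l2] := exists_lift y.
by apply: lifts_conn l1 l2; rewrite imset0.
Qed.

Section BlockCenter.
Variable r : dart G.
Hypothesis r_center : center G = cls r.

Let r_rep : represents (inr r : vert G + dart G) := r_center.

Definition reached w (z' : red_vert G + red_dart G) : Prop :=
  match z' with
  | inl u => conn [set w] (inr r) (inl (val u)) : Prop
  | inr (inl d) => conn [set w] (inr r) (inr (val d))
  | inr (inr e) => forall d, d \in (val (val e).1).1.2 -> conn [set w] (inr r) (inr d)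
  end.

(** A walk along a new edge can be followed in [G] only if the atom joins its ends after the
    deletion. For walks from the center [all_or_nothing] ensures this, which is why [reached] asks
    for all darts of the atom. *)
Lemma conn_lifted u (r' : red_dart G) (z' : red_vert G + red_dart G) :
  lifts (inr r) (inr r') -> conn (G := reduction c) [set u] (inr r') z' ->
  reached (val u) z'.
Proof.
move=> lr h; pose P := reached (val u).
change (P z'); apply: connect_ind h.
  case: r' lr => [d0 /= [<-]|e /= rA d dA]; first exact: conn_refl.
  exact: (all_or_nothing G_centered r_center (valP u) rA dA (conn_refl _ _)).
have nu (u' : red_vert G) : u' \notin [set u] -> val u' \notin [set val u].
  by rewrite !inE.
have endf e u' : (val e).2 = Some (val u') ->
    exists2 f, f \in (val (val e).1).1.2 & inc f = Some (val u').
  by move=> E; apply: (boundary_dart G_centered); rewrite -some_ends -E; apply: (valP e).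
move=> [u1|[d|e]] [u2|[d'|e']] _ //=.
- case/andP=> /nu h1 /eqP/red_inc_some dv h; exact: conn_trans h (connC (conn_inc dv h1)).
- case/andP=> /nu h1 /eqP/red_inc_some/endf[f fA fu] h d0 d0A.
  apply: (all_or_nothing G_centered r_center (valP u) fA d0A).
  exact: conn_trans h (connC (conn_inc fu h1)).
- case/andP=> /nu h1 /eqP/red_inc_some dv h; exact: conn_trans h (conn_inc dv h1).
- by move=> /eqP [->] h; apply: conn_trans h (conn_flip _ _).
- by case/andP=> /nu h1 /eqP/red_inc_some/endf[f fA fu] /(_ _ fA) h; apply: conn_trans h
  (conn_inc fu h1).
- by move=> /eqP [->].
Qed.

(** Equivalence to [r] passes to the reduced graph by [lifts_conn]. A dart outside the image of the
    center is separated from it by a kept vertex, and this separation persists by [conn_lifted]. *)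
Lemma red_center_cls : exists r', red_center c = cls (G := reduction c) r'.
Proof.
have [r' lr] : exists r', lifts (inr r) (inr r').
  by have [[u|r'] // lr] := lift_exists (inr r); exists r'.
have memC d : (d \in (center G).2) = eqd r d by rewrite r_center mem_cls2.
have center_inc d v : eqd r d -> inc d = Some v -> v \in (center G).1.
  by move=> rd dv; rewrite r_center; apply/mem_cls1; exists d.
have E2 x' : (x' \in (red_center c).2) = eqd (G := reduction c) r' x'.
  apply/idP/idP => [xC | rx].
    have [d rd lx] : exists2 d, eqd r d & lifts (inr d) (inr x').
      move: xC; rewrite inE; case: x' => [d|e].
        by rewrite memC => rd; exists (val d).
      by case/set0Pn=> d; rewrite inE memC => /andP[dA rd]; exists d.
    apply/eqdP=> u; apply: lifts_conn lr lx; rewrite imset_set1.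
    by move/eqdP: rd; apply.
  apply: contraT => xC.
  have [d nrd [dP lx]] : exists2 d, ~~ eqd r d &
    (kept_dart d \/ (exists2 A : atom G, d \in (val A).1.2 &
     #|(val A).2| = 2 -> forall v w, v \in (val A).2 -> w \in (val A).1.1 ->
        w \notin (val A).2 -> conn [set w] (inr d) (inl v))) /\ lifts (inr d) (inr x').
    case: x' xC {rx} => [d|e] xC.
      exists (val d); last by split=> //; left; apply: (valP d).
      by rewrite -memC; apply: contra xC; rewrite inE.
    have [d dA span] := spanning_dart G_centered (val e).1; exists d.
      rewrite -memC; apply: contra xC => dC; rewrite inE; apply/set0Pn; exists d.
      by rewrite inE dA.
    by split=> //; right; exists (val e).1.
  have [w kw] := kept_separator G_centered r_center nrd dP; case/negP.
  have := conn_lifted lr (elimT (eqdP _ _) rx (Sub w kw)).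
  by case: x' lx {rx xC} => [d0|e] /= => [[->] | dA]; [ | apply].
exists r'; apply: injective_projections; last by apply/setP=> x'; rewrite E2 mem_cls2.
apply/setP=> u; rewrite [LHS]inE; apply/idP/mem_cls1 => [|[x' rx /red_inc_some xu]].
  rewrite {1}r_center => /mem_cls1[f rf fu].
  have [kf | /kept_dartPn[A fA]] := boolP (kept_dart f).
    exists (inl (Sub f kf)); first by rewrite -E2 inE memC.
    by rewrite /= /red_inc /= fu /= valK.
  have [_ incA _] := atom_regular G_centered A; have uA := incA _ _ fu fA.
  have uB : val u \in (val A).2.
    by apply: contraT => nuA; have := interior_not_kept uA nuA; rewrite (valP u).
  have [e eA eu] := atom_end uB; exists (inr e).
    by rewrite -E2 inE; apply/set0Pn; exists f; rewrite inE eA fA memC.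
  by rewrite /= /red_inc /= eu /= valK.
move: rx xu; rewrite -E2 inE; case: x' => [d|e].
  by rewrite memC; apply: center_inc.
case/set0Pn=> f; rewrite inE memC => /andP[fA rf] eu.
have uB : val u \in (val (val e).1).2 by rewrite -some_ends -eu; apply: (valP e).
move: (val u) uB {eu} => a0 uB.
(* The atom contains a dart [f] of the central block. A block atom is excluded, as it avoids the
   center; the cut of a proper atom lies in the central block by [center_proper]; a dart of a dipole
   carries both boundary vertices. *)
case: (part_shape G_conn r_rep (atom_is_part (val e).1)).
- case=> w [K [sP _ _ E]]; rewrite E inE in fA; have [[_ clK rK] _] := sP.
  by case/negP: rK; apply: clK fA (connC _); move/eqdP: rf; apply.
- case=> b [u1 [u2 [K [sP E]]]]; rewrite E inE in fA; rewrite E in uB.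
  have [_ [ub vb] _ _ _] := sP; rewrite r_center -(center_proper G_centered r_center sP fA rf).
  by case/set2P: uB => ->.
case=> a [b [_ _ E]]; rewrite E /= in fA uB.
have rf' := eqd_trans rf (eqd_flip f).
move: fA; rewrite inE => /orP[] /andP[/eqP h1 /eqP h2]; case/set2P: uB => ->;
  by [apply: center_inc rf h1 | apply: center_inc rf' h2 | apply: center_inc rf' h1 | apply:
    center_inc rf h2].
Qed.

End BlockCenter.

Lemma red_center_vertex v : center G = vertex_node v -> exists u, red_center c = vertex_node
  (G := reduction c) u.
Proof.
move=> cv; have v_rep : represents (inl v : vert G + dart G) by [].
have kv : kept_vert v.
  apply: contraT => /kept_vertPn[A vA nvA].
  case: (part_shape G_conn v_rep (atom_is_part A)).
  - case=> w [K [[[_ _ vK] _] _ _ E]]; rewrite E !inE in vA nvA.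
    by rewrite (negPf nvA) (negPf vK) in vA.
  - case=> b [u1 [u2 [K [[_ _ _ _ [y [_ _ _ nc]]] E]]]]; rewrite E in_setU in vA.
    rewrite E /= in nvA; rewrite (negPf nvA) /= in vA.
    by case/negP: nc; rewrite cv /= sub1set.
  by case=> a [b [_ _ E]]; rewrite E /= in vA nvA; rewrite vA in nvA.
exists (Sub v kv); apply: injective_projections; apply/setP=> x; rewrite !inE cv /=.
  by rewrite inE -(inj_eq val_inj).
case: x => [d|e]; first by rewrite inE.
by rewrite setI0 eqxx.
Qed.

Lemma reduction_represents : exists rho, @represents (reduction c) rho.
Proof.
have [_ [[v|r] /= E] _] := G_centered.
  by have [u Eu] := red_center_vertex E; exists (inl u).
by have [r' Er] := red_center_cls E; exists (inr r').
Qed.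

Hypothesis c_valid : valid_choices c.

Lemma reduction_center_fixed (q : autT (reduction c)) : q \in AutG (reduction c) ->
  aut_piece q (center (reduction c)) = center (reduction c).
Proof.
move=> qR; have [p pG [h1 h2 h3]] := induces_surjective G_centered c_valid qR.
have [_ _ /(_ _ pG) cE] := G_centered.
have c1 v : (p.1 v \in (center G).1) = (v \in (center G).1).
  by rewrite -{1}cE (mem_imset _ _ perm_inj).
have c2 d : (p.2 d \in (center G).2) = (d \in (center G).2).
  by rewrite -{1}cE (mem_imset _ _ perm_inj).
apply: injective_projections; apply/setP=> x.
  rewrite -[x](permKV q.1) (mem_imset _ _ perm_inj); set u := (q.1^-1)%g x.
  by rewrite [LHS]inE [RHS]inE h1 c1.
rewrite -[x](permKV q.2) (mem_imset _ _ perm_inj); set u := (q.2^-1)%g x.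
rewrite [LHS]inE [RHS]inE; case: u => [d|e].
  by have [d' -> ->] := h2 d; rewrite c2.
have [e' -> [-> _]] := h3 e; rewrite /part_image /=.
have -> : p.2 @: (val (val e).1).1.2 :&: (center G).2 = p.2 @: ((val (val e).1).1.2 :&:
  (center G).2).
  by rewrite imsetI; [rewrite -{1}cE | move=> ? ? _ _; apply: perm_inj].
by rewrite imset_eq0.
Qed.

Lemma well_centered_reduction : well_centered (reduction c).
Proof.
split; [exact: reduction_conn | exact: reduction_represents | exact: reduction_center_fixed].
Qed.

End ReducedConnectivity.

(** * The reduction series *)

Section Base.
Variable G : graph.
Hypothesis G_conn : forall x y, conn (G := G) set0 x y.

Lemma aut_tree_ball (p : autT G) S T n : p \in AutG G ->
  (aut_piece p T \in tree_ball (block_tree_nodes G) (aut_piece p S) n) =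
  (T \in tree_ball (block_tree_nodes G) S n).
Proof.
move=> pG; elim: n T => [|n IH] T /=.
  by rewrite !in_set1 (inj_eq (@aut_piece_inj _ p)).
rewrite !in_setU IH; congr orb; rewrite !in_set.
apply: exists_inj (@aut_piece_inj _ p) _ => R.
by rewrite IH aut_tree_edge // => T'; apply: aut_block_tree_nodes.
Qed.

Lemma aut_central_node (p : autT G) C : p \in AutG G -> central_node C -> central_node
  (aut_piece p C).
Proof.
move=> pG [CN hC]; split; first by rewrite aut_block_tree_nodes.
move=> S n SN /(hC S n SN)/subsetP sC; apply/subsetP=> T TN.
have pG' : (p^-1)%g \in AutG G by rewrite groupV.
have <- : aut_piece p (aut_piece p^-1%g T) = T by rewrite -{1}[p]invgK aut_pieceK.
by rewrite aut_tree_ball // sC // aut_block_tree_nodes.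
Qed.

End Base.

(** An automorphism permutes the central nodes of the block-tree, and there is only one. *)
Lemma well_centered_admissible (G : centered_graph) : admissible G -> is_center (center G) ->
  well_centered G.
Proof.
case=> cG _ _ _ cC.
have G_conn x y : conn (G := G) set0 x y.
  move/forallP/(_ x): cG; have -> : x \in items whole by case: x => a; rewrite !inE.
  move/forallP/(_ y); have -> /= : y \in items whole by case: y => a; rewrite !inE.
  by rewrite -connE remove0.
split=> //.
  move: cC; rewrite /is_center; case: ifP => [/andP[/eqP V1 _] cE | _ [[+ _] _]].
    have /cards1P[v vE] : #|[set: vert G]| == 1 by rewrite cardsT V1.
    by exists (inl v); rewrite /= cE vE.
  rewrite in_setU inE => /orP[/(blockP G_conn)[d dE] | /imsetP[v _ vE]].
    by exists (inr d).
  by exists (inl v).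
move=> p pG; move: cC; rewrite /is_center; case: ifP => [_ -> | _ [cC uC]].
  rewrite /aut_piece /= imset0; congr (_, _); apply/setP=> v.
  by rewrite -[v](permKV p.1) (mem_imset _ _ perm_inj) !inE.
exact/uC/aut_central_node.
Qed.

(** * The homomorphism of one reduction step *)

Section StepTheorem.
Variables (G : centered_graph) (c : choices G).
Hypothesis G_centered : well_centered G.
Hypothesis c_valid : valid_choices c.
Implicit Types (p : autT G) (q : autT (reduction c)).

(** A graph that is not primitive has an atom, and a boundary vertex of it survives the reduction.
    In a semiregular group this makes the kernel trivial. *)
Lemma induces1 p : ~~ primitive G -> induces (c := c) p 1%g -> exists v, p.1 v = v.
Proof.
rewrite negb_forall => /existsP[P]; rewrite negbK => aP [h _ _].
have [v vA] := set0Pn _ (atom_boundary_neq0 (Sub P aP : atom G)).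
exists v; have := h (Sub v (boundary_kept G_centered vA)).
by rewrite perm1.
Qed.

Lemma semiregularP (H : graph) (Gamma : {group autT H}) : reflect
  (forall p : autT H, p \in Gamma -> p <> 1%g ->
     [/\ forall v, p.1 v <> v, forall d, p.2 d <> d
       & forall d, etype d <> Halvable -> p.2 d <> flip d])
  (semiregular Gamma).
Proof.
apply: (iffP forallP) => [h p pG /eqP p1 | h p].
  move: (h p); rewrite pG p1 /= => /and3P[/forallP h1 /forallP h2 /forallP h3].
  split=> [v|d|d dH E]; [exact/eqP | exact/eqP | ].
  by move/implyP: (h3 d) => /(_ (introN eqP dH)); rewrite E !inE eqxx orbT.
apply/implyP=> pG; apply/implyP=> /eqP p1; have [h1 h2 h3] := h p pG p1.
apply/and3P; split; apply/forallP=> x; try exact/eqP.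
apply/implyP=> /eqP xH; rewrite !inE; apply/norP; split; apply/eqP; [exact: h2 | exact: h3].
Qed.

Lemma swap_halvable p (A : atom G) : p \in AutG G ->
  (forall v, p.1 v <> v) -> (forall d, p.2 d <> d) ->
  (forall d, etype d <> Halvable -> p.2 d <> flip d) ->
  (p * p)%g = 1%g -> part_image p (val A) = val A -> halvable (val A).
Proof.
move=> pG h1 h2 h3 pp pA; apply/(halvableP (atom_regular G_centered A) (atom_boundary_neq0 A)).
exists p.1, p.2; split.
- split; first by rewrite -{2}pA; apply: aut_part_map.
  by move=> w _; apply/eqP/h1.
- move=> w _; split; last exact/eqP/h1.
  by rewrite -permM -[(p.1 * p.1)%g]/((p * p)%g.1) pp perm1.
- move=> d _; split; [ | exact/eqP/h2 | by move/eqP=> dH; apply/eqP/h3].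
  by rewrite -permM -[(p.2 * p.2)%g]/((p * p)%g.2) pp perm1.
Qed.

(** The last hypothesis is semiregularity at the square of [p]: if [p] reverses a new edge, its
    square fixes a vertex and must be trivial, so [p] itself halves the atom. *)
Lemma induces_semiregular p q : p \in AutG G -> induces p q ->
  (forall v, p.1 v <> v) -> (forall d, p.2 d <> d) ->
  (forall d, etype d <> Halvable -> p.2 d <> flip d) ->
  ((p * p)%g <> 1%g -> forall v, (p * p)%g.1 v <> v) ->
  [/\ forall v, q.1 v <> v, forall d, q.2 d <> d
    & forall d, etype d <> Halvable -> q.2 d <> flip d].
Proof.
move=> pG [i1 i2 i3] h1 h2 h3 hp.
have image_fix (A : atom G) : part_image p (val A) = val A ->
    forall v, v \in (val A).2 -> p.1 v \in (val A).2.
  by move=> pA v vA; rewrite -pA; apply: imset_f.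
(* A fixed new dart has a fixed end, or it is the free dart of a pendant edge; then [p] preserves
   the block atom and fixes its only boundary vertex. *)
have no_fix e : q.2 (inr e) <> inr e.
  have [e' -> [eA eE]] := i3 e; case=> E; subst e'.
  have := valP e; case Ex: (val e).2 eE => [v|] //= eE; first by case: eE => /esym/h1.
  rewrite /ends in_setU => /orP[/imsetP[] //|]; case: ifP; rewrite ?inE // => /cards1P[u Eu] _.
  have := image_fix _ (esym eA) u; rewrite Eu !inE eqxx => /(_ isT)/eqP; exact: h1.
split.
- by move=> u E; apply: (h1 (val u)); rewrite -i1 E.
- by case=> [d|e]; [have [d' -> dE] := i2 d; case=> E; apply: (h2 (val d)); rewrite -dE E |
  apply: no_fix].
case=> [d|e] /= ty.
  by have [d' -> dE] := i2 d; case=> E; apply: (h3 (val d) ty); rewrite -dE E.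
have [e' -> [eA eE]] := i3 e; case=> E; subst e'; rewrite /= in eA eE.
have [Ee n] := other_endP (atom_part (val e).1) (valP e).
rewrite eE in Ee n; case Ex: (val e).2 Ee n => [v|] //= Ee _.
have vA : v \in (val (val e).1).2 by rewrite -some_ends Ee !inE eqxx.
have pvA : p.1 v \in (val (val e).1).2 by rewrite -some_ends Ee !inE eqxx orbT.
(* The boundary consists of [v] and its image and is preserved by [p], which has no fixed vertex. *)
have ppv : p.1 (p.1 v) = v.
  have := image_fix _ (esym eA) _ pvA; rewrite -some_ends Ee => /set2P[[] // | []].
  by move/h1.
have pp : (p * p)%g = 1%g.
  apply/eqP; apply: contraT => /eqP/hp/(_ v) /=; by rewrite permM.
case: ty; rewrite /new_type (swap_halvable pG h1 h2 h3 pp (esym eA)).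
case: ifP => // /cards1P[w Ew]; move: vA pvA; rewrite Ew => /set1P -> /set1P.
by move/h1.
Qed.

Lemma reduction_morphism : ~~ primitive G ->
  exists Phi : {morphism AutG G >-> autT (reduction c)},
    [/\ forall p, p \in AutG G -> induces p (Phi p),
        (Phi @* AutG G)%g = AutG (reduction c) &
        forall (Gamma : {group autT G}) (sGamma : Gamma \subset AutG G),
          semiregular Gamma ->
          isom Gamma (Phi @* Gamma)%g (restrm sGamma Phi) /\
          semiregular (Phi @* Gamma)%g].
Proof.
move=> nprim.
(* A morphism is a total function on pairs of permutations, so some value, here 1, is needed outside
   [AutG G]. *)
have exq p : exists q, p \in AutG G -> q \in AutG (reduction c) /\ induces p q.
  have [pG | _] := boolP (p \in AutG G); last by exists 1%g.
  exists (induced c G_centered pG) => _; split; first exact: induced_aut.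
  exact: induced_induces.
have [phi phiP] := fin_all_exists exq.
have phiM : {in AutG G &, {morph phi : p p' / (p * p')%g}}.
  move=> p p' pG p'G; have [_ h] := phiP p pG; have [_ h'] := phiP p' p'G.
  have [_ hh] := phiP _ (groupM pG p'G).
  exact: induces_unique hh (induces_mul h h').
have [Phi PhiE] : exists Phi : {morphism AutG G >-> autT (reduction c)}, forall p, Phi p = phi
  p.
  by exists (Morphism phiM).
have PhiP p : p \in AutG G -> Phi p \in AutG (reduction c) /\ induces p (Phi p).
  by rewrite PhiE; apply: phiP.
clear phi phiP phiM PhiE.
exists Phi; split.
- by move=> p /PhiP[].
- apply/setP=> q; apply/morphimP/idP => [[p pG _ ->] | qR]; first by case: (PhiP p pG).
  have [p pG h] := induces_surjective G_centered c_valid qR; exists p => //.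
  by apply: induces_unique h _; case: (PhiP p pG).
move=> Gamma sGamma /semiregularP sr.
have ker p : p \in Gamma -> Phi p = 1%g -> p = 1%g.
  move=> pGa E; have [_] := PhiP p (subsetP sGamma p pGa); rewrite E.
  case/(induces1 nprim)=> v pv; apply/eqP; apply: contraT => /eqP p1.
  by have [/(_ v)] := sr p pGa p1.
split.
  apply/isomP; split; last by rewrite morphim_restrm setIid.
  apply/subsetP=> p /morphpreP[pGa /set1P E]; apply/set1P; exact: ker E.
apply/semiregularP=> _ /morphimP[p pG pGa ->] np1.
have p1 : p <> 1%g by move=> p1; apply: np1; rewrite p1 morph1.
have [h1 h2 h3] := sr p pGa p1.
apply: (induces_semiregular pG _ h1 h2 h3); first by case: (PhiP p pG).
move=> pp1; have [? _ _] := sr _ (groupM pGa pGa) pp1; assumption.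
Qed.

End StepTheorem.

Lemma well_centered_series (G : centered_graph) (c : forall H : centered_graph, choices H) r :
  admissible G -> is_center (center G) -> reduction_series c G r ->
  forall i, i <= r -> well_centered (reduction_step c G i).
Proof.
move=> aG cG [val_c _]; elim=> [|i IH] ir; first exact: well_centered_admissible.
by have [_ vc] := val_c i ir; apply: well_centered_reduction => //; apply/IH/ltnW.
Qed.

Theorem proposition4p1 (G : centered_graph)
    (G_admissible : admissible G) (G_center : is_center (center G))
    (c : forall H : centered_graph, choices H) (r : nat)
    (G_series : reduction_series c G r) (i : nat) (i_lt_r : i < r) :
  let Gi := reduction_step c G i in
  let Gi1 := reduction_step c G i.+1 in
  exists Phi : {morphism AutG Gi >-> autT Gi1},
    [/\ forall p, p \in AutG Gi -> @induces Gi (c Gi) p (Phi p),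
        (Phi @* AutG Gi)%g = AutG Gi1 &
        forall (Gamma : {group autT Gi}) (sGamma : Gamma \subset AutG Gi),
          semiregular Gamma ->
          isom Gamma (Phi @* Gamma)%g (restrm sGamma Phi) /\
          semiregular (Phi @* Gamma)%g].
Proof.
move=> Gi Gi1; have [np vc] := G_series.1 i i_lt_r.
apply: reduction_morphism => //.
exact: well_centered_series G_admissible G_center G_series i (ltnW i_lt_r).
Qed.
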